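(* Let $u_0\in C^1(\mathbb{R}^n;\mathbb{R}^n)\cap C_b(\mathbb{R}^n;\mathbb{R}^n)$, let $\rho_0\in L^1_{loc}(\mathbb{R}^n)$ be bounded, nonnegative and not almost everywhere zero, and let $t_*(u_0)\in(0,+\infty]$ be such that the solution of the Cauchy problem for the non-viscous Burgers equation $\partial_tu+(u,\nabla)u=0$, $u(x,0)=u_0(x)$, keeps the smoothness of $u_0$ for $0<t<t_*(u_0)$. Let $\rho_\sigma,u_\sigma$ be the functions defined in the context. Assume that the limits $$\rho(t,x)=\lim_{|\sigma|\to0}\rho_\sigma(t,x),\qquad \bar u(t,x)=\lim_{|\sigma|\to0}u_\sigma(t,x)$$ are $C^1$-smooth bounded functions for $(t,x)\in\Omega:=[0,t_*(u_0))\times\mathbb{R}^n$. Then $(\rho,\bar u)$ solves in $\Omega$ the pressureless gas dynamics system $$\partial_t\rho+\mathrm{div}_x(\rho\bar u)=0,\qquad \partial_t(\rho\bar u)+\nabla_x(\rho\,\bar u\otimes\bar u)=0.$$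
   Context: For $\sigma=(\sigma_1,\sigma_2)$ with $\sigma_1,\sigma_2\ge0$, $\sigma\ne0$, consider in $\mathbb{R}^n\times\mathbb{R}^n$ $$dX_k(t)=U_k(t)\,dt+\sigma_1\,d(W^1_k)_t,\qquad dU_k(t)=\sigma_2\,d(W^2_k)_t,\qquad k=1,\dots,n,\ t>0,$$ where $W^1,W^2$ are independent $n$-dimensional Brownian motions. $P(t,x,u)$ denotes the density of the joint distribution of $(X(t),U(t))$ with initial data $P_0(x,u)=\delta(u-u_0(x))\rho_0(x)$, where $\delta$ is the Dirac measure; that is, since $\rho_0$ is not assumed integrable, $P(t,\cdot,\cdot)=\int_{\mathbb{R}^n}\rho_0(s)\,p_t^{s,u_0(s)}(\cdot,\cdot)\,ds$, where $p_t^{s,v}$ is the law of $(X(t),U(t))$ started at $(s,v)$ (when $\sigma_2=0$, $P(t,x,\cdot)$ is a measure in $u$). Define $$\rho_\sigma(t,x)=\int_{\mathbb{R}^n}P(t,x,u)\,du,\qquad u_\sigma(t,x)=\frac{\int_{\mathbb{R}^n}u\,P(t,x,u)\,du}{\int_{\mathbb{R}^n}P(t,x,u)\,du},$$ with $\rho_\sigma(0,x)=\rho_0(x)$, $u_\sigma(0,x)=u_0(x)$. Limits $|\sigma|\to0$ are over $\sigma=(\sigma_1,\sigma_2)\neq0$ with nonnegative components, pointwise in $(t,x)$. ''Keeps the smoothness'' means that there is a classical solution $u$ with $u(t,\cdot)\in C^1(\mathbb{R}^n)\cap C_b(\mathbb{R}^n)$ for these $t$. The expression $\nabla_x(\rho\,\bar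 u\otimes\bar u)$ is the vector with $i$-th component $\mathrm{div}_x(\rho\,\bar u_i\,\bar u)$. *)

(* Defs.v *)
From HB Require Import structures.
From mathcomp Require Import all_boot all_order all_algebra.
From mathcomp Require Import all_classical all_reals all_analysis.

Set Implicit Arguments.
Unset Strict Implicit.
Unset Printing Implicit Defensive.

Import Order.TTheory GRing.Theory Num.Theory.
Import numFieldNormedType.Exports.

Local Open Scope classical_set_scope.
Local Open Scope ring_scope.

(* ['rV[R]_n] carries the sigma-algebra generated by the coordinates, which is
   the Borel one; the construction is that of the library for [n.-tuple T]. *)
Definition rV_display : measure_display.
Proof. exact: default_measure_display. Qed.

Section rV_measurable.
Variables (R : realType) (n : nat).

Let coor : 'I_n -> 'rV[R]_n -> R := fun i x => x 0 i.

Let rV_set0 : g_sigma_preimage coor set0.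
Proof. exact: sigma_algebra0. Qed.

Let rV_setC A : g_sigma_preimage coor A -> g_sigma_preimage coor (~` A).
Proof. exact: sigma_algebraC. Qed.

Let rV_bigcup (F : (set 'rV[R]_n)^nat) :
  (forall i, g_sigma_preimage coor (F i)) ->
  g_sigma_preimage coor (\bigcup_i (F i)).
Proof. exact: sigma_algebra_bigcup. Qed.

HB.instance Definition _ :=
  @isMeasurable.Build rV_display 'rV[R]_n (g_sigma_preimage coor)
    rV_set0 rV_setC rV_bigcup.

Lemma measurable_coord (i : 'I_n) :
  measurable_fun [set: 'rV[R]_n] (fun x : 'rV[R]_n => x 0 i).
Proof.
move=> _ Y mY; rewrite setTI; apply: sub_sigma_algebra => /=.
rewrite -bigcup_seq/=; exists i => /=; first by rewrite mem_index_enum.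
by exists Y => //; rewrite setTI.
Qed.

Lemma measurable_fun_coordP d (T : measurableType d) (f : T -> 'rV[R]_n) :
  (forall i, measurable_fun [set: T] (fun w => f w 0 i)) ->
  measurable_fun [set: T] f.
Proof.
move=> mf; suff sF : g_sigma_preimage (fun i => coor i \o f) `<=` measurable.
  move=> _ A mA; apply: sF; rewrite g_sigma_preimage_comp.
  by exists A.
apply: smallest_sub; first exact: sigma_algebra_measurable.
by rewrite -bigcup_seq => A [i _] [B mB <-]; exact: mf.
Qed.

End rV_measurable.

Section lebesgue_rV.
Variable R : realType.

Definition rV_cons n (p : R * 'rV[R]_n) : 'rV[R]_n.+1 :=
  \row_i (if unlift ord0 i is Some j then p.2 0 j else p.1).

Definition rV_uncons n (v : 'rV[R]_n.+1) : R * 'rV[R]_n :=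
  (v 0 ord0, \row_j v 0 (lift ord0 j)).

Lemma rV_consK n : cancel (@rV_cons n) (@rV_uncons n).
Proof.
move=> [x v]; rewrite /rV_uncons /rV_cons mxE unlift_none; congr (_, _).
by apply/rowP => j; rewrite !mxE liftK.
Qed.

Lemma measurable_rV_cons n : measurable_fun [set: R * 'rV[R]_n] (@rV_cons n).
Proof.
apply: measurable_fun_coordP => i; rewrite /rV_cons.
under eq_fun do rewrite mxE.
case: (unlift ord0 i) => [j|]; last exact: measurable_fst.
exact: (measurableT_comp (measurable_coord j) measurable_snd).
Qed.

Lemma measurable_rV_uncons n :
  measurable_fun [set: 'rV[R]_n.+1] (@rV_uncons n).
Proof.
apply/measurable_fun_pairP; split; first exact: (measurable_coord ord0).
apply: measurable_fun_coordP => j /=.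
under eq_fun do rewrite mxE.
exact: measurable_coord.
Qed.

Section step.
Variables (n : nat) (m : {sigma_finite_measure set 'rV[R]_n -> \bar R}).

Definition lebesgue_step : set 'rV[R]_n.+1 -> \bar R :=
  pushforward (lebesgue_measure \x m)%E (@rV_cons n).

Let pre A : measurable A -> measurable (@rV_cons n @^-1` A).
Proof. by move=> mA; rewrite -[X in measurable X]setTI; exact: measurable_rV_cons. Qed.

Let step0 : lebesgue_step set0 = 0%E.
Proof. by rewrite /lebesgue_step /pushforward preimage_set0 measure0. Qed.

Let step_ge0 A : (0 <= lebesgue_step A)%E.
Proof. by rewrite /lebesgue_step /pushforward measure_ge0. Qed.

Let step_sigma_additive : semi_sigma_additive lebesgue_step.
Proof.
move=> F mF tF mUF; rewrite /lebesgue_step /pushforward preimage_bigcup.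
apply: measure_semi_sigma_additive.
- by move=> i; exact: pre.
- apply/trivIsetP => /= i j _ _ ij; rewrite -preimage_setI.
  by move/trivIsetP : tF => /(_ _ _ _ _ ij) ->//; rewrite preimage_set0.
- by rewrite -preimage_bigcup; exact: pre.
Qed.

HB.instance Definition _ :=
  isMeasure.Build _ _ _ lebesgue_step step0 step_ge0 step_sigma_additive.

Let step_sigma_finite : sigma_finite setT lebesgue_step.
Proof.
have /sigma_finiteP[F [TF ndF Foo]] := sigma_finiteT (@lebesgue_measure R).
have /sigma_finiteP[G [TG ndG Goo]] := sigma_finiteT m.
exists (fun k => @rV_uncons n @^-1` (F k `*` G k)).
  rewrite -preimage_bigcup; apply/esym; rewrite -subTset => v _ /=.
  have : [set: R] (rV_uncons v).1 by [].
  have : [set: 'rV[R]_n] (rV_uncons v).2 by [].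
  rewrite TF TG => -[k _ Gk] [l _ Fl]; exists (maxn k l) => //; split.
    by move: Fl; exact/subsetPset/ndF/leq_maxr.
  by move: Gk; exact/subsetPset/ndG/leq_maxl.
move=> k; have [mF Fk] := Foo k; have [mG Gk] := Goo k; split.
  rewrite -[X in measurable X]setTI.
  by apply: measurable_rV_uncons => //; exact: measurableX.
rewrite /lebesgue_step /pushforward -comp_preimage.
rewrite (_ : @rV_uncons n \o @rV_cons n = id); last exact/funext/rV_consK.
by rewrite preimage_id product_measure1E// lte_mul_pinfty// ge0_fin_numE.
Qed.

HB.instance Definition _ :=
  @Measure_isSigmaFinite.Build _ _ _ lebesgue_step step_sigma_finite.

End step.

(* Lebesgue measure on R^n, as an iterated product. *)
Fixpoint lebesgue_rV n : {sigma_finite_measure set 'rV[R]_n -> \bar R} :=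
  match n with
  | 0%N => \d_(0 : 'rV[R]_0)
  | k.+1 => lebesgue_step (lebesgue_rV k)
  end.

Lemma lebesgue_rV_box n (A : 'I_n -> set R) :
  (forall i, measurable (A i)) ->
  lebesgue_rV n [set x | forall i, A i (x 0 i)] =
  (\prod_(i < n) lebesgue_measure (A i))%E.
Proof.
elim: n A => [|n IHn] A mA.
  by rewrite big_ord0 /= diracE mem_set//= => -[].
rewrite big_ord_recl /= /lebesgue_step /pushforward.
set B := [set y : 'rV[R]_n | forall i, A (lift ord0 i) (y 0 i)].
have mB : measurable B.
  rewrite (_ : B = \bigcap_(i in [set: 'I_n])
      (fun y : 'rV[R]_n => y 0 i) @^-1` A (lift ord0 i)).
    apply: fin_bigcap_measurable => // i _.
    by rewrite -[X in measurable X]setTI; exact: measurable_coord.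
  by apply/seteqP; split=> y /= By; [move=> i _ /=|move=> i]; exact: By.
rewrite -(IHn (fun i => A (lift ord0 i)))// -product_measure1E//.
congr (product_measure1 _ _ _).
apply/seteqP; split=> -[x y] /= Axy.
  split; first by have := Axy ord0; rewrite mxE unlift_none.
  by move=> i; have := Axy (lift ord0 i); rewrite mxE liftK.
by move=> i; rewrite mxE; case: unliftP => [j ->|->]; case: Axy.
exact: mA.
Qed.

End lebesgue_rV.

Section calculus.
Variables (R : realType) (n : nat).

(* At t = 0 this is the right derivative, elsewhere the usual one. *)
Definition time_quotient (W : normedModType R) (f : R -> W) (t : R) :=
  (fun h => h^-1 *: (f (t + h) - f t)) @ within [set h | 0 <= t + h] 0^'.

Definition dt (W : normedModType R) (f : R -> W) (t : R) : W :=
  lim (time_quotient f t).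

Definition dx (W : normedModType R) (i : 'I_n) (f : 'rV[R]_n -> W) x : W :=
  'D_(delta_mx 0 i) f x.

Definition divx (v : 'rV[R]_n -> 'rV[R]_n) (x : 'rV[R]_n) : R :=
  \sum_(j < n) dx j (fun y => v y 0 j) x.

Definition C1 (m : nat) (f : 'rV[R]_n -> 'rV[R]_m) :=
  (forall x, differentiable f x) /\ continuous (jacobian f).

Definition spacetime (T : \bar R) : set (R * 'rV[R]_n) :=
  [set p | 0 <= p.1 /\ (p.1%:E < T)%E].

(* C^1 up to the boundary t = 0. *)
Definition C1_spacetime (T : \bar R) (W : normedModType R)
    (f : R -> 'rV[R]_n -> W) :=
  [/\ {within spacetime T, continuous (fun p => f p.1 p.2)},
      forall p, spacetime T p ->
        cvg (time_quotient (f ^~ p.2) p.1) /\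
        forall i : 'I_n, derivable (f p.1) p.2 (delta_mx 0 i),
      {within spacetime T, continuous (fun p => dt (f ^~ p.2) p.1)} &
      forall i : 'I_n,
        {within spacetime T, continuous (fun p => dx i (f p.1) p.2)}].

Definition bounded_spacetime (T : \bar R) (W : normedModType R)
    (f : R -> 'rV[R]_n -> W) :=
  [bounded f p.1 p.2 | p in spacetime T].

Definition burgers_solution (T : \bar R) (u0 : 'rV[R]_n -> 'rV[R]_n)
    (u : R -> 'rV[R]_n -> 'rV[R]_n) :=
  [/\ C1_spacetime T u,
      forall x, u 0 x = u0 x &
      forall t x, 0 < t -> (t%:E < T)%E ->
        dt (u ^~ x) t + \sum_(j < n) u t x 0 j *: dx j (u t) x = 0].

Definition keeps_smoothness (u0 : 'rV[R]_n -> 'rV[R]_n) (T : \bar R) :=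
  exists2 u, burgers_solution T u0 u &
    forall t, 0 < t -> (t%:E < T)%E -> C1 (u t) /\ bounded_fun (u t).

Definition pressureless_gas (T : \bar R) (rho : R -> 'rV[R]_n -> R)
    (u : R -> 'rV[R]_n -> 'rV[R]_n) :=
  forall t x, spacetime T (t, x) ->
    dt (rho ^~ x) t + divx (fun y => rho t y *: u t y) x = 0 /\
    forall i : 'I_n,
      dt (fun s => rho s x * u s x 0 i) t +
      divx (fun y => (rho t y * u t y 0 i) *: u t y) x = 0.

Definition L1_loc (f : 'rV[R]_n -> R) :=
  measurable_fun [set: 'rV[R]_n] f /\
  forall K : set 'rV[R]_n, compact K ->
    (\int[lebesgue_rV R n]_(x in K) `|f x|%:E < +oo)%E.

End calculus.

Section brownian.
Variables (R : realType) (n : nat) (d : measure_display).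
Variables (T : measurableType d) (Pr : probability T R).
Implicit Types W : R -> {RV Pr >-> 'rV[R]_n}.

Definition independent_increments W :=
  forall (m : nat) (t : nat -> R) (A : nat -> set 'rV[R]_n),
    0 <= t 0%N -> (forall i, t i <= t i.+1) -> (forall i, measurable (A i)) ->
    let E i := [set w | A i (W (t i.+1) w - W (t i) w)] in
    Pr (\bigcap_(i < m) E i) = (\prod_(i < m) Pr (E i))%E.

(* The increments are N(0, (t - s) I_n); [normal_prob] takes the standard
   deviation. *)
Definition gaussian_increments W :=
  forall (s t : R) (A : 'I_n -> set R),
    0 <= s -> s < t -> (forall k, measurable (A k)) ->
    Pr [set w | forall k, A k (W t w 0 k - W s w 0 k)] =
    (\prod_(k < n) normal_prob 0 (Num.sqrt (t - s)) (A k))%E.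

Definition brownian W :=
  [/\ {ae Pr, forall w, W 0 w = 0},
      independent_increments W,
      gaussian_increments W &
      {ae Pr, forall w, {within `[0, +oo[, continuous (fun t => W t w)}}].

Definition independent_processes W1 W2 :=
  forall (m : nat) (s t : 'I_m -> R) (A B : 'I_m -> set 'rV[R]_n),
    (forall i, 0 <= s i) -> (forall i, 0 <= t i) ->
    (forall i, measurable (A i)) -> (forall i, measurable (B i)) ->
    let E := [set w | forall i, A i (W1 (s i) w)] in
    let F := [set w | forall i, B i (W2 (t i) w)] in
    Pr (E `&` F) = (Pr E * Pr F)%E.

(* dX = U dt + sigma_1 dW^1, dU = sigma_2 dW^2, (X, U)(0) = (s, v). The noise
   is additive, so the stochastic integrals are multiples of W^1 and W^2. *)
Definition sde_solution W1 W2 (sigma : R * R) (s v : 'rV[R]_n)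
    (X U : R -> {RV Pr >-> 'rV[R]_n}) :=
  {ae Pr, forall w, forall t, 0 <= t ->
    X t w = s
      + \row_k (\int[lebesgue_measure]_(r in `[0, t]) (U r w 0 k))%R
      + sigma.1 *: W1 t w /\
    U t w = v + sigma.2 *: W2 t w}.

End brownian.

Section density.
Variables (R : realType) (n : nat).

Definition noise : set (R * R) :=
  [set sigma | [/\ 0 <= sigma.1, 0 <= sigma.2 & sigma != 0]].

(* The measure [int rho0(s) p_t^(s, u0(s)) ds] on R^n x R^n, where
   p_t^(s, v) is the law of (X s v t, U s v t). *)
Definition joint_distribution (d : measure_display) (T : measurableType d)
    (Pr : probability T R) (rho0 : 'rV[R]_n -> R) (u0 : 'rV[R]_n -> 'rV[R]_n)
    (X U : 'rV[R]_n -> 'rV[R]_n -> R -> {RV Pr >-> 'rV[R]_n}) (t : R)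
    (C : set ('rV[R]_n * 'rV[R]_n)) : \bar R :=
  (\int[lebesgue_rV R n]_s
     ((rho0 s)%:E * Pr [set w | C (X s (u0 s) t w, U s (u0 s) t w)]))%E.

(* [P x] is the measure P(t, x, u) du. A density with respect to dx is only
   determined for almost every x; since P(t, x, .) is evaluated pointwise, it
   is the version that is weakly continuous in x, which is unique. *)
Definition is_density (mu : set ('rV[R]_n * 'rV[R]_n) -> \bar R)
    (P : R.-ftker 'rV[R]_n ~> 'rV[R]_n) :=
  (forall A B : set 'rV[R]_n, measurable A -> measurable B ->
     mu (A `*` B) = (\int[lebesgue_rV R n]_(x in A) P x B)%E) /\
  (forall phi : 'rV[R]_n -> R, continuous phi -> bounded_fun phi ->
     continuous (fun x => \int[P x]_u phi u)).

Definition rho_sigma (rho0 : 'rV[R]_n -> R)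
    (P : R -> R.-ftker 'rV[R]_n ~> 'rV[R]_n) (t : R) (x : 'rV[R]_n) : R :=
  if t == 0 then rho0 x else \int[P t x]_u 1.

Definition u_sigma (u0 : 'rV[R]_n -> 'rV[R]_n)
    (P : R -> R.-ftker 'rV[R]_n ~> 'rV[R]_n) (t : R) (x : 'rV[R]_n) : 'rV[R]_n :=
  if t == 0 then u0 x
  else (\int[P t x]_u 1)^-1 *: \row_i \int[P t x]_u (u 0 i).

End density.

(* Main.v *)
Require Import Defs.
From HB Require Import structures.
From mathcomp Require Import all_boot all_order all_algebra.
From mathcomp Require Import all_classical all_reals all_analysis.
From mathcomp Require Import measurable_realfun.
From mathcomp Require Import ring lra.

(** The limits over the noise are assumed to exist, so that they can be computed
along the sequence [sigma = (1 / (k + 1), 0)], where the velocity carries no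
noise. A particle issued from [s] then keeps the velocity [u0 s] and is at
[F s + Z] at time [t], with [F s = s + t *: u0 s] and [Z = W1 t / (k + 1)],
which tends to zero for every realisation.

A smooth solution [u] of the Burgers equation is constant along the lines
[t |-> s + t *: u0 s] ([burgers_characteristic], a Gronwall estimate). Hence
[F] is injective with inverse [x |-> x - t *: u t x], which is locally
Lipschitz ([burgers_lipschitz]), and an open set has a preimage of comparable
measure ([lebesgue_preimage_expanding], by dyadic cubes).

The law of the particles and its density are related by an identity between
integrals ([density_identity]). Letting [k] go to infinity in it is the heart
of the matter, since pointwise limits of densities may lose mass.
[vague_limit] excludes this: the bound on the preimages shows that above a
suitable level the density only collects mass from large values of the noise.
It follows that [rho t] is the image of [rho0] under [F]
([density_pushforward]). With the velocity as a weight it follows that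
[rho * ubar] is the image of [rho0 * u0], which is [rho * u] because [u t] has
the value [u0 s] at [F s] ([limit_velocity]). For the weight to be bounded and
nonnegative, the velocity is clipped at a bound of [u0] and shifted; clipping
is harmless since the measures [P(t, x, .)] only charge velocities within that
bound, for every [x], by their weak continuity in [x].

It remains to see that a transported mass solves the system
([transport_pressureless_gas]). Differentiating in time the integral of
[phi (s + t *: u0 s)] against [rho0] gives the continuity equation against
every test function, hence everywhere, as all terms are continuous and [C^1]
bumps separate points ([bump_orthogonal_eq0]). The momentum equation is the
combination of the continuity equation times [u_i] and the Burgers equation
times [rho]. All this holds up to the initial time, where the time derivative
is one-sided and the Burgers equation extends by continuity
([burgers_coord_closed]). *)

Set Implicit Arguments.
Unset Strict Implicit.
Unset Printing Implicit Defensive.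

Import Order.TTheory GRing.Theory Num.Theory.
Import numFieldNormedType.Exports.

Local Open Scope classical_set_scope.
Local Open Scope ring_scope.

(** * Continuity of real-valued functions *)

Section pointwise_continuity.
Variables (R : realType) (T : topologicalType).
Implicit Types f g : T -> R.

Lemma continuous_mulf f g : continuous f -> continuous g ->
  continuous (fun x => f x * g x).
Proof. by move=> cf cg x; apply: cvgM; [exact: cf|exact: cg]. Qed.

Lemma continuous_addf f g : continuous f -> continuous g ->
  continuous (fun x => f x + g x).
Proof. by move=> cf cg x; apply: cvgD; [exact: cf|exact: cg]. Qed.

Lemma continuous_subf f g : continuous f -> continuous g ->
  continuous (fun x => f x - g x).
Proof. by move=> cf cg x; apply: cvgB; [exact: cf|exact: cg]. Qed.

Lemma continuous_oppf f : continuous f -> continuous (fun x => - f x).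
Proof. by move=> cf x; apply: cvgN; exact: cf. Qed.

Lemma continuous_sumf n (f : 'I_n -> T -> R) :
  (forall i, continuous (f i)) -> continuous (fun x => \sum_i f i x).
Proof. by move=> cf; apply: continuous_big => //; exact: add_continuous. Qed.

Lemma continuous_maxf f g : continuous f -> continuous g ->
  continuous (fun x => Num.max (f x) (g x)).
Proof. by move=> cf cg x; apply: continuous_max; [exact: cf|exact: cg]. Qed.

Lemma continuous_minf f g : continuous f -> continuous g ->
  continuous (fun x => Num.min (f x) (g x)).
Proof. by move=> cf cg x; apply: continuous_min; [exact: cf|exact: cg]. Qed.

End pointwise_continuity.

(** * Cubes and expanding maps *)

Section rV_geometry.
Variables (R : realType) (n : nat).
Implicit Types (x y v : 'rV[R]_n) (O : set 'rV[R]_n).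

Lemma rV_norm_ge x i : `|x 0 i| <= `|x|.
Proof.
rewrite [leRHS]/Num.norm /= mx_normrE.
exact: (le_bigmax _ (fun ij : 'I_1 * 'I_n => `|x ij.1 ij.2|) (0, i)).
Qed.

Lemma rV_norm_le x (r : R) :
  0 <= r -> (`|x| <= r) <-> (forall i, `|x 0 i| <= r).
Proof.
move=> r0; split=> [xr i|xr]; first exact: le_trans (rV_norm_ge x i) xr.
rewrite [leLHS]/Num.norm /= mx_normrE; apply/bigmax_leP; split=> // -[j i] _ /=.
by rewrite ord1.
Qed.

Lemma measurable_rV_box (A : 'I_n -> set R) :
  (forall i, measurable (A i)) ->
  measurable [set x : 'rV[R]_n | forall i, A i (x 0 i)].
Proof.
move=> mA; rewrite (_ : mkset _ = \bigcap_(i in [set: 'I_n])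
    (fun y : 'rV[R]_n => y 0 i) @^-1` A i).
  apply: fin_bigcap_measurable => // i _.
  by rewrite -[X in measurable X]setTI; exact: measurable_coord.
by apply/seteqP; split=> y /= By; [move=> i _ /=|move=> i]; exact: By.
Qed.

Let closed_cubeE v (r : R) : 0 <= r ->
  [set x | `|x - v| <= r] =
  [set x : 'rV[R]_n | forall i, `[v 0 i - r, v 0 i + r]%classic (x 0 i)].
Proof.
move=> r0; apply/seteqP; split=> x /=.
  move/(rV_norm_le _ r0) => xr i; rewrite in_itv /=.
  by have := xr i; rewrite !mxE ler_distl.
move=> xr; apply/(rV_norm_le _ r0) => i; have := xr i.
by rewrite in_itv /= !mxE ler_distl.
Qed.

Lemma measurable_closed_cube v (r : R) : measurable [set x | `|x - v| <= r].
Proof.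
have [r0|r0] := leP 0 r.
  rewrite closed_cubeE//.
  exact: (@measurable_rV_box (fun i => `[v 0 i - r, v 0 i + r]%classic)).
rewrite (_ : mkset _ = set0)//; apply/seteqP; split=> x //=.
by rewrite leNgt (lt_le_trans r0).
Qed.

Lemma lebesgue_closed_cube v (r : R) : 0 <= r ->
  lebesgue_rV R n [set x | `|x - v| <= r] = ((2 * r) ^+ n)%:E.
Proof.
move=> r0; rewrite closed_cubeE//.
rewrite (@lebesgue_rV_box R n (fun i => `[v 0 i - r, v 0 i + r]%classic))//.
have -> : (2 * r) ^+ n = \prod_(i < n) (2 * r) by rewrite prodr_const card_ord.
rewrite -prodEFin; apply: eq_bigr => i _; rewrite lebesgue_measure_itv/= lte_fin.
case: ltP => [_|]; first by rewrite -EFinB; congr EFin; lra.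
by move=> rr; congr EFin; lra.
Qed.

Definition dyadic (k : nat) x : 'rV[int]_n := \row_i Num.floor (2 ^+ k * x 0 i).

Definition dyadic_cube (k : nat) (z : 'rV[int]_n) := [set x | dyadic k x = z].

Let pow2_gt0 k : 0 < 2 ^+ k :> R. Proof. exact: exprn_gt0. Qed.

Let dyadic_cubeE k z : dyadic_cube k z =
  [set x : 'rV[R]_n | forall i,
     `[(z 0 i)%:~R / 2 ^+ k, (z 0 i + 1)%:~R / 2 ^+ k[%classic (x 0 i)].
Proof.
apply/seteqP; split=> x /=.
  move=> <- i; rewrite in_itv /= !mxE ler_pdivrMr// ltr_pdivlMr//.
  by rewrite [x 0 i * _]mulrC floor_itv.
move=> xz; apply/rowP => i; rewrite mxE; apply: floor_def.
have := xz i; rewrite in_itv /= ler_pdivrMr// ltr_pdivlMr//.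
by rewrite mulrC.
Qed.

Lemma measurable_dyadic_cube k z : measurable (dyadic_cube k z).
Proof.
rewrite dyadic_cubeE; exact: (@measurable_rV_box
  (fun i => `[(z 0 i)%:~R / 2 ^+ k, (z 0 i + 1)%:~R / 2 ^+ k[%classic)).
Qed.

Lemma lebesgue_dyadic_cube k z :
  lebesgue_rV R n (dyadic_cube k z) = (((2 ^+ k)^-1) ^+ n)%:E.
Proof.
rewrite dyadic_cubeE (@lebesgue_rV_box R n
  (fun i => `[(z 0 i)%:~R / 2 ^+ k, (z 0 i + 1)%:~R / 2 ^+ k[%classic))//.
have -> : (2 ^+ k)^-1 ^+ n = \prod_(i < n) (2 ^+ k)^-1 :> R.
  by rewrite prodr_const card_ord.
rewrite -prodEFin; apply: eq_bigr => i _; rewrite lebesgue_measure_itv/= lte_fin.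
rewrite ltr_pM2r ?invr_gt0// intrD ltrDl ltr01 -EFinB; congr EFin.
by rewrite mulrDl mul1r addrAC subrr add0r.
Qed.

Lemma dyadic_close k x y : dyadic k x = dyadic k y -> `|x - y| <= (2 ^+ k)^-1.
Proof.
move=> xy; apply/rV_norm_le; first by rewrite invr_ge0 ltW.
move=> i; rewrite !mxE -(ler_pM2l (pow2_gt0 k)) divff ?gt_eqF//.
rewrite -[X in X * _]gtr0_norm// -normrM mulrBr.
have := congr1 (fun z : 'rV[int]_n => z 0 i) xy; rewrite !mxE => fxy.
have := floor_itv (2 ^+ k * x 0 i); have := floor_itv (2 ^+ k * y 0 i).
rewrite -fxy intrD => /andP[y1 y2] /andP[x1 x2].
by rewrite ler_norml; apply/andP; split; lra.
Qed.

Lemma dyadicS k x y : dyadic k.+1 x = dyadic k.+1 y -> dyadic k x = dyadic k y.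
Proof.
move=> xy; apply/rowP => i; rewrite !mxE; apply: floor_def.
have := congr1 (fun z : 'rV[int]_n => z 0 i) xy; rewrite !mxE => fxy.
set a := Num.floor (2 ^+ k * y 0 i).
have /andP[a1 a2] := floor_itv (2 ^+ k * y 0 i).
have /andP[x1 x2] := floor_itv (2 ^+ k.+1 * x 0 i).
have ya : (2 * a <= Num.floor (2 ^+ k.+1 * y 0 i))%R.
  by rewrite floor_ge_int exprS -mulrA intrM ler_pM2l.
have yb : (Num.floor (2 ^+ k.+1 * y 0 i) < 2 * (a + 1))%R.
  by rewrite floor_lt_int exprS -mulrA intrM ltr_pM2l.
have ya' : (2 * a)%:~R <= 2 ^+ k.+1 * x 0 i.
  by apply: le_trans x1; rewrite ler_int fxy.
have yb' : 2 ^+ k.+1 * x 0 i < (2 * (a + 1))%:~R.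
  by apply: lt_le_trans x2 _; rewrite ler_int fxy lezD1.
move: ya' yb'; rewrite exprS -mulrA !intrM ler_pM2l// ltr_pM2l//.
by move=> -> ->.
Qed.

(** The cubes are listed through the codes of their corners, so that they form
a sequence of disjoint sets to which countable additivity applies. *)
Definition inner_cube O (k m : nat) : set 'rV[R]_n :=
  if pickle_inv m is Some z then
    [set x | dyadic_cube k z x /\ dyadic_cube k z `<=` O] else set0.

Definition inner_cubes O (k : nat) := \bigcup_m inner_cube O k m.

Let inner_cube_case O k m :
  inner_cube O k m = set0 \/ exists z, inner_cube O k m = dyadic_cube k z.
Proof.
rewrite /inner_cube; case: pickle_inv => [z|]; last by left.
have [zO|zO] := pselect (dyadic_cube k z `<=` O); [right|left].
  by exists z; apply/seteqP; split => x [].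
by apply/seteqP; split => x // [].
Qed.

Lemma measurable_inner_cube O k m : measurable (inner_cube O k m).
Proof.
have [->//|[z ->]] := inner_cube_case O k m; exact: measurable_dyadic_cube.
Qed.

Lemma trivIset_inner_cube O k : trivIset setT (inner_cube O k).
Proof.
apply/trivIsetP => i j _ _; apply: contraNeq; case/set0P => x [].
rewrite /inner_cube; case Ei: (pickle_inv i) => [z|//].
case Ej: (pickle_inv j) => [w|//] => -[[/= xz _] [/= xw _]]; apply/eqP.
have := @pickle_invK 'rV[int]_n i; have := @pickle_invK 'rV[int]_n j.
rewrite Ei Ej /= => <- <-; by rewrite -xz -xw.
Qed.

Let inner_cubesP O k x :
  inner_cubes O k x <-> forall y, dyadic k y = dyadic k x -> O y.
Proof.
split=> [[m _]|Ox].
  by rewrite /inner_cube; case: pickle_inv => // z [<- zO] y yx; exact: zO.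
exists (pickle (dyadic k x)) => //; rewrite /inner_cube pickleK_inv.
by split=> // y; exact: Ox.
Qed.

Lemma nondecreasing_inner_cubes O : nondecreasing_seq (inner_cubes O).
Proof.
apply/nondecreasing_seqP => k; apply/subsetPset => x /inner_cubesP Ox.
by apply/inner_cubesP => y /dyadicS; exact: Ox.
Qed.

Lemma bigcup_inner_cubes O : open O -> \bigcup_k inner_cubes O k = O.
Proof.
move=> oO; apply/seteqP; split=> x.
  by case=> k _ /inner_cubesP; exact.
move=> Ox; have /nbhs_ballP[e /= e0 xO] := open_nbhs_nbhs (conj oO Ox).
have [k ke] : exists k, (2 ^+ k)^-1 < e.
  have [k _ ke] := near_infty_natSinv_expn_lt (PosNum e0).
  by exists k; have := ke k (leqnn k); rewrite /= div1r.
exists k => //; apply/inner_cubesP => y yx; apply: xO.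
by rewrite -ball_normE /= (le_lt_trans (dyadic_close (esym yx))).
Qed.

Lemma open_measurable_rV O : open O -> measurable O.
Proof.
move=> /bigcup_inner_cubes <-; apply: bigcupT_measurable => k.
by apply: bigcupT_measurable => m; exact: measurable_inner_cube.
Qed.

Lemma continuous_measurable_rV (f : 'rV[R]_n -> R) :
  continuous f -> measurable_fun [set: 'rV[R]_n] f.
Proof.
move=> cf; apply: (measurability _ (RGenOpens.measurableE R)).
move=> _ [_ [a [b ->] <-]]; rewrite setTI.
by apply: open_measurable_rV; move/continuousP : cf; apply; exact: interval_open.
Qed.

(** The open set is exhausted by unions of disjoint dyadic cubes, and the
preimage of a cube of side [l] inside [O] lies in a cube of half-side [L * l]
around any of its points, because distances shrink at most by the factor [L].
This replaces the change of variables formula for maps whose inverse is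
locally Lipschitz. *)
Lemma lebesgue_preimage_expanding (G : 'rV[R]_n -> 'rV[R]_n) (L : R) O :
  measurable_fun [set: 'rV[R]_n] G -> 0 <= L -> open O ->
  (forall x y, O (G x) -> O (G y) -> `|x - y| <= L * `|G x - G y|) ->
  (lebesgue_rV R n (G @^-1` O) <= ((2 * L) ^+ n)%:E * lebesgue_rV R n O)%E.
Proof.
move=> mG L0 oO GL; set mu := lebesgue_rV R n.
have mGpre A : measurable A -> measurable (G @^-1` A).
  by move=> mA; rewrite -[X in measurable X]setTI; exact: mG.
have cube k m : (mu (G @^-1` inner_cube O k m) <=
    ((2 * L) ^+ n)%:E * mu (inner_cube O k m))%E.
  have [->|zO] := inner_cube_case O k m.
    by rewrite preimage_set0 measure0 mule0.
  have [E0|] := eqVneq (G @^-1` inner_cube O k m) set0.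
    by rewrite E0 measure0 mule_ge0// lee_fin exprn_ge0// mulr_ge0.
  case/set0P => x Gx; have := Gx; case: zO => z zE.
  have {}zO : dyadic_cube k z `<=` O.
    move: Gx zE; rewrite /= /inner_cube; case: pickle_inv => // w [xw wO] <-.
    by move=> y [yw _]; exact: wO.
  rewrite zE => xz.
  apply: (@le_trans _ _ (mu [set y : 'rV[R]_n | `|y - x| <= L * (2 ^+ k)^-1])).
    apply: le_measure; rewrite ?inE.
    - apply: mGpre; exact: measurable_dyadic_cube.
    - exact: (@measurable_closed_cube x).
    - move=> y /= yz; apply: le_trans (GL _ _ (zO _ yz) (zO _ xz)) _.
      by rewrite ler_wpM2l// dyadic_close// yz xz.
  rewrite lebesgue_closed_cube; last by rewrite divr_ge0// ltW.
  by rewrite lebesgue_dyadic_cube -EFinM lee_fin mulrA exprMn.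
have mI k : measurable (inner_cubes O k).
  by apply: bigcupT_measurable => m; exact: measurable_inner_cube.
have cubes k : (mu (G @^-1` inner_cubes O k) <= ((2 * L) ^+ n)%:E * mu O)%E.
  apply: (@le_trans _ _ (\sum_(m <oo) mu (G @^-1` inner_cube O k m))%E).
    rewrite /inner_cubes preimage_bigcup; apply: measure_sigma_subadditive => //.
    - by move=> m; apply: mGpre; exact: measurable_inner_cube.
    - by rewrite -preimage_bigcup; apply: mGpre; exact: mI.
  apply: (@le_trans _ _ (\sum_(m <oo) ((2 * L) ^+ n)%:E * mu (inner_cube O k m))%E).
    by apply: lee_nneseries => // m _; exact: cube.
  rewrite nneseriesZl//; apply: lee_wpmul2l.
    by rewrite lee_fin exprn_ge0// mulr_ge0.
  have := @measure_bigcup _ _ _ mu setT (inner_cube O k)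
    (fun m _ => measurable_inner_cube O k m) (@trivIset_inner_cube O k).
  under eq_eseriesl do rewrite in_setT.
  move=> <-; apply: le_measure; rewrite ?inE.
  - exact: mI.
  - exact: open_measurable_rV.
  - by rewrite -[X in _ `<=` X]bigcup_inner_cubes// => x Ox; exists k.
have : mu \o (fun k => G @^-1` inner_cubes O k) @ \oo --> mu (G @^-1` O).
  rewrite -[in X in _ --> X](bigcup_inner_cubes oO) preimage_bigcup.
  apply: nondecreasing_cvg_mu.
  - by move=> k; apply: mGpre; exact: mI.
  - by apply: bigcupT_measurable => k; apply: mGpre; exact: mI.
  - move=> i j ij; apply/subsetPset => x.
    by have /subsetPset := nondecreasing_inner_cubes O ij; exact.
move=> /cvg_lim <-//; apply: lime_le; last by apply: nearW => k; exact: cubes.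
apply: ereal_nondecreasing_is_cvgn => i j ij; apply: le_measure; rewrite ?inE.
- apply: mGpre; exact: mI.
- apply: mGpre; exact: mI.
- move=> x; by have /subsetPset := nondecreasing_inner_cubes O ij; exact.
Qed.

End rV_geometry.

(** * Translations and bounded convergence *)

Section rV_translation.
Variables (R : realType) (n : nat).
Local Notation mu := (lebesgue_rV R n).

Let measurable_shift (a : R) :
  measurable_fun [set: R] (fun x => x + a).
Proof. exact: measurable_funD. Qed.

Let lebesgue_measure_shift (a : R) (A : set R) : measurable A ->
  lebesgue_measure ((fun x => x + a) @^-1` A) = lebesgue_measure A.
Proof.
move=> mA.
have ms : measurable_fun [set: measurableTypeR R]
    ((fun x => x + a) : _ -> measurableTypeR R).
  exact: measurable_funD.
apply/esym; apply: (@lebesgue_measure_unique R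
  (measure_function_pushforward__canonical__measure_function_Measure
     lebesgue_measure ms)) => //= _ [[b c]] _ <-.
rewrite /pushforward (_ : _ @^-1` _ = `]b - a, c - a]%classic); last first.
  by apply/seteqP; split=> x /=; rewrite !in_itv /= ltrBlDr lerBrDr.
rewrite !lebesgue_measure_itv/= !lte_fin ltrD2r -!EFinB.
by case: ifP => // _; congr EFin; lra.
Qed.

Lemma measurable_rV_shift (v : 'rV[R]_n) :
  measurable_fun [set: 'rV[R]_n] (fun x => x + v).
Proof.
apply: measurable_fun_coordP => i; under eq_fun do rewrite mxE.
by apply: measurable_funD => //; exact: measurable_coord.
Qed.

Let boxes : set (set 'rV[R]_n) :=
  [set B | exists2 A : 'I_n -> set R, (forall i, measurable (A i)) &
     B = [set x : 'rV[R]_n | forall i, A i (x 0 i)]].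

Let measurable_boxes : (@measurable _ 'rV[R]_n) = <<s boxes >>.
Proof.
apply/seteqP; split=> B; last first.
  apply: smallest_sub; first exact: sigma_algebra_measurable.
  by move=> _ [A mA ->]; exact: measurable_rV_box.
move: B; rewrite /measurable/=; apply: smallest_sub.
  exact: smallest_sigma_algebra.
rewrite -bigcup_seq => B [i _] [A mA <-]; apply: sub_sigma_algebra.
exists (fun j => if j == i then A else setT).
  by move=> j; case: ifP.
apply/seteqP; split=> x /=.
  by move=> [_ Ax] j; case: eqP => // ->.
by move=> /(_ i); rewrite eqxx.
Qed.

(** Boxes determine the measure, and on a box the translation acts on each side
separately, where it preserves the length. *)
Lemma lebesgue_rV_shift (v : 'rV[R]_n) (B : set 'rV[R]_n) : measurable B ->
  mu ((fun x => x + v) @^-1` B) = mu B.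
Proof.
move=> mB; apply/esym; apply: (measure_unique boxes
  (fun k => [set x : 'rV[R]_n | forall i, `[- k%:R, k%:R]%classic (x 0 i)]) _ _ _ _ mu
  (measure_function_pushforward__canonical__measure_function_Measure mu
   (measurable_rV_shift v))) => //.
- move=> _ _ [A mA ->] [A' mA' ->]; exists (fun i => A i `&` A' i).
    by move=> i; exact: measurableI.
  apply/seteqP; split=> x /=; first by move=> [Ax A'x] i; split.
  by move=> AA'; split=> i; case: (AA' i).
- by move=> k; exists (fun=> `[- k%:R, k%:R]%classic).
- rewrite -subTset => x _; exists (Num.bound `|x|) => //= i.
  rewrite in_itv /= -ler_norml (le_trans (rV_norm_ge x i))// ltW//.
  exact: archi_boundP.
- move=> _ [A mA ->]; rewrite /= /pushforward lebesgue_rV_box//.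
  rewrite (_ : _ @^-1` _ =
      [set x : 'rV[R]_n | forall i, ((fun z => z + v 0 i) @^-1` A i) (x 0 i)]).
    rewrite (@lebesgue_rV_box _ _ (fun i => (fun z => z + v 0 i) @^-1` A i)) => [|i].
      by apply: eq_bigr => i _; rewrite lebesgue_measure_shift.
    rewrite -[X in measurable X]setTI; exact: measurable_shift.
  by apply/seteqP; split=> x /= Ax i; have := Ax i; rewrite mxE.
- move=> k; have := @lebesgue_closed_cube R n 0 k%:R (ler0n _ _).
  under eq_set do rewrite subr0.
  move=> E; apply: le_lt_trans (ltry ((2 * k%:R) ^+ n)); rewrite -E.
  apply: le_measure; rewrite ?inE.
  + by apply: (@measurable_rV_box R n (fun=> `[- k%:R, k%:R]%classic)).
  + have := @measurable_closed_cube R n 0 k%:R.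
    by under eq_set do rewrite subr0.
  + move=> x /= xk; apply/rV_norm_le => // i.
    by have := xk i; rewrite in_itv /= ler_norml.
Qed.

End rV_translation.

Section bounded_convergence.
Context d (T : measurableType d) (R : realType)
  (mu : {measure set T -> \bar R}) (D : set T).

Lemma bounded_integrable (f : T -> R) (M : R) :
  measurable D -> (mu D < +oo)%E -> measurable_fun D f ->
  (forall x, D x -> `|f x| <= M) -> mu.-integrable D (EFin \o f).
Proof.
move=> mD Doo mf fM; apply: measurable_bounded_integrable => //.
exists M; split; first by rewrite num_real.
by move=> x Mx y Dy /=; apply: le_trans (fM _ Dy) _; exact: ltW.
Qed.

Lemma bounded_convergence (f_ : nat -> T -> R) (f : T -> R) (M : R) :
  measurable D -> (mu D < +oo)%E -> (forall k, measurable_fun D (f_ k)) ->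
  (forall k x, D x -> `|f_ k x| <= M) ->
  (forall x, D x -> f_ ^~ x @ \oo --> f x) ->
  \int[mu]_(x in D) f_ k x @[k --> \oo] --> \int[mu]_(x in D) f x.
Proof.
move=> mD Doo mf_ fM ff.
have mf : measurable_fun D f by exact: measurable_fun_cvg ff.
have [] := @dominated_convergence _ _ _ mu D mD (fun k => EFin \o f_ k)
  (EFin \o f) (cst M%:E).
- by move=> k; exact/measurable_EFinP.
- exact/measurable_EFinP.
- by apply: aeW => x Dx; apply: cvg_EFin; [exact: nearW|exact: ff].
- apply: (bounded_integrable (M := `|M|)) => //; exact: measurable_cst.
- by apply: aeW => x k Dx; rewrite lee_fin; exact: fM.
move=> intf _ cvgI; apply: fine_cvg; rewrite fineK//.
exact: integrable_fin_num.
Qed.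

End bounded_convergence.

Section bounded_support.
Variables (R : realType) (n : nat).
Local Notation mu := (lebesgue_rV R n).
Implicit Types (f g : 'rV[R]_n -> R) (r : R).

Definition vanishes_beyond r f := forall x : 'rV[R]_n, r < `|x| -> f x = 0.

Let cube r : set 'rV[R]_n := [set x | `|x| <= r].

Let measurable_cube r : measurable (cube r).
Proof.
by have := @measurable_closed_cube R n 0 r; under eq_set do rewrite subr0.
Qed.

Lemma lebesgue_cube_lty r : (mu [set x | `|x| <= r]%R < +oo)%E.
Proof.
have : (mu (cube `|r|) < +oo)%E.
  have := @lebesgue_closed_cube R n 0 `|r| (normr_ge0 _).
  by under eq_set do rewrite subr0; move=> ->; rewrite ltry.
apply: le_lt_trans; apply: le_measure; rewrite ?inE; [exact: measurable_cube..|].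
by move=> x /= /le_trans; apply; exact: ler_norm.
Qed.

Let restrictE r f : vanishes_beyond r f -> f = f \_ (cube r).
Proof.
move=> f0; apply/funext => x; rewrite /restrict; case: ifPn => //.
by rewrite notin_setE /= => /negP; rewrite -ltNge => /f0.
Qed.

Lemma Rintegral_cube r f : vanishes_beyond r f ->
  \int[mu]_x f x = \int[mu]_(x in [set x | `|x| <= r]) f x.
Proof. by move=> /restrictE f0; rewrite {1}f0 [RHS]Rintegral_mkcond. Qed.

Lemma integrable_bounded_support r f (M : R) : measurable_fun setT f ->
  (forall x, `|f x| <= M) -> vanishes_beyond r f ->
  mu.-integrable setT (EFin \o f).
Proof.
move=> mf fM f0; rewrite (restrictE f0) -restrict_EFin.
apply/(integrable_mkcond _ (measurable_cube r)).
apply: (bounded_integrable (M := M)) => //; first exact: lebesgue_cube_lty.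
exact: measurable_funTS.
Qed.

Lemma bounded_convergence_rV r (f_ : nat -> 'rV[R]_n -> R) f (M : R) :
  (forall k, measurable_fun setT (f_ k)) -> (forall k x, `|f_ k x| <= M) ->
  (forall k, vanishes_beyond r (f_ k)) ->
  (forall x, f_ ^~ x @ \oo --> f x) ->
  \int[mu]_x f_ k x @[k --> \oo] --> \int[mu]_x f x.
Proof.
move=> mf_ fM f0 ff; have f00 : vanishes_beyond r f.
  move=> x rx; apply/esym; apply: (cvg_unique _ _ (ff x)) => //=.
  by under eq_cvg do rewrite f0//; exact: cvg_cst.
rewrite (Rintegral_cube f00).
under eq_cvg do rewrite (Rintegral_cube (f0 _)).
apply: (@bounded_convergence _ _ _ mu (cube r) f_ f M) => //.
  exact: lebesgue_cube_lty.
by move=> k; exact: measurable_funTS.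
Qed.

End bounded_support.

(** * Test functions *)

Section directional_derivatives.
Variables (R : realType) (V W : normedModType R).

Lemma is_derive_line (f : V -> W) (x v : V) (s : R) :
  derivable f (x + s *: v) v ->
  is_derive s 1 (fun s => f (x + s *: v)) ('D_v f (x + s *: v)).
Proof.
set g := fun s => f (x + s *: v).
have E : (fun h : R => h^-1 *: ((g \o shift s) (h *: (1 : R)) - g s)) =
    (fun h => h^-1 *: ((f \o shift (x + s *: v)) (h *: v) - f (x + s *: v))).
  apply/funext => h; congr (_ *: (f _ - _)); rewrite /= /shift.
  by rewrite [h *: 1]mulr1 scalerDl addrCA.
by move=> df; apply: DeriveDef; rewrite ?/derivable ?/derive E.
Qed.

End directional_derivatives.

Section mean_value.
Variables (R : realType) (V : normedModType R).

Lemma mean_value_line (f : V -> R) (x v : V) (h M : R) : 0 <= h ->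
  (forall s, 0 <= s <= h -> derivable f (x + s *: v) v) ->
  (forall s, 0 <= s <= h -> `|'D_v f (x + s *: v)| <= M) ->
  `|f (x + h *: v) - f x| <= M * h.
Proof.
move=> h0 df fM; pose g s := f (x + s *: v).
have dg s : 0 <= s <= h -> is_derive s 1 g ('D_v f (x + s *: v)).
  by move=> sh; apply: is_derive_line; exact: df.
have [||c ch] := @MVT_segment R g (fun s => 'D_v f (x + s *: v)) 0 h h0.
- by move=> s; rewrite in_itv /= => /andP[/ltW s0 /ltW sh]; apply: dg; rewrite s0.
- apply: derivable_within_continuous => s; rewrite in_itv /= => sh.
  by have [] := dg s sh.
rewrite /g scale0r addr0 subr0 => ->; rewrite normrM (ger0_norm h0).
by rewrite ler_wpM2r// fM//; move: ch; rewrite in_itv.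
Qed.

End mean_value.

Section harmonic_filters.
Variable R : realType.

Lemma cvg_harmonic_within (t : R) : 0 <= t ->
  @harmonic R @ \oo --> within [set h | 0 <= t + h] 0^'.
Proof.
move=> t0 A [e /= e0 Ae].
have [N _ hN] := near_infty_natSinv_lt (PosNum e0).
exists N => // k /hN /= ke; apply: Ae => //=.
- by rewrite sub0r normrN ger0_norm.
- by rewrite addr_ge0.
Qed.

Lemma cvg_harmonic_dnbhs : @harmonic R @ \oo --> 0^'.
Proof.
move=> A [e /= e0 Ae].
have [N _ hN] := near_infty_natSinv_lt (PosNum e0).
exists N => // k /hN /= ke; apply: Ae => //=.
- by rewrite sub0r normrN ger0_norm.
Qed.

End harmonic_filters.

Section rV_calculus.
Variables (R : realType) (n : nat).
Local Notation mu := (lebesgue_rV R n).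
Implicit Types (f g : 'rV[R]_n -> R) (x v : 'rV[R]_n) (r : R).

Lemma compact_cube r : compact [set x : 'rV[R]_n | `|x| <= r].
Proof.
apply: bounded_closed_compact.
  exists r; split; first exact: num_real.
  by move=> M rM x /= /le_trans; apply; exact: ltW.
rewrite (_ : mkset _ = (fun x : 'rV[R]_n => `|x|) @^-1` [set y | y <= r])//.
apply: closed_comp; last exact: closed_le.
by move=> x _; exact: norm_continuous.
Qed.

Lemma continuous_bounded_cube f r : continuous f ->
  exists M : R, forall x, `|x| <= r -> `|f x| <= M.
Proof.
move=> cf; have /compact_bounded[M [_ fM]] :
    compact (f @` [set x : 'rV[R]_n | `|x| <= r]).
  apply: continuous_compact; last exact: compact_cube.
  exact: continuous_subspaceT.
by exists (M + 1) => x xr; apply: fM; [rewrite ltrDl|exists x].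
Qed.

Lemma continuous_bounded f r : continuous f -> vanishes_beyond r f ->
  exists M : R, forall x, `|f x| <= M.
Proof.
move=> cf f0; have [M fM] := continuous_bounded_cube r cf.
exists `|M| => x; have [xr|xr] := leP `|x| r.
  by apply: le_trans (fM _ xr) _; exact: ler_norm.
by rewrite f0// normr0.
Qed.

Lemma derive_vanishes f r v : vanishes_beyond r f ->
  vanishes_beyond r (fun x => 'D_v f x).
Proof.
move=> f0 x rx; have D0 : is_derive x v f 0; last exact: derive_val.
have /near_eq_is_derive : \forall y \near x, cst 0 y = f y; last first.
  by apply; exact: is_derive_cst.
have : \forall y \near x, r < `|y|.
  apply: (@norm_continuous _ _ x [set y | r < y]).
  exact: (open_nbhs_nbhs (conj (@open_gt R r) rx)).
by apply: filterS => y /f0.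
Qed.

Lemma cvg_diff_quotient f x v : derivable f x v ->
  (harmonic k)^-1 * (f (x + harmonic k *: v) - f x) @[k --> \oo] --> 'D_v f x.
Proof.
move=> /cvg_ex[l fl]; rewrite /derive (cvg_lim _ fl)//.
rewrite (_ : (fun k => _) =
    (fun h => h^-1 *: ((f \o shift x) (h *: v) - f x)) \o @harmonic R).
  exact: cvg_comp _ _ (@cvg_harmonic_dnbhs R) fl.
by apply/funext => k; rewrite /= /shift /= [_ *: v + x]addrC.
Qed.

Lemma shift_integral f (M : R) r (v : 'rV[R]_n) : measurable_fun setT f ->
  (forall x, `|f x| <= M) -> vanishes_beyond r f ->
  \int[mu]_x f (x + v) = \int[mu]_x f x.
Proof.
move=> mf fM f0; have mv := @measurable_rV_shift R n v.
have fv0 : vanishes_beyond (r + `|v|) (fun x => f (x + v)).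
  move=> x rx; apply: f0; rewrite -[x in `|x|]/(x + v).
  have : `|x| <= `|x + v| + `|v| by rewrite -{1}(addrK v x) ler_normB.
  by lra.
have iv := @integrable_bounded_support R n _ _ M
  (measurableT_comp mf mv) (fun x => fM (x + v)) fv0.
rewrite /Rintegral; congr fine.
have /= := @integral_pushforward _ _ _ _ R _ mv mu setT (EFin \o f) _ iv measurableT.
rewrite preimage_setT => <-; last exact/measurable_EFinP.
by apply: eq_measure_integral => A mA _; rewrite /= /pushforward lebesgue_rV_shift.
Qed.

(** Translation invariance makes the integral of each difference quotient zero,
and the quotients converge boundedly to the derivative. *)
Lemma integral_derive_eq0 f r v : continuous f -> vanishes_beyond r f ->
  (forall x, derivable f x v) -> continuous (fun x => 'D_v f x) ->
  \int[mu]_x 'D_v f x = 0.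
Proof.
move=> cf f0 df cdf; have d0 := derive_vanishes v f0.
have [M fM] := continuous_bounded cf f0.
have [M' dM] := continuous_bounded cdf d0.
pose q k x := (harmonic k)^-1 * (f (x + harmonic k *: v) - f x).
have mf : measurable_fun setT f by exact: continuous_measurable_rV.
have mfs k : measurable_fun setT (fun x => f (x + harmonic k *: v)).
  exact: (measurableT_comp mf (measurable_rV_shift _)).
have h1 k : harmonic k <= 1 :> R.
  by rewrite /harmonic /= invf_le1// ler1n.
have fs0 k : vanishes_beyond (r + `|v|) (fun x => f (x + harmonic k *: v)).
  move=> x rx; apply: f0.
  have : `|x| <= `|x + harmonic k *: v| + `|harmonic k *: v|.
    by rewrite -{1}(addrK (harmonic k *: v) x) ler_normB.
  rewrite normrZ (ger0_norm (ltW (harmonic_gt0 _))).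
  have := ler_wpM2r (normr_ge0 v) (h1 k); lra.
have f0' : vanishes_beyond (r + `|v|) f.
  by move=> x rx; apply: f0; apply: le_lt_trans rx; rewrite lerDl.
have cq : \int[mu]_x q k x @[k --> \oo] --> \int[mu]_x 'D_v f x.
  apply: (@bounded_convergence_rV R n (r + `|v|) q _ M').
  - move=> k; apply: measurable_funM; first exact: measurable_cst.
    exact: measurable_funB.
  - move=> k x; rewrite /q normrM ger0_norm ?invr_ge0//.
    rewrite ler_pdivrMl ?harmonic_gt0// mulrC; apply: mean_value_line => [|//|s _]; last exact: dM.
    by rewrite ltW// harmonic_gt0.
  - by move=> k x rx; rewrite /q fs0// f0'// subr0 mulr0.
  - by move=> x; exact: cvg_diff_quotient.
apply/esym; apply: (cvg_unique _ _ cq) => //.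
rewrite (_ : (fun k => _) = cst 0); first exact: cvg_cst.
apply/funext => k; rewrite /q /=.
have i1 : mu.-integrable setT (EFin \o (fun x => f (x + harmonic k *: v))).
  exact: (integrable_bounded_support (mfs k) (fun x => fM _) (fs0 k)).
have i2 := integrable_bounded_support mf fM f0.
rewrite RintegralZl//; last first.
  exact: (integrableB measurableT i1 i2).
by rewrite RintegralB// (shift_integral _ mf fM f0) subrr mulr0.
Qed.

Lemma derive_delta f x v : differentiable f x ->
  'D_v f x = \sum_j v 0 j * 'D_(delta_mx 0 j) f x.
Proof.
move=> df; rewrite deriveE// {1}(row_sum_delta v) linear_sum /=.
by apply: eq_bigr => j _; rewrite linearZ /= deriveE.
Qed.

End rV_calculus.

Section bump.
Variables (R : realType) (n : nat).
Local Notation mu := (lebesgue_rV R n).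
Implicit Types (x v a : 'rV[R]_n) (r : R).

Let sqrpos (z : R) : R := Num.max 0 z ^+ 2.

(** Taylor's formula with remainder at most [h ^+ 2] survives at the origin,
where the positive part has a corner. *)
Let is_derive_sqrpos (z : R) : is_derive z 1 sqrpos (2 * Num.max 0 z).
Proof.
suff cv : h^-1 *: ((sqrpos \o shift z) (h *: (1 : R)) - sqrpos z) @[h --> 0^']
    --> 2 * Num.max 0 z.
  by apply: DeriveDef; [apply/cvg_ex; exists (2 * Num.max 0 z)|exact: cvg_lim].
apply/cvgrPdist_le => /= e e0; near=> h.
have h0 : h != 0 by near: h; exact: nbhs_dnbhs_neq.
have he : `|h| <= e.
  near: h; apply: cvg_within; apply: (@nbhs0_le R R e e0).
rewrite [h *: 1]mulr1 /sqrpos /shift /=.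
set A := 2 * _; set B := Num.max 0 (h + z) ^+ 2 - _.
have -> : A - h^-1 *: B = h^-1 * (A * h - B).
  by rewrite mulrBr mulrCA (mulVf h0) mulr1.
rewrite normrM normfV ler_pdivrMl ?normr_gt0//.
apply: (@le_trans _ _ (`|h| * `|h|)); last by rewrite ler_wpM2l.
have -> : `|h| * `|h| = h * h by rewrite -normrM ger0_norm// -expr2 sqr_ge0.
rewrite /A /B ler_norml !expr2.
by case: (leP 0 (h + z)); case: (leP 0 z) => z1 z2; apply/andP; split; nra.
Unshelve. all: by end_near. Qed.

Let dist2 a x : R := \sum_i (x 0 i - a 0 i) ^+ 2.

(** The Euclidean distance is used, and not the norm of the row vectors, since
the supremum norm is not differentiable. *)
Definition rV_bump a r x : R := Num.max 0 (r ^+ 2 - dist2 a x) ^+ 2.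

Let is_derive_dist2 a x v :
  is_derive x v (dist2 a) (\sum_i 2 * (x 0 i - a 0 i) * v 0 i).
Proof.
have -> : dist2 a =
    \sum_i ((fun x : 'rV[R]_n => x 0 i) - cst (a 0 i)) ^+ 2.
  apply/funext => y; rewrite /dist2 fct_sumE; apply: eq_bigr => i _.
  by rewrite exprfctE.
have dc i : is_derive x v (fun x : 'rV[R]_n => x 0 i) (v 0 i).
  have dc := @differentiable_coord R 1 n x 0 i.
  apply: DeriveDef; first exact: diff_derivable.
  have := derive_mx (@derivable_id R 'rV[R]_n x v).
  by rewrite derive_id => /(congr1 (fun u : 'rV[R]_n => u 0 i)); rewrite mxE => <-.
apply: is_derive_eq; apply: eq_bigr => i _.
by rewrite subr0 /= expr1.
Qed.

Let differentiable_dist2 a x : differentiable (dist2 a) x.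
Proof.
have -> : dist2 a =
    \sum_i ((fun x : 'rV[R]_n => x 0 i) - cst (a 0 i)) ^+ 2.
  apply/funext => y; rewrite /dist2 fct_sumE; apply: eq_bigr => i _.
  by rewrite exprfctE.
apply: differentiable_sum => i; apply: differentiableX; apply: differentiableB.
  exact: differentiable_coord.
exact: differentiable_cst.
Qed.

Let differentiable_sqrpos (z : R) : differentiable sqrpos z.
Proof. by apply/derivable1_diffP; have [] := is_derive_sqrpos z. Qed.

Let bumpE a r : rV_bump a r = sqrpos \o (cst (r ^+ 2) - dist2 a).
Proof. by []. Qed.

Let differentiable_arg a r x : differentiable (cst (r ^+ 2) - dist2 a) x.
Proof. by apply: differentiableB; [exact: differentiable_cst|]. Qed.

Lemma differentiable_bump a r x : differentiable (rV_bump a r) x.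
Proof. by rewrite bumpE; apply: differentiable_comp. Qed.

Lemma continuous_bump a r : continuous (rV_bump a r).
Proof. by move=> x; apply: differentiable_continuous; exact: differentiable_bump. Qed.

Let derive_bump a r x v : 'D_v (rV_bump a r) x =
  2 * Num.max 0 (r ^+ 2 - dist2 a x) * - (\sum_i 2 * (x 0 i - a 0 i) * v 0 i).
Proof.
rewrite bumpE deriveE; last by rewrite -bumpE; exact: differentiable_bump.
rewrite diff_comp//= diff1E// derive1E.
have [_ ->] := is_derive_sqrpos ((cst (r ^+ 2) - dist2 a) x).
rewrite -deriveE// [_ *: _]mulrC; congr (_ * _).
have [_ ->] := is_deriveB (is_derive_cst (r ^+ 2) x v) (is_derive_dist2 a x v).
by rewrite sub0r.
Qed.

Let continuous_coord_sub a i : continuous (fun x : 'rV[R]_n => x 0 i - a 0 i).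
Proof. by apply: continuous_subf; [exact: coord_continuous|exact: cst_continuous]. Qed.

Lemma continuous_derive_bump a r v : continuous (fun x => 'D_v (rV_bump a r) x).
Proof.
have -> : (fun x => 'D_v (rV_bump a r) x) = (fun x =>
    2 * Num.max 0 (r ^+ 2 - dist2 a x) * - (\sum_i 2 * (x 0 i - a 0 i) * v 0 i)).
  by apply/funext => x; exact: derive_bump.
apply: continuous_mulf.
  apply: continuous_mulf; first exact: cst_continuous.
  apply: continuous_maxf; first exact: cst_continuous.
  by move=> x; exact: (differentiable_continuous (differentiable_arg a r x)).
apply: continuous_oppf; apply: continuous_sumf => i.
apply: continuous_mulf; last exact: cst_continuous.
by apply: continuous_mulf; [exact: cst_continuous|exact: continuous_coord_sub].
Qed.

Let dist2_ge a x i : (x 0 i - a 0 i) ^+ 2 <= dist2 a x.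
Proof.
rewrite /dist2 (bigD1 i)//= lerDl; apply: sumr_ge0 => j _; exact: sqr_ge0.
Qed.

Lemma bump_ge0 a r x : 0 <= rV_bump a r x.
Proof. exact: sqr_ge0. Qed.

Lemma bump_eq0 a r x : 0 <= r -> r < `|x - a| -> rV_bump a r x = 0.
Proof.
move=> r0 rx; have [i xi] : exists i, r < `|x 0 i - a 0 i|.
  apply: contrapT => /forallNP xr; move: rx; apply/negP; rewrite -leNgt.
  by apply/rV_norm_le => // i; rewrite !mxE leNgt; apply/negP; exact: xr.
rewrite /rV_bump max_l ?expr0n// subr_le0 (le_trans _ (dist2_ge a x i))//.
by rewrite -[leRHS]real_normK ?num_real// lerXn2r ?nnegrE// ltW.
Qed.

Lemma bump_vanishes a r : 0 <= r -> vanishes_beyond (`|a| + r) (rV_bump a r).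
Proof.
move=> r0 x rx; apply: bump_eq0 => //.
have : `|x| <= `|x - a| + `|a| by rewrite -{1}(subrK a x) ler_normD.
by lra.
Qed.

Lemma bump_gt0 a r : 0 < r ->
  exists2 e : R, 0 < e <= r & exists2 c : R, 0 < c &
    forall x, `|x - a| <= e -> c <= rV_bump a r x.
Proof.
(* on the cube of half-side [r / (2 (n + 1))] the squared Euclidean distance is
at most [n (r / (2 (n + 1))) ^+ 2 <= r ^+ 2 / 2] *)
move=> r0; exists (r / (2 * n.+1%:R)).
  rewrite divr_gt0//= ?mulr_gt0// ler_pdivrMr ?mulr_gt0//.
  rewrite ler_pMr// -natrM ler1n//.
exists ((r ^+ 2 / 2) ^+ 2); first by rewrite exprn_gt0// divr_gt0// exprn_gt0.
move=> x xe; rewrite /rV_bump lerXn2r ?nnegrE ?le_max ?lexx ?divr_ge0 ?sqr_ge0//.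
apply/orP; right; rewrite lerBrDr -lerBrDl.
apply: (@le_trans _ _ (\sum_(i < n) (r / (2 * n.+1%:R)) ^+ 2)).
  apply: ler_sum => i _; rewrite -[leLHS]real_normK ?num_real//.
  rewrite lerXn2r ?nnegrE ?(le_trans _ xe)//.
  by have := rV_norm_ge (x - a) i; rewrite !mxE => /le_trans; apply.
rewrite sumr_const card_ord exprMn -[leLHS]mulr_natr -mulrA.
have -> : r ^+ 2 - r ^+ 2 / 2 = r ^+ 2 * 2^-1 by lra.
rewrite ler_wpM2l ?sqr_ge0//.
have n1 : (n.+1%:R : R) != 0 by [].
have nN : (n%:R : R) <= n.+1%:R by rewrite ler_nat.
have N1 : (1 : R) <= n.+1%:R by rewrite ler1n.
set w := (2 * _)^-1; have w0 : 0 < w by rewrite invr_gt0 mulr_gt0.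
have wN : w * n.+1%:R = 2^-1 by rewrite /w; field.
have ww : 0 <= w * w by rewrite mulr_ge0 ?ltW.
have := ler_wpM2l ww nN; rewrite -[in leRHS]mulrA wN.
have := ler_wpM2l (ltW w0) N1; rewrite wN expr2; lra.
Qed.

(** If [f a > 0] then a bump with small support makes the integrand nonnegative
everywhere and bounded below on a smaller cube around [a]. *)
Lemma bump_orthogonal_eq0 (f : 'rV[R]_n -> R) a : continuous f ->
  (forall r, 0 < r -> \int[mu]_x (rV_bump a r x * f x) = 0) -> f a = 0.
Proof.
wlog fa0 : f / 0 < f a.
  move=> wl cf f0; have [fa|fa|//] := ltgtP (f a) 0; last exact: wl.
  apply/eqP; rewrite -oppr_eq0; apply/eqP; apply: (wl (fun x => - f x)).
  - by rewrite oppr_gt0.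
  - exact: continuous_oppf.
  move=> r r0; under eq_Rintegral do rewrite mulrN -mulN1r.
  have cbf : continuous (fun x => rV_bump a r x * f x).
    by apply: continuous_mulf; [exact: continuous_bump|exact: cf].
  have bf0 : vanishes_beyond (`|a| + r) (fun x => rV_bump a r x * f x).
    by move=> x rx; rewrite bump_vanishes ?mul0r// ltW.
  have [M bfM] := continuous_bounded cbf bf0.
  rewrite RintegralZl ?f0 ?mulr0//.
  exact: (integrable_bounded_support (continuous_measurable_rV cbf) bfM bf0).
move=> cf f0; exfalso.
have [e /= e0 fe] : exists2 e : R, 0 < e & forall x, `|x - a| <= e -> f a / 2 < f x.
  have fa2 : f a / 2 < f a by lra.
  have /nbhs_ballP[e /= e0 He] := cf a _ (open_nbhs_nbhs (conj (@open_gt R (f a / 2)) fa2)).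
  exists (e / 2); first by rewrite divr_gt0.
  move=> x xe; apply: He; rewrite -ball_normE /= distrC; lra.
have [e' /andP[e'0 e'e] [c c0 bc]] := bump_gt0 a e0.
have cbf : continuous (fun x => rV_bump a e x * f x).
  by apply: continuous_mulf; [exact: continuous_bump|exact: cf].
have bf0 : vanishes_beyond (`|a| + e) (fun x => rV_bump a e x * f x).
  by move=> x rx; rewrite bump_vanishes ?mul0r// ltW.
have [M bfM] := continuous_bounded cbf bf0.
have ibf := integrable_bounded_support (continuous_measurable_rV cbf) bfM bf0.
pose D : set 'rV[R]_n := [set x | `|x - a| <= e'].
have mD : measurable D by exact: measurable_closed_cube.
have mu_D : mu D = ((2 * e') ^+ n)%:E by apply: lebesgue_closed_cube; exact: ltW.
have : \int[mu]_(x in D) (c * (f a / 2)) <= \int[mu]_x (rV_bump a e x * f x).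
  rewrite Rintegral_mkcond; apply: le_Rintegral => //.
    rewrite -restrict_EFin; apply/(integrable_mkcond _ mD).
    apply: (bounded_integrable (M := `|c * (f a / 2)|)) => //.
    by have := ltry ((2 * e') ^+ n); rewrite -mu_D.
  move=> x _; rewrite /patch; case: ifPn => [/set_mem xD|_].
    rewrite ler_pM ?(ltW c0)//; first by lra.
      exact: bc.
    by rewrite ltW// fe// (le_trans xD).
  have [xe|xe] := leP `|x - a| e; last by rewrite bump_eq0 ?mul0r// ltW.
  by rewrite mulr_ge0 ?bump_ge0// ltW// (lt_trans _ (fe _ xe))//; lra.
rewrite f0// Rintegral_cst// (_ : fine _ = (2 * e') ^+ n); last first.
  exact: (congr1 fine mu_D).
apply/negP; rewrite -ltNge.
by rewrite !mulr_gt0// ?exprn_gt0 ?mulr_gt0 ?invr_gt0.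
Qed.

End bump.

(** * Calculus in spacetime *)

Lemma lt_EFin_between (R : realType) (t : R) (T : \bar R) : (t%:E < T)%E ->
  exists2 T', t < T' & (T'%:E < T)%E.
Proof.
case: T => [T'| |] //= tT'.
  by exists ((t + T') / 2); move: tT'; rewrite !lte_fin; lra.
by exists (t + 1); rewrite ?ltry// ltrDl.
Qed.

Section spacetime_calculus.
Variables (R : realType) (n : nat).
Implicit Types (T : \bar R) (t : R) (x v : 'rV[R]_n).

Lemma within_comp (S U V : topologicalType) (A : set U) (B : set S)
    (f : U -> V) (g : S -> U) :
  {within A, continuous f} -> continuous g -> (forall s, B s -> A (g s)) ->
  {within B, continuous (f \o g)}.
Proof.
move=> /subspace_continuousP cf cg gBA; apply/subspace_continuousP => s Bs P Pn.
have H : nbhs s (g @^-1` [set u | A u -> P (f u)]) := cg s _ (cf _ (gBA _ Bs) P Pn).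
change (nbhs s (fun s' => B s' -> P (f (g s')))).
by apply: filterS H => s' H Bs'; exact: H (gBA _ Bs').
Qed.

Lemma spacetime_slice T (V : topologicalType) (F : R -> 'rV[R]_n -> V) t :
  {within spacetime T, continuous (fun p => F p.1 p.2)} ->
  0 <= t -> (t%:E < T)%E -> continuous (F t).
Proof.
move=> cF t0 tT.
have cg : continuous (fun x : 'rV[R]_n => (t, x)).
  move=> x P [[A B] [/= tA xB] AB]; apply: (filterS _ xB) => z Bz.
  by apply: AB; split => //; exact: nbhs_singleton tA.
have := @within_comp _ _ _ _ setT _ _ cF cg (fun x _ => conj t0 tT).
move=> /subspace_continuousP H x P Pn.
have {}H : nbhs x (fun y => setT y -> P (F t y)) := H x I P Pn.
by change (nbhs x (fun y => P (F t y))); apply: filterS H => y; exact.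
Qed.

Lemma continuous_ray x v : continuous (fun s : R => (s, x + s *: v)).
Proof.
move=> s P [[A B] [/= sA xB] AB].
have c : {for s, continuous (fun s : R => x + s *: v)}.
  by apply: cvgD; [exact: cvg_cst|apply: cvgZr_tmp; exact: cvg_id].
change (nbhs s (fun z => P (z, x + z *: v))).
by apply: filterS2 sA (c _ xB) => z Az Bz; exact: AB.
Qed.

Lemma spacetime_ray T (V : topologicalType) (F : R -> 'rV[R]_n -> V) (a b : R) x v :
  {within spacetime T, continuous (fun p => F p.1 p.2)} ->
  0 <= a -> (b%:E < T)%E ->
  {within `[a, b], continuous (fun s => F s (x + s *: v))}.
Proof.
move=> cF a0 bT.
have := @within_comp _ _ _ _ `[a, b]%classic _ _ cF (@continuous_ray x v).
apply => s /=; rewrite in_itv /= => /andP[sa sb]; split; first exact: le_trans sa.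
by apply: le_lt_trans bT; rewrite lee_fin.
Qed.

Lemma spacetime_time T (V : topologicalType) (F : R -> 'rV[R]_n -> V) (a b : R) x :
  {within spacetime T, continuous (fun p => F p.1 p.2)} ->
  0 <= a -> (b%:E < T)%E -> {within `[a, b], continuous (F ^~ x)}.
Proof.
move=> cF a0 bT; have := @spacetime_ray T V F a b x 0 cF a0 bT.
rewrite (_ : (fun s => _) = F ^~ x)//.
by apply/funext => s; rewrite scaler0 addr0.
Qed.

Lemma spacetime_bounded T (F : R -> 'rV[R]_n -> R) b r :
  {within spacetime T, continuous (fun p => F p.1 p.2)} -> (b%:E < T)%E ->
  exists M : R, forall t x, 0 <= t <= b -> `|x| <= r -> `|F t x| <= M.
Proof.
move=> cF bT; pose K := `[0, b] `*` [set x : 'rV[R]_n | `|x| <= r].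
have cK : compact K.
  by apply: compact_setX; [exact: segment_compact|exact: compact_cube].
have KT : K `<=` spacetime T.
  move=> [t x] [/= + _]; rewrite in_itv /= => /andP[t0 tb]; split=> //=.
  by apply: le_lt_trans bT; rewrite lee_fin.
have /compact_bounded[M [_ FM]] :
    compact ((fun p : R * 'rV[R]_n => F p.1 p.2) @` K).
  by apply: continuous_compact cK; exact: continuous_subspaceW cF.
exists (M + 1) => t x tb xr; apply: FM; first by rewrite ltrDl.
by exists (t, x) => //; split=> //=; rewrite in_itv.
Qed.

(** The constraint [0 <= t + h] is void near [h = 0] when [t > 0]. *)
Lemma is_derive_dt (f : R -> R) t : 0 < t -> cvg (time_quotient f t) ->
  is_derive t 1 f (dt f t).
Proof.
move=> t0; rewrite /dt /time_quotient.
have -> : within [set h | 0 <= t + h] 0^' = (0 : R)^'.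
  apply/seteqP; split=> A; last exact: cvg_within.
  move=> H; rewrite /within /= in H.
  have : \forall h \near (0 : R)^', 0 <= t + h.
    apply: cvg_within; exists t => //= h /=; rewrite sub0r normrN.
    by rewrite ltr_norml => /andP[]; lra.
  by move: H; apply: filterS2 => h Ah; exact: Ah.
have -> : (fun h => h^-1 *: (f (t + h) - f t)) =
    (fun h => h^-1 *: ((f \o shift t) (h *: (1 : R)) - f t)).
  by apply/funext => h; rewrite /= /shift /= [h *: 1]mulr1 [h + t]addrC.
by move=> cf; exact: DeriveDef.
Qed.

Variables (T : \bar R) (f : R -> 'rV[R]_n -> R).
Hypothesis fC1 : C1_spacetime T f.

Lemma C1_is_derive t x : 0 < t -> (t%:E < T)%E ->
  is_derive t 1 (f ^~ x) (dt (f ^~ x) t).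
Proof.
move=> t0 tT; apply: is_derive_dt => //; have [_ df _ _] := fC1.
by have [] := df (t, x) (conj (ltW t0) tT).
Qed.

Lemma time_mean_value a b x : 0 <= a -> a < b -> (b%:E < T)%E ->
  exists2 c, a < c < b & f b x - f a x = dt (f ^~ x) c * (b - a).
Proof.
move=> a0 ab bT; have [cf _ _ _] := fC1.
have [||c cab ->] := @MVT R (f ^~ x) (fun s => dt (f ^~ x) s) a b ab.
- move=> s; rewrite in_itv /= => /andP[sa sb]; apply: C1_is_derive.
    exact: le_lt_trans sa.
  by apply: lt_trans bT; rewrite lte_fin.
- exact: spacetime_time cf a0 bT.
by exists c.
Qed.

Lemma time_quotient_mean_value t (h T' : R) x : h != 0 -> `|h| < t ->
  (T'%:E < T)%E -> `|h| < T' - t ->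
  exists2 c, `|t - c| <= `|h| & h^-1 * (f (t + h) x - f t x) = dt (f ^~ x) c.
Proof.
move=> h0 + T'T; move: h0; case: (ltgtP h 0) => // h0 _.
  rewrite (ltr0_norm h0) => ht hT.
  have a0 : 0 <= t + h by lra.
  have ab : t + h < t by lra.
  have bT : (t%:E < T)%E by apply: lt_trans T'T; rewrite lte_fin; lra.
  have [c cth E] := time_mean_value x a0 ab bT.
  exists c; first by rewrite ger0_norm; lra.
  by rewrite -opprB E; field; rewrite lt_eqF.
rewrite (gtr0_norm h0) => ht hT.
have t0 : 0 <= t by lra.
have ab : t < t + h by lra.
have bT : ((t + h)%:E < T)%E by apply: lt_trans T'T; rewrite lte_fin; lra.
have [c cth ->] := time_mean_value x t0 ab bT.
exists c; first by rewrite ler0_norm; lra.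
by field; rewrite gt_eqF.
Qed.

(** The increment along the ray is split into a space increment at time [t] and
a time increment at the displaced point. The latter is a value of [dt f] at a
nearby point of spacetime by the mean value theorem, so that its limit follows
from the joint continuity of [dt f]. *)
Lemma is_derive_ray t x v : 0 < t -> (t%:E < T)%E ->
  differentiable (f t) (x + t *: v) ->
  is_derive t 1 (fun s => f s (x + s *: v))
    (dt (f ^~ (x + t *: v)) t + 'D_v (f t) (x + t *: v)).
Proof.
move=> t0 tT dft; set y := x + t *: v.
have [_ _ cdt _] := fC1.
pose f0 (h : R) := f t (y + h *: v).
have [dv vD] : is_derive (0 : R) 1 f0 ('D_v (f t) y).
  have := @is_derive_line R _ _ (f t) y v 0.
  by rewrite scale0r addr0; apply; exact: diff_derivable.
pose q (h : R) := h^-1 * (f (t + h) (y + h *: v) - f t (y + h *: v)).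
have cq : q h @[h --> 0^'] --> dt (f ^~ y) t.
  apply/cvgrPdist_le => e e0.
  have cl : (fun p => dt (f ^~ p.2) p.1) p @[p --> within (spacetime T) (nbhs (t, y))]
      --> dt (f ^~ y) t.
    by move/subspace_continuousP : cdt => /(_ (t, y) (conj (ltW t0) tT)).
  move/cvgrPdist_le : cl => /(_ _ e0) [[A B] [/= /nbhs_ballP[a /= a0 aA]
    /nbhs_ballP[b /= b0 bB]] AB].
  have [T' tT' T'T] := lt_EFin_between tT.
  near=> h.
  have h0 : h != 0 by near: h; exact: nbhs_dnbhs_neq.
  have ha : `|h| < a by near: h; apply: cvg_within; exact: (@nbhs0_lt R R).
  have ht : `|h| < t by near: h; apply: cvg_within; exact: (@nbhs0_lt R R).
  have hT : `|h| < T' - t.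
    by near: h; apply: cvg_within; apply: (@nbhs0_lt R R); rewrite subr_gt0.
  have hb : `|h| * `|v| < b.
    apply: (@le_lt_trans _ _ (`|h| * (`|v| + 1))).
      by rewrite ler_wpM2l// lerDl.
    rewrite -ltr_pdivlMr ?ltr_wpDl//.
    by near: h; apply: cvg_within; apply: (@nbhs0_lt R R); rewrite divr_gt0// ltr_wpDl.
  have [c ch ->] : exists2 c, `|t - c| <= `|h| & q h = dt (f ^~ (y + h *: v)) c.
    exact: (time_quotient_mean_value _ h0 ht T'T hT).
  have := AB (c, y + h *: v); apply => /=.
    split => /=.
      by apply: aA; rewrite -ball_normE /=; exact: le_lt_trans ha.
    by apply: bB; rewrite -ball_normE /= opprD addrA subrr sub0r normrN normrZ.
  move: ch; rewrite ler_norml => /andP[c1 c2]; split => /=; first by lra.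
  by apply: lt_trans T'T; rewrite lte_fin; lra.
set g := fun s => _.
have cg : h^-1 *: ((g \o shift t) (h *: (1 : R)) - g t) @[h --> 0^'] -->
    dt (f ^~ y) t + 'D_v (f t) y.
  have -> : (fun h : R => h^-1 *: ((g \o shift t) (h *: (1 : R)) - g t)) =
     (fun h => q h + h^-1 *: ((f0 \o shift 0) (h *: (1 : R)) - f0 0)).
    apply/funext => h; rewrite /q /g /f0 /= /shift /= [h *: 1]mulr1 addr0 scale0r.
    rewrite addr0 -/y [h + t]addrC scalerDl addrA -/y -mulrDr.
    by rewrite addrA subrK.
  by apply: cvgD; [exact: cq|rewrite -vD; exact: dv].
by apply: DeriveDef; [apply/cvg_ex; exists (dt (f ^~ y) t + 'D_v (f t) y)|exact: cvg_lim].
Unshelve. all: by end_near. Qed.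

End spacetime_calculus.

(** * Characteristics of the Burgers equation *)

Section gronwall.
Variable R : realType.

(** The function [exp (- L s) E s] is nonincreasing. *)
Lemma gronwall_le0 (E dE : R -> R) (L t : R) : 0 <= t ->
  {within `[0, t], continuous E} ->
  (forall s, 0 < s < t -> is_derive s 1 E (dE s)) ->
  (forall s, 0 < s < t -> dE s <= L * E s) -> E 0 <= 0 -> E t <= 0.
Proof.
move=> t0 cE dEs dEL E0; pose ex (s : R) := expR (- L * s).
have dex (s : R) : is_derive s 1 ex (- L * ex s).
  have : is_derive s 1 (expR \o (fun s : R => - L * s)) (expR (- L * s) * - L).
    apply: is_derive1_comp.
    have := @is_deriveZ _ _ _ (@id R) (- L) s 1 1 (is_derive_id s 1).
    by rewrite [_ *: 1]mulr1.
  by rewrite [in X in X -> _]mulrC.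
have dG s : 0 < s < t -> is_derive s 1 (ex * E) (ex s * (dE s - L * E s)).
  move=> st; have := dEs s st => dEs'.
  apply: is_derive_eq; rewrite /GRing.scale /=; ring.
have G0 : (ex * E) t <= (ex * E) 0.
  apply: (@ler0_derive1_le_cc R (ex * E) 0 t).
  - by move=> s; rewrite in_itv /= => st; have [] := dG s st.
  - move=> s; rewrite in_itv /= => st; have [_ dGs] := dG s st.
    rewrite derive1E dGs pmulr_rle0 ?expR_gt0// subr_le0; exact: dEL.
  - move=> s; apply: continuousM; last exact: cE.
    apply: continuous_subspaceT => r; apply: differentiable_continuous.
    by apply/derivable1_diffP; have [] := dex r.
  - by rewrite in_itv /= lexx t0.
  - by rewrite in_itv /= lexx t0.
  - exact: t0.
have : ex t * E t <= 0.
  apply: le_trans G0 _; change (ex 0 * E 0 <= 0).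
  by rewrite pmulr_rle0 ?expR_gt0.
by rewrite pmulr_rle0// expR_gt0.
Qed.

End gronwall.

Section coordinates.
Variables (R : realType) (n m : nat).

Lemma cvg_time_quotient_coord (F : R -> 'rV[R]_m) t i :
  cvg (time_quotient F t) ->
  time_quotient (fun s => F s 0 i) t --> dt F t 0 i.
Proof.
move=> cF; have := cvg_comp _ _ cF (@coord_continuous R 1 m 0 i (dt F t)).
rewrite /time_quotient.
rewrite (_ : _ \o _ = (fun h => h^-1 *: (F (t + h) 0 i - F t 0 i)))//.
by apply/funext => h; rewrite /= !mxE.
Qed.

Lemma time_quotient_proper (t : R) : 0 <= t ->
  ProperFilter (within [set h | 0 <= t + h] 0^').
Proof.
move=> t0; split; last exact: within_filter.
by move=> /(cvg_harmonic_within t0)[N _ /(_ N)]; apply => /=.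
Qed.

Lemma dt_coord (F : R -> 'rV[R]_m) t i : 0 <= t -> cvg (time_quotient F t) ->
  dt (fun s => F s 0 i) t = dt F t 0 i.
Proof.
move=> t0 cF; have PF := time_quotient_proper t0.
by apply: cvg_lim => //; exact: cvg_time_quotient_coord.
Qed.

Lemma dx_coord (f : 'rV[R]_n -> 'rV[R]_m) x (j : 'I_n) i :
  derivable f x (delta_mx 0 j) -> dx j (fun y => f y 0 i) x = dx j f x 0 i.
Proof. by move=> df; rewrite /dx (derive_mx df) mxE. Qed.

Lemma C1_spacetime_coord T (u : R -> 'rV[R]_n -> 'rV[R]_m) i :
  C1_spacetime T u -> C1_spacetime T (fun t x => u t x 0 i).
Proof.
move=> [cu du cdt cdx]; have cc := @coord_continuous R 1 m 0 i; split.
- by move=> p; apply: continuous_comp (cu p) (cc _).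
- move=> p pT; have [dup dxp] := du p pT; split.
    by apply/cvg_ex; eexists; exact: cvg_time_quotient_coord.
  by move=> j; have /derivable_mxP := dxp j; apply.
- apply: (@subspace_eq_continuous _ _ _ (fun p => dt (u ^~ p.2) p.1 0 i)).
    move=> p /set_mem pT; have [dup _] := du p pT.
    change (dt (u ^~ p.2) p.1 0 i = dt (fun s => u s p.2 0 i) p.1).
    by rewrite dt_coord//; case: pT.
  by move=> p; apply: continuous_comp (cdt p) (cc _).
- move=> j.
  apply: (@subspace_eq_continuous _ _ _ (fun p => dx j (u p.1) p.2 0 i)).
    move=> p /set_mem pT; have [_ dxp] := du p pT.
    change (dx j (u p.1) p.2 0 i = dx j (fun y => u p.1 y 0 i) p.2).
    by rewrite (dx_coord i (dxp j)).
  by move=> p; apply: continuous_comp (cdx j p) (cc _).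
Qed.

End coordinates.

Section burgers.
Variables (R : realType) (n : nat) (T : \bar R).
Variables (u0 : 'rV[R]_n -> 'rV[R]_n) (u : R -> 'rV[R]_n -> 'rV[R]_n).
Hypothesis uB : burgers_solution T u0 u.
Hypothesis uC1 : forall t, 0 < t -> (t%:E < T)%E -> C1 (u t).

Let uCi i : C1_spacetime T (fun t x => u t x 0 i).
Proof. by have [uC _ _] := uB; exact: C1_spacetime_coord. Qed.

Let diff_coord t x i : 0 < t -> (t%:E < T)%E ->
  differentiable (fun y => u t y 0 i) x.
Proof.
move=> t0 tT; have [du _] := uC1 t0 tT.
by apply: (@differentiable_comp _ _ _ _ (u t) (fun M : 'rV[R]_n => M 0 i) x) => //;
  exact: differentiable_coord.
Qed.

Lemma burgers_coord t x i : 0 < t -> (t%:E < T)%E ->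
  dt (fun s => u s x 0 i) t =
  - \sum_j u t x 0 j * dx j (fun y => u t y 0 i) x.
Proof.
move=> t0 tT; have [[_ du _ _] _ ub] := uB.
have [dut dux] := du (t, x) (conj (ltW t0) tT).
have /(congr1 (fun M : 'rV[R]_n => M 0 i)) := ub t x t0 tT.
rewrite !mxE -dt_coord ?ltW// summxE => /eqP; rewrite addr_eq0 => /eqP ->.
by congr (- _); apply: eq_bigr => j _; rewrite mxE (dx_coord i (dux j)).
Qed.

(** Compactness of [[0, b]] times a cube; the bound is uniform up to the initial
time. *)
Let gradient_bounded b r : (b%:E < T)%E -> exists2 L : R, 0 <= L &
  forall t x i j, 0 <= t <= b -> `|x| <= r -> `|dx j (fun y => u t y 0 i) x| <= L.
Proof.
move=> bT; have /choice[M hM] : forall ij : 'I_n * 'I_n, exists M : R,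
    forall t x, 0 <= t <= b -> `|x| <= r ->
    `|dx ij.2 (fun y => u t y 0 ij.1) x| <= M.
  move=> [i j] /=; have [_ _ _ cdx] := uCi i.
  exact: (@spacetime_bounded _ _ T (fun t => dx j (fun y => u t y 0 i))).
exists (\sum_ij `|M ij|); first by apply: sumr_ge0.
move=> t x i j tb xr; apply: le_trans (hM (i, j) t x tb xr) _.
apply: (le_trans (ler_norm _)); rewrite (bigD1 (i, j))//= lerDl.
exact: sumr_ge0.
Qed.

Let sum_pairs (L : R) (a : 'I_n -> R) :
  \sum_i \sum_(j < n) L * (a i + a j) = 2 * n%:R * L * \sum_i a i.
Proof.
under eq_bigr do rewrite -mulr_sumr big_split /= sumr_const card_ord.
rewrite -mulr_sumr big_split /= sumr_const card_ord sumrMnl.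
by move: (\sum_i a i) => S; rewrite -mulr_natr; ring.
Qed.

(** Let [w] be the deviation of [u] from [v = u0 s] along the straight line
issued from [s] with velocity [v]. The chain rule and the equation give
[w_i' = - sum_j w_j d_j u_i], which is linear in [w]; as the gradient is
bounded along the line, the squared length of [w] satisfies a Gronwall
inequality with initial value zero. *)
Lemma burgers_characteristic t s : 0 <= t -> (t%:E < T)%E ->
  u t (s + t *: u0 s) = u0 s.
Proof.
move=> t0 tT; set v := u0 s.
have [L L0 uL] := gradient_bounded (`|s| + t * `|v|) tT.
pose w i r := u r (s + r *: v) 0 i - v 0 i.
pose E r := \sum_i w i r ^+ 2.
pose dw i r := - \sum_j w j r * dx j (fun y => u r y 0 i) (s + r *: v).
have dwE i r : 0 < r < t -> is_derive r 1 (w i) (dw i r).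
  move=> /andP[r0 rt].
  have rT : (r%:E < T)%E by apply: lt_trans tT; rewrite lte_fin.
  have d := @is_derive_ray R n T _ (uCi i) r s v r0 rT (diff_coord _ _ r0 rT).
  have -> : w i = (fun r => u r (s + r *: v) 0 i) - cst (v 0 i) by [].
  apply: is_derive_eq; rewrite subr0 burgers_coord//.
  rewrite derive_delta; last exact: diff_coord.
  rewrite addrC -sumrB /dw -sumrN; apply: eq_bigr => j _.
  by rewrite /w mulrBl opprB.
have Et : E t <= 0.
  apply: (@gronwall_le0 R E (fun r => \sum_i 2 * w i r * dw i r) (2 * n%:R * L)) => //.
  - have cw i : {within `[0, t], continuous (w i)}.
      have [cu _ _ _] := uCi i.
      have := @spacetime_ray _ _ T _ (fun t x => u t x 0 i) 0 t s v cu (lexx _) tT.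
      move=> c r; apply: continuousB; first exact: c.
      by apply: continuous_subspaceT => ?; exact: cvg_cst.
    move=> r; rewrite /E; apply: continuous_big => [|i _].
      exact: add_continuous.
    by move=> r'; apply: continuousM; exact: cw.
  - move=> r rt; have -> : E = \sum_i (w i) ^+ 2.
      by apply/funext => x; rewrite /E fct_sumE; apply: eq_bigr => i _; rewrite exprfctE.
    have dwr i := dwE i r rt.
    by apply: is_derive_eq; apply: eq_bigr => i _; rewrite /= expr1.
  - move=> r /andP[r0 rt].
    (* [2 |w_i w_j| <= w_i ^+ 2 + w_j ^+ 2] for each term of the double sum *)
    apply: (@le_trans _ _ (\sum_i \sum_(j < n) L * (w i r ^+ 2 + w j r ^+ 2))).
      apply: ler_sum => i _; rewrite /dw mulrN -mulNr mulr_sumr; apply: ler_sum => j _.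
      set D := dx _ _ _.
      have : `|D| <= L.
        apply: uL; first by rewrite !ltW.
        apply: le_trans (ler_normD _ _) _; rewrite lerD2l normrZ.
        by rewrite ler_wpM2r// ger0_norm ltW.
      rewrite ler_norml => /andP[D1 D2]; rewrite !expr2.
      set a := w i r; set b := w j r.
      have : 0 <= (L - D) * (a - b) ^+ 2 by rewrite mulr_ge0 ?sqr_ge0// subr_ge0.
      have : 0 <= (L + D) * (a + b) ^+ 2.
        by rewrite mulr_ge0 ?sqr_ge0//; lra.
      rewrite !expr2; nra.
    by rewrite sum_pairs.
  - have [_ u00 _] := uB; rewrite /E big1// => i _.
    by rewrite /w scale0r addr0 u00 subrr expr0n.
apply/rowP => i; apply/eqP; rewrite -subr_eq0 -sqrf_eq0 eq_le sqr_ge0 andbT.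
apply: le_trans Et; rewrite /E (bigD1 i)//= lerDl.
by apply: sumr_ge0 => j _; exact: sqr_ge0.
Qed.

(** Together with [burgers_characteristic], which gives
[s = F s - t *: u t (F s)] for [F s = s + t *: u0 s], this bound says that
the inverse of the flow [F] is locally Lipschitz. *)
Lemma burgers_lipschitz t r : 0 < t -> (t%:E < T)%E -> exists2 L : R, 0 <= L &
  forall x y, `|x| <= r -> `|y| <= r -> `|u t x - u t y| <= L * `|x - y|.
Proof.
move=> t0 tT; have [L L0 uL] := gradient_bounded r tT.
exists (n%:R * L); first by rewrite mulr_ge0.
move=> x y xr yr; apply/rV_norm_le; first by rewrite !mulr_ge0.
move=> i; rewrite !mxE.
have := @mean_value_line R _ (fun z => u t z 0 i) y (x - y) 1
  (n%:R * L * `|x - y|) ler01.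
rewrite scale1r mulr1 [y + _]addrC subrK; apply => s s01.
  by apply: diff_derivable; exact: diff_coord.
rewrite derive_delta; last exact: diff_coord.
apply: le_trans (ler_norm_sum _ _ _) _.
have -> : n%:R * L * `|x - y| = \sum_(j < n) (`|x - y| * L).
  by rewrite sumr_const card_ord -mulr_natl; ring.
apply: ler_sum => j _; rewrite normrM ler_pM//; first exact: rV_norm_ge.
apply: uL; first by rewrite lexx ltW.
move: s01 => /andP[s0 s1].
have -> : y + s *: (x - y) = s *: x + (1 - s) *: y.
  by rewrite scalerBr scalerBl scale1r addrCA addrC -addrA [- _ + _]addrC addrA.
apply: le_trans (ler_normD _ _) _; rewrite !normrZ !ger0_norm ?subr_ge0//.
have := ler_wpM2l s0 xr; have s1' : 0 <= 1 - s by rewrite subr_ge0.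
have := ler_wpM2l s1' yr; lra.
Qed.

End burgers.

(** * Mixtures of measures *)

Section mixtures.
Context d1 d2 (X : measurableType d1) (Y : measurableType d2) (R : realType).
Local Open Scope ereal_scope.

Import HBNNSimple.

(** Both integrals are approximated by monotone convergence, so that the
right-hand side only mentions the measures of the mixture on the level sets of
simple functions. *)
Lemma mixture_integralE (mu : {measure set X -> \bar R}) (D : set X)
    (w : X -> R) (k : X -> {measure set Y -> \bar R}) (g : Y -> \bar R)
    (mg : measurable_fun setT g) :
  measurable D -> measurable_fun setT w -> (forall x, (0 <= w x)%R) ->
  (forall B, measurable B -> measurable_fun setT (fun x => k x B)) ->
  (forall y, 0 <= g y) ->
  \int[mu]_(x in D) ((w x)%:E * \int[k x]_y g y) =
  limn (fun m => let h := nnsfun_approx measurableT mg m in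
    \sum_(r \in range h) r%:E *
      \int[mu]_(x in D) ((w x)%:E * k x (h @^-1` [set r]))).
Proof.
move=> mD mw w0 mk g0; pose h := nnsfun_approx measurableT mg.
have mkh m : measurable_fun setT (fun x => \int[k x]_y (h m y)%:E).
  apply: measurable_fun_integral_kernel => //.
  - by move=> y; rewrite lee_fin.
  - exact/measurable_EFinP.
have mwE : measurable_fun setT (EFin \o w) by exact/measurable_EFinP.
transitivity (\int[mu]_(x in D) limn (fun m => (w x)%:E * \int[k x]_y (h m y)%:E)).
  apply: eq_integral => x _.
  have nd : {homo (fun m => \int[k x]_y (h m y)%:E) : a b / (a <= b)%N >-> a <= b}.
    move=> a b ab; apply: ge0_le_integral => //.
    - by move=> y _; rewrite lee_fin.
    - exact/measurable_EFinP.
    - exact/measurable_EFinP.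
    - by move=> y _; rewrite lee_fin; exact/lefP/nd_nnsfun_approx.
  rewrite limeMl//; last exact: ereal_nondecreasing_is_cvgn.
  congr (_ * _); rewrite -monotone_convergence//; last 3 first.
  - by move=> m; exact/measurable_EFinP.
  - by move=> m y _; rewrite lee_fin.
  - by move=> y _ a b ab; rewrite lee_fin; exact/lefP/nd_nnsfun_approx.
  apply: eq_integral => y _; apply/esym/cvg_lim => //.
  exact: cvg_nnsfun_approx.
rewrite monotone_convergence//; last 3 first.
- move=> m; apply: measurable_funTS; exact: emeasurable_funM.
- move=> m x _; rewrite mule_ge0 ?lee_fin//; apply: integral_ge0 => y _.
  by rewrite lee_fin.
- move=> x _ a b ab; rewrite lee_wpmul2l ?lee_fin//; apply: ge0_le_integral => //.
  + by move=> y _; rewrite lee_fin.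
  + exact/measurable_EFinP.
  + exact/measurable_EFinP.
  + by move=> y _; rewrite lee_fin; exact/lefP/nd_nnsfun_approx.
congr (limn _); apply/funext => m /=.
have mhr r : measurable (h m @^-1` [set r]) by [].
transitivity (\int[mu]_(x in D) \sum_(r \in range (h m))
    (r%:E * ((w x)%:E * k x (h m @^-1` [set r])))).
  apply: eq_integral => x _; rewrite integralT_nnsfun sintegralE.
  rewrite ge0_mule_fsumr; last first.
    by move=> r; apply: (mulemu_ge0 (fun r => h m @^-1` [set r])) => r';
      exact: preimage_nnfun0.
  by apply: eq_fsbigr => r _; rewrite muleCA.
have mint r : measurable_fun D (fun x => (w x)%:E * k x (h m @^-1` [set r])).
  by apply: measurable_funTS; apply: emeasurable_funM => //; exact: mk.
rewrite ge0_integral_fsum//; last 2 first.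
- by move=> r; exact: measurable_funeM.
- move=> r x _; rewrite muleCA mule_ge0 ?lee_fin//.
  by apply: (mulemu_ge0 (fun r => h m @^-1` [set r])) => r'; exact: preimage_nnfun0.
apply: eq_fsbigr => r /set_mem [y _ <-]; rewrite ge0_integralZl//.
- by move=> x _; rewrite mule_ge0// lee_fin.
- by rewrite lee_fin.
Qed.

End mixtures.

Section mixture_equality.
Import HBNNSimple.

(** By [mixture_integralE] both sides are limits of the same combinations of
values that agree by assumption. *)
Lemma mixture_integral_eq d1 d1' d2 (X : measurableType d1)
    (X' : measurableType d1') (Y : measurableType d2) (R : realType)
    (mu : {measure set X -> \bar R}) (D : set X) (w : X -> R)
    (k : X -> {measure set Y -> \bar R})
    (mu' : {measure set X' -> \bar R}) (D' : set X') (w' : X' -> R)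
    (k' : X' -> {measure set Y -> \bar R}) (g : Y -> \bar R) :
  measurable D -> measurable_fun setT w -> (forall x, 0 <= w x) ->
  (forall B, measurable B -> measurable_fun setT (fun x => k x B)) ->
  measurable D' -> measurable_fun setT w' -> (forall x, 0 <= w' x) ->
  (forall B, measurable B -> measurable_fun setT (fun x => k' x B)) ->
  (forall B, measurable B ->
    (\int[mu]_(x in D) ((w x)%:E * k x B) =
     \int[mu']_(x in D') ((w' x)%:E * k' x B))%E) ->
  measurable_fun setT g -> (forall y, (0 <= g y)%E) ->
  (\int[mu]_(x in D) ((w x)%:E * \int[k x]_y g y) =
   \int[mu']_(x in D') ((w' x)%:E * \int[k' x]_y g y))%E.
Proof.
move=> mD mw w0 mk mD' mw' w'0 mk' kk' mg g0.
rewrite (@mixture_integralE _ _ X Y R mu D w k g mg)//.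
rewrite (@mixture_integralE _ _ X' Y R mu' D' w' k' g mg)//.
congr (limn _); apply/funext => m /=; apply: eq_fsbigr => r _.
by rewrite kk'.
Qed.

End mixture_equality.

Section density_identity.
Context d (Tm : measurableType d) (R : realType) (n : nat)
  (Pr : probability Tm R).
Local Notation mu := (lebesgue_rV R n).
Variables (F v : 'rV[R]_n -> 'rV[R]_n) (Z : Tm -> 'rV[R]_n).
Variables (rho0 : 'rV[R]_n -> R) (P : 'rV[R]_n -> {measure set 'rV[R]_n -> \bar R}).
Hypotheses (mF : measurable_fun setT F) (mv : measurable_fun setT v)
  (mZ : measurable_fun setT Z) (mrho : measurable_fun setT rho0)
  (rho_ge0 : forall s, 0 <= rho0 s).
Hypothesis mP : forall B, measurable B -> measurable_fun setT (fun x => P x B).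
Hypothesis P_density : forall A B, measurable A -> measurable B ->
  (\int[mu]_(x in A) P x B =
   \int[mu]_s ((rho0 s)%:E * Pr [set w | A (F s + Z w)%R /\ B (v s)]))%E.

Let measurable_sum :
  measurable_fun setT (fun p : 'rV[R]_n * Tm => F p.1 + Z p.2).
Proof.
apply: measurable_fun_coordP => i; under eq_fun do rewrite mxE.
apply: measurable_funD.
- exact: (measurableT_comp (measurable_coord i) (measurableT_comp mF measurable_fst)).
- exact: (measurableT_comp (measurable_coord i) (measurableT_comp mZ measurable_snd)).
Qed.

Let measurable_sum_l s : measurable_fun setT (fun w => F s + Z w).
Proof.
apply: measurable_fun_coordP => i; under eq_fun do rewrite mxE.
by apply: measurable_funD => //; exact: (measurableT_comp (measurable_coord i) mZ).
Qed.

Let law s : {measure set 'rV[R]_n -> \bar R} :=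
  measure_function_pushforward__canonical__measure_function_Measure Pr
    (measurable_sum_l s).

Let measurable_law A : measurable A -> measurable_fun setT (fun s => law s A).
Proof.
move=> mA; rewrite /law /= /pushforward.
have mS : measurable ((fun p : 'rV[R]_n * Tm => F p.1 + Z p.2) @^-1` A).
  by rewrite -[X in measurable X]setTI; exact: measurable_sum.
have := @measurable_fun_xsection _ _ _ _ R Pr _ mS.
apply: eq_measurable_fun => s _; congr (Pr _).
by apply/seteqP; split=> w; rewrite /xsection/= inE.
Qed.

Let law_le1 s A : measurable A -> (law s A <= 1)%E.
Proof.
move=> mA; apply: probability_le1; rewrite -[X in measurable X]setTI.
exact: measurable_sum_l.
Qed.

Let law_fin s A : measurable A -> law s A = (fine (law s A))%:E.
Proof.
move=> mA; rewrite fineK// ge0_fin_numE//.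
by apply: le_lt_trans (law_le1 s mA) _; rewrite ltry.
Qed.

(** The hypothesis [P_density] is the case of indicator functions. The passage
to functions is made first in the velocity for a fixed set of positions, then
in the position, where the law of [F s + Z] is the mixing family; the last
exchange of integrals is Tonelli's theorem. *)
Lemma density_identity (g phi : 'rV[R]_n -> R) :
  measurable_fun setT g -> (forall u, 0 <= g u) ->
  measurable_fun setT phi -> (forall x, 0 <= phi x) ->
  (forall x, (\int[P x]_u (g u)%:E < +oo)%E) ->
  (\int[mu]_x ((\int[P x]_u g u)%R * phi x)%:E =
   \int[Pr]_w \int[mu]_s (rho0 s * g (v s) * phi (F s + Z w)%R)%:E)%E.
Proof.
move=> mg g0 mphi phi0 goo.
have Pg x : (\int[P x]_u (g u)%:E = (\int[P x]_u g u)%:E)%E.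
  rewrite /Rintegral fineK// ge0_fin_numE//.
  by apply: integral_ge0 => u _; rewrite lee_fin.
have gE0 u : (0 <= (g u)%:E)%E by rewrite lee_fin.
have pE0 u : (0 <= (phi u)%:E)%E by rewrite lee_fin.
have mgE : measurable_fun setT (EFin \o g) by exact/measurable_EFinP.
have mpE : measurable_fun setT (EFin \o phi) by exact/measurable_EFinP.
have mdirac (q : 'rV[R]_n -> 'rV[R]_n) : measurable_fun setT q ->
    forall B : set 'rV[R]_n, measurable B ->
    measurable_fun setT (fun s => \d_(q s) B : \bar R).
  move=> mq B mB; under eq_fun do rewrite diracE.
  apply/measurable_EFinP.
  have mi : measurable_fun setT (\1_B : 'rV[R]_n -> R) by exact: measurable_indic.
  have := measurableT_comp mi mq; apply: eq_measurable_fun => s _.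
  by rewrite /= indicE.
have step1 A : measurable A ->
    (\int[mu]_(x in A) (\int[P x]_u g u)%:E =
     \int[mu]_s ((rho0 s * g (v s))%:E * law s A))%E.
  move=> mA.
  have := @mixture_integral_eq _ _ _ _ _ _ R mu A (fun=> 1) P mu setT
    (fun s => rho0 s * fine (law s A)) (fun s => \d_(v s)) (EFin \o g).
  move=> H; transitivity (\int[mu]_(x in A) (1%:E * \int[P x]_u (g u)%:E))%E.
    by apply: eq_integral => x _; rewrite mul1e Pg.
  rewrite H//.
  - apply: eq_integral => s _; rewrite integral_dirac//= diracE mem_set//= mul1e.
    by rewrite -EFinM [in RHS](law_fin _ mA) -EFinM mulrAC.
  - apply: measurable_funM => //; apply: (measurableT_comp (fine_measurable measurableT)) => //.
    exact: measurable_law.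
  - by move=> s; rewrite mulr_ge0// fine_ge0.
  - exact: mdirac.
  - move=> B mB; under eq_integral do rewrite mul1e; rewrite P_density//.
    apply: eq_integral => s _; rewrite EFinM -law_fin// -muleA; congr (_ * _)%E.
    rewrite /= diracE; have [vB|vB] := boolP (v s \in B).
      rewrite mule1; congr (Pr _); apply/seteqP; split => w /=; first by case.
      by move=> ?; split => //; exact: set_mem.
    rewrite mule0 -(measure0 Pr); congr (Pr _); apply/seteqP; split => w //=.
    by move=> [_ /mem_set]; rewrite (negbTE vB).
transitivity (\int[mu]_x ((\int[P x]_u g u)%:E * \int[\d_x]_y (phi y)%:E))%E.
  apply: eq_integral => x _.
  by rewrite integral_dirac//= diracE mem_set//= mul1e EFinM.
rewrite (@mixture_integral_eq _ _ _ _ _ _ R mu setT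
    (fun x => \int[P x]_u g u) (fun x => \d_x) mu setT
    (fun s => rho0 s * g (v s)) law (EFin \o phi))//.
- transitivity (\int[mu]_s \int[Pr]_w (rho0 s * g (v s) * phi (F s + Z w)%R)%:E)%E.
    apply: eq_integral => s _.
    rewrite ge0_integral_pushforward//; last by move=> *; rewrite /= lee_fin.
    rewrite preimage_setT -ge0_integralZl//=.
    + by apply: measurableT_comp.
    + by rewrite lee_fin mulr_ge0.
  have mf : measurable_fun setT (fun p : 'rV[R]_n * Tm =>
      (rho0 p.1 * g (v p.1) * phi (F p.1 + Z p.2))%:E).
    apply/measurable_EFinP; apply: measurable_funM; last first.
      exact: measurableT_comp mphi measurable_sum.
    apply: measurable_funM; first exact: measurableT_comp mrho measurable_fst.
    exact: measurableT_comp (measurableT_comp mg mv) measurable_fst.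
  apply: (@fubini_tonelli _ _ _ _ R mu Pr _ mf) => p.
  by rewrite lee_fin !mulr_ge0.
- apply: (measurableT_comp (fine_measurable measurableT)) => //.
  exact: measurable_fun_integral_kernel.
- by move=> x; rewrite fine_ge0// integral_ge0.
- exact: mdirac.
- by apply: measurable_funM => //; exact: measurableT_comp mg mv.
- by move=> s; rewrite mulr_ge0.
- move=> B mB; rewrite -step1// [RHS]integral_mkcond; apply: eq_integral => x _.
  rewrite /= /patch diracE; case: ifPn => xB; first by rewrite mule1.
  by rewrite mule0.
Qed.

End density_identity.

(** * Densities under vanishing noise *)

Section vague_limit.
Context d (Tm : measurableType d) (R : realType) (n : nat)
  (Pr : probability Tm R).
Local Notation mu := (lebesgue_rV R n).
Variables (F v : 'rV[R]_n -> 'rV[R]_n) (W : Tm -> 'rV[R]_n)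
  (rho0 : 'rV[R]_n -> R) (P : nat -> 'rV[R]_n -> {measure set 'rV[R]_n -> \bar R})
  (K M : R).
Hypotheses (mF : measurable_fun setT F)
  (mv : measurable_fun setT v)
  (mW : measurable_fun setT W) (mrho : measurable_fun setT rho0)
  (rho_ge0 : forall s, 0 <= rho0 s) (rho_le : forall s, rho0 s <= K)
  (F_near : forall s, `|F s - s| <= M)
  (F_expanding : forall r, exists2 L : R, 0 <= L &
     forall x y, `|F x| <= r -> `|F y| <= r -> `|x - y| <= L * `|F x - F y|).
Hypotheses
  (mP : forall k B, measurable B -> measurable_fun setT (fun x => P k x B))
  (Poo : forall k x, (P k x setT < +oo)%E)
  (P_density : forall k A B, measurable A -> measurable B ->
    (\int[mu]_(x in A) P k x B = \int[mu]_s ((rho0 s)%:E *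
       Pr [set w | A (F s + harmonic k *: W w)%R /\ B (v s)]))%E).
Variables (g : 'rV[R]_n -> R) (G : R) (f : 'rV[R]_n -> R) (C0 : R).
Hypotheses (mg : measurable_fun setT g) (g_ge0 : forall u, 0 <= g u)
  (g_le : forall u, g u <= G).

Let Z k w : 'rV[R]_n := harmonic k *: W w.
Let f_ k x := \int[P k x]_u g u.

Hypotheses (cf_ : forall k, continuous (f_ k))
  (f_f : forall x, f_ ^~ x @ \oo --> f x) (f_le : forall x, f x <= C0).

Let K_ge0 : 0 <= K. Proof. exact: le_trans (rho_ge0 0) (rho_le 0). Qed.
Let G_ge0 : 0 <= G. Proof. exact: le_trans (g_ge0 0) (g_le 0). Qed.
Let M_ge0 : 0 <= M. Proof. exact: le_trans (normr_ge0 _) (F_near 0). Qed.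

Let f_ge0 k x : 0 <= f_ k x.
Proof. by apply: Rintegral_ge0. Qed.

Let Z_le k w : `|Z k w| <= `|W w|.
Proof.
rewrite /Z normrZ ger0_norm; last exact/ltW/harmonic_gt0.
rewrite ler_piMl//.
by rewrite /harmonic /= invf_le1// ler1n.
Qed.

Let mZ k : measurable_fun setT (Z k).
Proof.
apply: measurable_fun_coordP => i; under eq_fun do rewrite mxE.
by apply: measurable_funM => //; exact: (measurableT_comp (measurable_coord i) mW).
Qed.

Let cvg_Z w : Z ^~ w @ \oo --> (0 : 'rV[R]_n).
Proof.
rewrite -[X in _ --> X](scale0r (W w)).
by apply: cvgZr_tmp; exact: cvg_harmonic.
Qed.

Let measurable_FZ k w : measurable_fun setT (fun s => F s + Z k w).
Proof.
apply: (measurableT_comp (@measurable_rV_shift R n (Z k w))); exact: mF.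
Qed.

Let H (phi : 'rV[R]_n -> R) k w := \int[mu]_s (rho0 s * g (v s) * phi (F s + Z k w)).

Let integrand_vanishes (phi : 'rV[R]_n -> R) (r : R) (z : 'rV[R]_n) : vanishes_beyond r phi ->
  vanishes_beyond (r + M + `|z|)
    (fun s => rho0 s * g (v s) * phi (F s + z)).
Proof.
move=> phi0 s rs; rewrite phi0 ?mulr0//.
have : `|s| <= `|F s + z| + `|F s - s| + `|z|.
  rewrite {1}(_ : s = (F s + z) - (F s - s) - z); last first.
    by apply/rowP => i; rewrite !mxE; ring.
  by rewrite (le_trans (ler_normB _ _))// lerD2r ler_normB.
have := F_near s; lra.
Qed.

Let integrand_le (phi : 'rV[R]_n -> R) (Mphi : R) (z s : 'rV[R]_n) : (forall x, 0 <= phi x) ->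
  (forall x, phi x <= Mphi) ->
  `|rho0 s * g (v s) * phi (F s + z)| <= K * G * Mphi.
Proof.
move=> phi0 phiM; rewrite ger0_norm ?mulr_ge0//.
by rewrite !ler_pM ?mulr_ge0.
Qed.

Let measurable_integrand (phi : 'rV[R]_n -> R) k w : measurable_fun setT phi ->
  measurable_fun setT (fun s => rho0 s * g (v s) * phi (F s + Z k w)).
Proof.
move=> mphi; apply: measurable_funM.
  by apply: measurable_funM => //; exact: measurableT_comp mg mv.
exact: measurableT_comp mphi (measurable_FZ k w).
Qed.

Let integrable_integrand (phi : 'rV[R]_n -> R) (Mphi r : R) k w : measurable_fun setT phi ->
  (forall x, 0 <= phi x) -> (forall x, phi x <= Mphi) -> vanishes_beyond r phi ->
  mu.-integrable setT
    (EFin \o (fun s => rho0 s * g (v s) * phi (F s + Z k w))).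
Proof.
move=> mphi phi0 phiM phir.
exact: (integrable_bounded_support (measurable_integrand k w mphi)
  (fun s => integrand_le (Z k w) s phi0 phiM)
  (@integrand_vanishes phi r (Z k w) phir)).
Qed.

Let g_lty k x : (\int[P k x]_u (g u)%:E < +oo)%E.
Proof.
apply: (@le_lt_trans _ _ (\int[P k x]_u G%:E)%E).
  apply: ge0_le_integral => //.
  - by move=> u _; rewrite lee_fin.
  - exact/measurable_EFinP.
  - by move=> u _; rewrite lee_fin.
by rewrite integral_cst// lte_mul_pinfty.
Qed.

Let HE (phi : 'rV[R]_n -> R) (Mphi r : R) k : measurable_fun setT phi ->
  (forall x, 0 <= phi x) -> (forall x, phi x <= Mphi) -> vanishes_beyond r phi ->
  \int[mu]_x (f_ k x * phi x) = \int[Pr]_w H phi k w.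
Proof.
move=> mphi phi0 phiM phir; rewrite /Rintegral.
rewrite (@density_identity _ Tm R n Pr F v (Z k) rho0 (P k))//; last 2 first.
  exact: mP.
  exact: P_density.
congr fine; apply: eq_integral => w _; rewrite /H /Rintegral fineK//.
exact: integrable_fin_num (integrable_integrand k w mphi phi0 phiM phir).
Qed.

Let measurable_H (phi : 'rV[R]_n -> R) k : measurable_fun setT phi -> (forall x, 0 <= phi x) ->
  measurable_fun setT (H phi k).
Proof.
move=> mphi phi0; apply: (measurableT_comp (fine_measurable measurableT)) => //.
have msum : measurable_fun setT (fun p : 'rV[R]_n * Tm => F p.1 + Z k p.2).
  apply: measurable_fun_coordP => i; under eq_fun do rewrite mxE.
  apply: measurable_funD.
  - exact: (measurableT_comp (measurable_coord i) (measurableT_comp mF measurable_fst)).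
  - exact: (measurableT_comp (measurable_coord i) (measurableT_comp (mZ k) measurable_snd)).
have mf : measurable_fun setT (fun p : 'rV[R]_n * Tm =>
    (rho0 p.1 * g (v p.1) * phi (F p.1 + Z k p.2))%:E).
  apply/measurable_EFinP; apply: measurable_funM; last first.
    exact: measurableT_comp mphi msum.
  apply: measurable_funM; first exact: measurableT_comp mrho measurable_fst.
  exact: measurableT_comp (measurableT_comp mg mv) measurable_fst.
apply: (@measurable_fun_fubini_tonelli_G _ _ _ _ R mu _ mf) => p.
by rewrite lee_fin !mulr_ge0.
Qed.

Let delta k := \int[Pr]_w (\1_[set w | 1 < `|Z k w|] w : R).

Let measurable_far k : measurable [set w | 1 < `|Z k w|].
Proof.
have := mZ k measurableT (open_measurable_rV
  (open_comp (fun x _ => @norm_continuous _ 'rV[R]_n x) (@open_gt R 1))).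
by rewrite setTI.
Qed.

Let measurable_ind_far k :
  measurable_fun setT (\1_[set w | 1 < `|Z k w|] : Tm -> R).
Proof. exact: measurable_indic. Qed.

Let delta_cvg0 : delta k @[k --> \oo] --> 0.
Proof.
have <- : \int[Pr]_w (0 : R) = 0.
  by rewrite Rintegral_cst// mul0r.
apply: (@bounded_convergence _ _ _ Pr setT _ _ 1) => //.
- by rewrite (le_lt_trans (probability_le1 Pr measurableT))// ltry.
- by move=> k w _; rewrite indicE; case: (_ \in _); rewrite ?normr1 ?normr0.
- move=> w _; have := cvg_Z w.
  move/cvgr0Pnorm_lt => /(_ 1 ltr01) Zw.
  apply: cvg_near_cst; apply: filterS Zw => k Zk.
  by rewrite indicE memNset//= => /(lt_trans Zk); rewrite ltxx.
Qed.

(** If the noise stays in the unit ball, then [s |-> F s + Z k w] expands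
distances by at least [1 / L] over [A], and the mass sent into [A] is
controlled by the measure of [A]. If not, the only information is that [F s]
is at distance at most [M] from [s]. *)
Let H_ind_le (A : set 'rV[R]_n) (r L : R) k w : measurable A -> open A ->
  (forall x, A x -> `|x| <= r) -> 0 <= r -> 0 <= L ->
  (forall x y, `|F x| <= r + 1 -> `|F y| <= r + 1 ->
     `|x - y| <= L * `|F x - F y|) ->
  H \1_A k w <= K * G * ((2 * L) ^+ n * fine (mu A) +
     (2 * (r + M)) ^+ n * \1_[set w | 1 < `|Z k w|] w).
Proof.
move=> mA oA Ar r0 L0 FL; set z := Z k w.
pose S : set 'rV[R]_n := [set s | A (F s + z)].
have mS : measurable S.
  by have := measurable_FZ k w measurableT mA; rewrite setTI.
have Soo : (mu S <= ((2 * (r + M)) ^+ n)%:E)%E.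
  rewrite -(@lebesgue_closed_cube R n (- z)) ?addr_ge0//.
  apply: le_measure; rewrite ?inE//; first exact: measurable_closed_cube.
  move=> s /= /Ar sr.
  have -> : s - - z = (F s + z) - (F s - s) by apply/rowP => i; rewrite !mxE; ring.
  by rewrite (le_trans (ler_normB _ _))// lerD.
have Aoo : (mu A < +oo)%E.
  apply: le_lt_trans (lebesgue_cube_lty n r).
  apply: le_measure; rewrite ?inE//.
  by have := @measurable_closed_cube R n 0 r; under eq_set do rewrite subr0.
have Sfin : mu S \is a fin_num.
  by rewrite ge0_fin_numE//; apply: le_lt_trans Soo _; rewrite ltry.
have HS : H \1_A k w <= K * G * fine (mu S).
  have -> : K * G * fine (mu S) =
      \int[mu]_(s in S) (K * G).
    by rewrite Rintegral_cst.
  rewrite [leRHS]Rintegral_mkcond; apply: le_Rintegral => //.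
  - apply: (@integrable_integrand _ 1 r) => //.
    by move=> x rx; rewrite indicE memNset// => /Ar; rewrite leNgt rx.
  - rewrite -restrict_EFin; apply/(integrable_mkcond _ mS).
    apply: (@bounded_integrable _ _ _ _ _ _ `|K * G|) => //.
    by apply: le_lt_trans Soo _; rewrite ltry.
  - move=> s _; rewrite /patch indicE.
    have [AF|AF] := boolP (F s + z \in A).
      rewrite mulr1 ifT; last by rewrite inE /=; exact: set_mem.
      by rewrite ler_pM.
    by rewrite mulr0; case: ifP => // _; rewrite mulr_ge0.
apply: le_trans HS _; rewrite ler_wpM2l ?mulr_ge0// indicE.
have [far|near] := boolP (w \in _).
  rewrite mulr1; apply: ler_wpDl; first by rewrite mulr_ge0 ?exprn_ge0 ?mulr_ge0 ?fine_ge0.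
  by rewrite -lee_fin fineK.
have Afin : mu A \is a fin_num by rewrite ge0_fin_numE.
rewrite mulr0 addr0 -lee_fin EFinM !fineK//.
apply: (lebesgue_preimage_expanding (measurable_FZ k w) L0 oA) => x y Ax Ay.
have z1 : `|z| <= 1 by move: near; rewrite notin_setE /= => /negP; rewrite -leNgt.
have Fr s : A (F s + z) -> `|F s| <= r + 1.
  move=> /Ar sr; have -> : F s = (F s + z) - z by rewrite addrK.
  by rewrite (le_trans (ler_normB _ _))// lerD.
have -> : F x + Z k w - (F y + Z k w) = F x - F y.
  by apply/rowP => i; rewrite !mxE; ring.
by apply: FL; exact: Fr.
Qed.

Let integral_ind_le (A : set 'rV[R]_n) (r L : R) k : measurable A -> open A ->
  (forall x, A x -> `|x| <= r) -> 0 <= r -> 0 <= L ->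
  (forall x y, `|F x| <= r + 1 -> `|F y| <= r + 1 ->
     `|x - y| <= L * `|F x - F y|) ->
  \int[mu]_x (f_ k x * \1_A x) <=
  K * G * ((2 * L) ^+ n * fine (mu A)) + K * G * (2 * (r + M)) ^+ n * delta k.
Proof.
move=> mA oA Ar r0 L0 FL.
have mi : measurable_fun setT (\1_A : 'rV[R]_n -> R) by exact: measurable_indic.
have i0 x : 0 <= \1_A x :> R by rewrite indicE.
have i1 x : \1_A x <= 1 :> R by rewrite indicE; case: (_ \in _).
have ir : vanishes_beyond r (\1_A : 'rV[R]_n -> R).
  by move=> x rx; rewrite indicE memNset// => /Ar; rewrite leNgt rx.
rewrite (@HE _ 1 r)//.
set a := K * G * _; set b := _ * (2 * (r + M)) ^+ n.
have Proo : (Pr setT < +oo)%E.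
  by rewrite (le_lt_trans (probability_le1 Pr measurableT))// ltry.
have ifar : Pr.-integrable setT (EFin \o (\1_[set w | 1 < `|Z k w|] : Tm -> R)).
  apply: (@bounded_integrable _ _ _ _ _ _ 1) => // w _.
  by rewrite indicE; case: (_ \in _); rewrite ?normr1 ?normr0.
have ifar' : Pr.-integrable setT (EFin \o (fun w => b * \1_[set w | 1 < `|Z k w|] w)).
  apply: (@bounded_integrable _ _ _ _ _ _ `|b|) => //.
    exact: measurable_funM.
  move=> w _; rewrite indicE; case: (_ \in _); rewrite ?mulr1 ?mulr0 ?normr0//.
have ia : Pr.-integrable setT (EFin \o (fun=> a)).
  by apply: (@bounded_integrable _ _ _ _ _ _ `|a|).
have Hle w : H \1_A k w <= a + b * \1_[set w | 1 < `|Z k w|] w.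
  apply: le_trans (@H_ind_le A r L k w mA oA Ar r0 L0 FL) _.
  by rewrite mulrDr /a /b lerD2l mulrA.
have H0 w : 0 <= H \1_A k w.
  by apply: Rintegral_ge0 => s _; rewrite !mulr_ge0.
apply: (@le_trans _ _ (\int[Pr]_w (a + b * \1_[set w | 1 < `|Z k w|] w))).
  apply: le_Rintegral => //.
    apply: (@bounded_integrable _ _ _ _ _ _ (`|a| + `|b|)) => //.
      exact: measurable_H.
    move=> w _; rewrite ger0_norm//; apply: le_trans (Hle w) _.
    rewrite indicE; apply: lerD; first exact: ler_norm.
    by case: (_ \in _); rewrite ?mulr1 ?mulr0// ler_norm.
  exact: (integrableD measurableT ia ifar').
rewrite RintegralD// RintegralZl// Rintegral_cst//.
by rewrite [fine _](_ : _ = 1) ?mulr1// [X in fine X](_ : _ = 1%E)//; exact: probability_setT.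
Qed.

Let excess_set (r C : R) k : set 'rV[R]_n := [set x | `|x| < r /\ C < f_ k x].

Let excess_open r C k : open (excess_set r C k).
Proof.
apply: openI.
  exact: (open_comp (fun x _ => @norm_continuous _ 'rV[R]_n x) (@open_lt R r)).
by have /continuousP c := @cf_ k; exact: (c _ (@open_gt R C)).
Qed.

Let integrable_ind_density r C k (h : 'rV[R]_n -> R) : continuous h ->
  mu.-integrable setT (EFin \o (fun x => h x * \1_(excess_set r C k) x)).
Proof.
move=> ch; set A := excess_set r C k.
have Ar x : A x -> `|x| <= r by move=> -[/ltW].
have [Mh hM] := continuous_bounded_cube r ch.
apply: (@integrable_bounded_support R n r _ `|Mh|).
- apply: measurable_funM; first exact: continuous_measurable_rV.
  have mA : measurable A by apply: open_measurable_rV; exact: excess_open.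
  exact: measurable_indic.
- move=> x; rewrite indicE; have [xA|_] := boolP (x \in A).
    rewrite mulr1 (le_trans (hM x _)) ?ler_norm//.
    by apply: Ar; exact: set_mem.
  by rewrite mulr0 normr0.
- by move=> x rx; rewrite indicE memNset ?mulr0// => /Ar; rewrite leNgt rx.
Qed.

(** At a level above [K * G * (2 * L) ^+ n] the contribution of the small noise
to the mass of the excess set is compensated by the level itself. *)
Let excess_le (r L C : R) k : 0 < r -> 0 <= L ->
  (forall x y, `|F x| <= r + 1 -> `|F y| <= r + 1 ->
     `|x - y| <= L * `|F x - F y|) ->
  K * G * (2 * L) ^+ n <= C ->
  \int[mu]_x ((f_ k x - C) * \1_(excess_set r C k) x) <=
    K * G * (2 * (r + M)) ^+ n * delta k.
Proof.
move=> r0 L0 FL KC; set A := excess_set r C k.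
have oA : open A by exact: excess_open.
have mA := open_measurable_rV oA.
have Ar x : A x -> `|x| <= r by move=> -[/ltW].
have i1 := @integrable_ind_density r C k _ (@cf_ k).
have i2 := @integrable_ind_density r C k _ (@cst_continuous _ _ C).
have -> : \int[mu]_x ((f_ k x - C) * \1_A x) =
    \int[mu]_x (f_ k x * \1_A x) - C * fine (mu A).
  under eq_Rintegral do rewrite mulrBl.
  rewrite RintegralB//; congr (_ - _).
  have <- : \int[mu]_(x in A) C = C * fine (mu A) by rewrite Rintegral_cst.
  rewrite [RHS]Rintegral_mkcond; apply: eq_Rintegral => x _.
  by rewrite /patch indicE; case: ifPn => _; rewrite ?mulr1 ?mulr0.
rewrite lerBlDl; apply: le_trans (@integral_ind_le A r L k mA oA Ar (ltW r0) L0 FL) _.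
by rewrite lerD2r mulrA ler_wpM2r// fine_ge0.
Qed.

(** Pointwise convergence of the densities does not exclude a loss of mass by
concentration. The remedy is that the mass above a level which dominates the
Jacobian of the inverse of [F] comes from realisations of the noise outside the
unit ball, and hence disappears in the limit; below this level the convergence
is dominated. The right-hand side is the limit of the same integrals written on
the initial positions, where [Z k w] tends to zero for each [w]. *)
Lemma vague_limit (phi : 'rV[R]_n -> R) (r : R) : continuous phi ->
  (forall x, 0 <= phi x) -> vanishes_beyond r phi ->
  \int[mu]_x (f x * phi x) = \int[mu]_s (rho0 s * g (v s) * phi (F s)).
Proof.
move=> cphi phi0 phir'.
have [r1 r0 phir] : exists2 r : R, 0 < r & forall x, r <= `|x| -> phi x = 0.
  exists (`|r| + 1); first by rewrite ltr_wpDl.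
  move=> x rx; apply: phir'; apply: lt_le_trans rx.
  by rewrite (le_lt_trans (ler_norm r))// ltrDl.
move: r1 r0 phir => {phir'} {}r r0 phir.
have phiv : vanishes_beyond r phi by move=> x /ltW /phir.
have [Mp phiM'] := continuous_bounded cphi phiv.
have phiM x : phi x <= Mp by apply: le_trans (phiM' x); exact: ler_norm.
have Mp0 : 0 <= Mp by apply: le_trans (phi0 0) (phiM 0).
have mphi := continuous_measurable_rV cphi.
have [L L0 FL] := F_expanding (r + 1).
pose C := Num.max (K * G * (2 * L) ^+ n) C0.
have KC : K * G * (2 * L) ^+ n <= C by rewrite le_max lexx.
have C0C : C0 <= C by rewrite le_max lexx orbT.
have C_ge0 : 0 <= C by apply: le_trans KC; rewrite !mulr_ge0// exprn_ge0// mulr_ge0.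
have f0 x : 0 <= f x.
  rewrite -(cvg_lim _ (@f_f x))//; apply: limr_ge.
    by apply/cvg_ex; exists (f x); exact: (@f_f _).
  by apply: nearW => k; exact: f_ge0.
pose cut k x := Num.min (f_ k x) C * phi x.
have ccut k : continuous (cut k).
  apply: continuous_mulf => //; apply: continuous_minf => //.
  exact: cst_continuous.
have cutM k x : `|cut k x| <= C * Mp.
  rewrite ger0_norm; last by rewrite mulr_ge0// le_min f_ge0.
  by rewrite ler_pM// ?le_min ?f_ge0// ge_min lexx orbT.
have cutr k : vanishes_beyond r (cut k).
  by move=> x rx; rewrite /cut phiv ?mulr0.
have cvg_cut : \int[mu]_x cut k x @[k --> \oo] --> \int[mu]_x (f x * phi x).
  apply: (@bounded_convergence_rV R n r cut _ (C * Mp)) => //.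
    by move=> k; exact: continuous_measurable_rV.
  move=> x; rewrite /cut; apply: cvgM; last exact: cvg_cst.
  rewrite -[X in _ --> X](@min_l _ _ (f x) C) ?(le_trans (f_le x))//.
  apply: (@cvg_comp _ _ _ (f_ ^~ x) (fun y => Num.min y C) _ (nbhs (f x))).
    exact: (@f_f _).
  apply: (@continuous_minf R R id (fun=> C) _ (@cst_continuous _ _ C) (f x)).
  by move=> y; exact: cvg_id.
have cfp k : continuous (fun x => f_ k x * phi x) by exact: continuous_mulf.
have fpr k : vanishes_beyond r (fun x => f_ k x * phi x).
  by move=> x rx; rewrite phiv ?mulr0.
have ifp k : mu.-integrable setT (EFin \o (fun x => f_ k x * phi x)).
  have [M' fM] := continuous_bounded (cfp k) (fpr k).
  exact: (integrable_bounded_support (continuous_measurable_rV (cfp k)) fM (fpr k)).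
have icut k : mu.-integrable setT (EFin \o cut k).
  exact: (integrable_bounded_support (continuous_measurable_rV (ccut k)) (cutM k) (cutr k)).
have excess k : 0 <= \int[mu]_x (f_ k x * phi x) - \int[mu]_x cut k x <=
    Mp * (K * G * (2 * (r + M)) ^+ n) * delta k.
  rewrite -RintegralB//; apply/andP; split.
    apply: Rintegral_ge0 => x _; rewrite -mulrBl mulr_ge0// subr_ge0.
    by rewrite ge_min lexx.
  rewrite -[X in _ <= X]mulrA; set A := excess_set r C k.
  apply: (@le_trans _ _ (Mp * \int[mu]_x ((f_ k x - C) * \1_A x))); last first.
    by rewrite ler_wpM2l//; exact: (@excess_le r L C k).
  have iA := @integrable_ind_density r C k _
    (continuous_subf (@cf_ k) (@cst_continuous _ _ C)).
  rewrite -RintegralZl//; apply: le_Rintegral => //.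
  - exact: (integrableB measurableT (ifp k) (icut k)).
  - have := @integrableZl _ _ _ mu _ measurableT Mp _ iA.
    by apply: eq_integrable => // x _; rewrite /= EFinM.
  - move=> x _; rewrite /cut -mulrBl indicE.
    have [/set_mem[_ Cf]|xA] := boolP (x \in A).
      rewrite mulr1 (min_r (ltW Cf)) [leRHS]mulrC ler_wpM2l//.
      by rewrite subr_ge0 ltW.
    rewrite mulr0 mulr0; have [xr|xr] := ltP `|x| r.
      rewrite min_l ?subrr ?mul0r//; rewrite leNgt; apply/negP => Cf.
      by move: xA; rewrite notin_setE; apply.
    by rewrite phir// mulr0.
have cvg_l : \int[mu]_x (f_ k x * phi x) @[k --> \oo] --> \int[mu]_x (f x * phi x).
  have d0 : \int[mu]_x (f_ k x * phi x) - \int[mu]_x cut k x @[k --> \oo] --> 0.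
    apply: (@squeeze_cvgr _ _ _ _ (fun=> 0)
      (fun k => Mp * (K * G * (2 * (r + M)) ^+ n) * delta k)).
    - by apply: nearW => k; exact: excess.
    - exact: cvg_cst.
    - rewrite -[X in _ --> X](mulr0 (Mp * (K * G * (2 * (r + M)) ^+ n))).
      by apply: cvgM; [exact: cvg_cst|exact: delta_cvg0].
  rewrite -[X in _ --> X]add0r.
  rewrite (_ : (fun k => _) = (fun k => (\int[mu]_x (f_ k x * phi x) -
    \int[mu]_x cut k x) + \int[mu]_x cut k x)).
    exact: cvgD d0 cvg_cut.
  by apply/funext => k; rewrite subrK.
pose I0 := \int[mu]_s (rho0 s * g (v s) * phi (F s)).
have cvg_r : \int[Pr]_w H phi k w @[k --> \oo] --> \int[Pr]_w I0.
  apply: (@bounded_convergence _ _ _ Pr setT _ _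
    (K * G * Mp * (2 * (r + M)) ^+ n)) => //.
  - by rewrite (le_lt_trans (probability_le1 Pr measurableT))// ltry.
  - by move=> k; exact: measurable_H.
  - move=> k w _; rewrite ger0_norm; last first.
      by apply: Rintegral_ge0 => s _; rewrite !mulr_ge0.
    have rM : 0 <= r + M by rewrite addr_ge0// ltW.
    pose S : set 'rV[R]_n := [set s | `|s - - Z k w| <= r + M].
    have mS : measurable S by exact: measurable_closed_cube.
    have muS : mu S = ((2 * (r + M)) ^+ n)%:E by exact: lebesgue_closed_cube.
    have <- : \int[mu]_(s in S) (K * G * Mp) = K * G * Mp * (2 * (r + M)) ^+ n.
      by rewrite Rintegral_cst//; congr (_ * _); exact: (congr1 fine muS).
    rewrite [leRHS]Rintegral_mkcond; apply: le_Rintegral => //.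
    + exact: (@integrable_integrand _ Mp r).
    + rewrite -restrict_EFin; apply/(integrable_mkcond _ mS).
      apply: (@bounded_integrable _ _ _ _ _ _ `|K * G * Mp|) => //.
      by have := ltry ((2 * (r + M)) ^+ n); rewrite -muS.
    + move=> s _; rewrite /patch; case: ifPn => [_|sS].
        by apply: le_trans (integrand_le (Z k w) s phi0 phiM); exact: ler_norm.
      rewrite phiv ?mulr0//; rewrite ltNge; apply/negP => Fr.
      move: sS; rewrite notin_setE; apply.
      change (`|s - - Z k w| <= r + M); have -> : s - - Z k w = (F s + Z k w) - (F s - s).
        by apply/rowP => i; rewrite !mxE; ring.
      by rewrite (le_trans (ler_normB _ _))// lerD.
  - move=> w _; apply: (@bounded_convergence_rV R n (r + M + `|W w|) _ _ (K * G * Mp)).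
    + by move=> k; exact: measurable_integrand.
    + by move=> k x; exact: integrand_le.
    + move=> k x rx; apply: (@integrand_vanishes _ r (Z k w)) => //.
      by apply: le_lt_trans rx; rewrite lerD2l.
    + move=> x; apply: cvgM; first exact: cvg_cst.
      apply: (@cvg_comp _ _ _ (fun k => F x + Z k w) phi _ (nbhs (F x))); last exact: cphi.
      have : F x + Z k w @[k --> \oo] --> F x + 0.
        by apply: cvgD; [exact: cvg_cst|exact: cvg_Z].
      by rewrite addr0.
apply: (cvg_unique _ cvg_l) => //.
have EI : \int[Pr]_w I0 = I0.
  rewrite Rintegral_cst// [fine _](_ : _ = 1) ?mulr1//.
  by rewrite [X in fine X](_ : _ = 1%E)//; exact: probability_setT.
rewrite EI in cvg_r.
rewrite /= (_ : (fun k => _) = (fun k => \int[Pr]_w H phi k w))//.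
by apply/funext => k; exact: (@HE _ Mp r).
Qed.

End vague_limit.

(** * From transported mass to conservation laws *)

Section time_derivative.
Variable R : realType.

Lemma cvg_time_shift (f : R -> R) t : 0 <= t -> cvg (time_quotient f t) ->
  f (t + h) @[h --> within [set h | 0 <= t + h] 0^'] --> f t.
Proof.
move=> t0 cf; have PF := time_quotient_proper t0.
have ch : h @[h --> within [set h | 0 <= t + h] (0 : R)^'] --> (0 : R).
  by apply: cvg_within_filter; exact: cvg_within.
have : f t + h * (h^-1 *: (f (t + h) - f t)) @[h --> within [set h | 0 <= t + h] 0^']
    --> f t + 0 * dt f t.
  by apply: cvgD; [exact: cvg_cst|apply: cvgM].
rewrite mul0r addr0; apply: cvg_trans; apply: near_eq_cvg.
have : \forall h \near (0 : R)^', h != 0 by exact: nbhs_dnbhs_neq.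
apply: filterS => h h0 _.
by rewrite /GRing.scale /= mulrA divff// mul1r addrC subrK.
Qed.

Lemma dt_mul (f g : R -> R) t : 0 <= t ->
  cvg (time_quotient f t) -> cvg (time_quotient g t) ->
  time_quotient (fun s => f s * g s) t --> f t * dt g t + g t * dt f t.
Proof.
move=> t0 cf cg; have PF := time_quotient_proper t0.
have : f (t + h) * (h^-1 *: (g (t + h) - g t)) +
    g t * (h^-1 *: (f (t + h) - f t)) @[h --> within [set h | 0 <= t + h] 0^']
    --> f t * dt g t + g t * dt f t.
  apply: cvgD; first by apply: cvgM; [exact: cvg_time_shift|].
  by apply: cvgM; [exact: cvg_cst|].
rewrite /time_quotient.
rewrite (_ : (fun h => h^-1 *: (f (t + h) * g (t + h) - f t * g t)) = (fun h =>
  f (t + h) * (h^-1 *: (g (t + h) - g t)) + g t * (h^-1 *: (f (t + h) - f t))))//.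
by apply/funext => h; rewrite /GRing.scale /=; ring.
Qed.

(** Only nonnegative times below [T] enter the difference quotient at [t] for
small [h]. *)
Lemma eq_dt (T : \bar R) (f g : R -> R) t : 0 <= t -> (t%:E < T)%E ->
  (forall s, 0 <= s -> (s%:E < T)%E -> f s = g s) -> dt f t = dt g t.
Proof.
move=> t0 tT fg; rewrite /dt /time_quotient; congr (lim _).
have [T' tT' T'T] := lt_EFin_between tT.
have E : {near within [set h | 0 <= t + h] 0^',
    (fun h => h^-1 *: (f (t + h) - f t)) =1 (fun h => h^-1 *: (g (t + h) - g t))}.
  have : \forall h \near (0 : R)^', `|h| < T' - t.
    by apply: cvg_within; apply: (@nbhs0_lt R R); rewrite subr_gt0.
  apply: filterS => h hT' th; rewrite !fg//.
  apply: lt_trans T'T; rewrite lte_fin.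
  by move: hT'; rewrite ltr_norml => /andP[_]; lra.
rewrite eqEsubset; split; apply: near_eq_cvg => //.
by apply: filterS E => h /esym.
Qed.

End time_derivative.

Section burgers_closed.
Variables (R : realType) (n : nat) (T : \bar R).
Variables (u0 : 'rV[R]_n -> 'rV[R]_n) (u : R -> 'rV[R]_n -> 'rV[R]_n).
Hypothesis uB : burgers_solution T u0 u.

(** The equation extends to the initial time by continuity of the partial
derivatives. *)
Lemma burgers_coord_closed t x i : 0 <= t -> (t%:E < T)%E ->
  dt (fun s => u s x 0 i) t +
  \sum_j u t x 0 j * dx j (fun y => u t y 0 i) x = 0.
Proof.
rewrite le_eqVlt => /predU1P[<-|t0] tT; last first.
  by rewrite (burgers_coord uB)// addNr.
have uCi k : C1_spacetime T (fun t x => u t x 0 k).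
  by have [uC _ _] := uB; exact: C1_spacetime_coord.
have [T' T'0 T'T] := lt_EFin_between tT.
pose e s := dt (fun s => u s x 0 i) s +
  \sum_j u s x 0 j * dx j (fun y => u s y 0 i) x.
have ce : {within `[0, T'], continuous e}.
  have c1 : {within `[0, T'], continuous (fun s => dt (fun s => u s x 0 i) s)}.
    have [_ _ c _] := uCi i.
    exact: (@spacetime_time _ _ T _ (fun t x => dt (fun s => u s x 0 i) t)).
  have c2 j : {within `[0, T'], continuous (fun s => u s x 0 j)}.
    have [c _ _ _] := uCi j.
    exact: (@spacetime_time _ _ T _ (fun t x => u t x 0 j)).
  have c3 j : {within `[0, T'], continuous (fun s => dx j (fun y => u s y 0 i) x)}.
    have [_ _ _ c] := uCi i.
    exact: (@spacetime_time _ _ T _ (fun t x => dx j (fun y => u t y 0 i) x)).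
  apply: (@continuous_addf R (subspace `[0, T']%classic)) => //.
  apply: (@continuous_sumf R (subspace `[0, T']%classic)) => j.
  exact: (@continuous_mulf R (subspace `[0, T']%classic) (fun s => u s x 0 j)
    (fun s => dx j (fun y => u s y 0 i) x) (c2 j) (c3 j)).
have ce0 : e s @[s --> within `[0, T'] (nbhs 0)] --> e 0.
  move/subspace_continuousP : ce; apply => /=.
  by rewrite in_itv /= lexx ltW.
have ch : @harmonic R k @[k --> \oo] --> within `[0, T']%classic (nbhs 0).
  move=> A [r /= r0 rA].
  have [N _ hN] := near_infty_natSinv_lt (PosNum r0).
  have [N' _ hN'] := near_infty_natSinv_lt (PosNum T'0).
  exists (maxn N N') => // k /=; rewrite geq_max => /andP[Nk N'k].
  apply: rA => /=; first by rewrite sub0r normrN ger0_norm//; exact: hN.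
  by rewrite in_itv /= invr_ge0 ler0n /= ltW//; exact: hN'.
have cvg_e := cvg_comp _ _ ch ce0.
apply: (cvg_unique _ cvg_e) => //.
have [N' _ hN'] := near_infty_natSinv_lt (PosNum T'0).
apply: cvg_near_cst; exists N' => // k N'k.
rewrite /e /= (burgers_coord uB) ?addNr//.
by apply: lt_trans T'T; rewrite lte_fin; exact: hN'.
Qed.

End burgers_closed.

Section integrals_of_test_functions.
Variables (R : realType) (n : nat).
Local Notation mu := (lebesgue_rV R n).

Lemma integrable_continuous (f : 'rV[R]_n -> R) r : continuous f ->
  vanishes_beyond r f -> mu.-integrable setT (EFin \o f).
Proof.
move=> cf fr; have [M fM] := continuous_bounded cf fr.
exact: (integrable_bounded_support (continuous_measurable_rV cf) fM fr).
Qed.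

Lemma Rintegral_sum_continuous k (f : 'I_k -> 'rV[R]_n -> R) r :
  (forall j, continuous (f j)) -> (forall j, vanishes_beyond r (f j)) ->
  \int[mu]_x \sum_j f j x = \sum_j \int[mu]_x f j x.
Proof.
elim: k f => [|k IH] f cf fr.
  rewrite big_ord0; under eq_Rintegral do rewrite big_ord0.
  by rewrite Rintegral_cst// mul0r.
under eq_Rintegral do rewrite big_ord_recl.
rewrite RintegralD//; last 2 first.
- exact: integrable_continuous (cf _) (fr _).
- apply: (@integrable_continuous (fun x => \sum_i f (lift ord0 i) x) r).
    by apply: continuous_sumf => j; exact: cf.
  by move=> x rx; rewrite big1// => j _; exact: fr.
by rewrite big_ord_recl IH.
Qed.

End integrals_of_test_functions.

Section transport.
Variables (R : realType) (n : nat) (T : \bar R).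
Local Notation mu := (lebesgue_rV R n).
Variables (u0 : 'rV[R]_n -> 'rV[R]_n) (u : R -> 'rV[R]_n -> 'rV[R]_n).
Variables (rho0 : 'rV[R]_n -> R) (rho : R -> 'rV[R]_n -> R)
  (ubar : R -> 'rV[R]_n -> 'rV[R]_n) (K M : R).
Hypothesis uB : burgers_solution T u0 u.
Hypothesis uC1 : forall t, 0 < t -> (t%:E < T)%E -> C1 (u t).
Hypotheses (mu0 : measurable_fun setT u0) (u0_le : forall x, `|u0 x| <= M).
Hypotheses (mrho0 : measurable_fun setT rho0) (rho0_le : forall x, `|rho0 x| <= K).
Hypotheses (rhoC1 : C1_spacetime T rho) (ubarC1 : C1_spacetime T ubar).
Hypothesis rho_pushforward : forall t (phi : 'rV[R]_n -> R) r,
  0 <= t -> (t%:E < T)%E -> continuous phi -> vanishes_beyond r phi ->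
  \int[mu]_x (rho t x * phi x) = \int[mu]_s (rho0 s * phi (s + t *: u0 s)).
Hypothesis ubar_eq : forall t x i, 0 <= t -> (t%:E < T)%E ->
  rho t x * ubar t x 0 i = rho t x * u t x 0 i.

Let ubarCi i : C1_spacetime T (fun t x => ubar t x 0 i).
Proof. exact: C1_spacetime_coord. Qed.

Let uCi i : C1_spacetime T (fun t x => u t x 0 i).
Proof. by have [uC _ _] := uB; exact: C1_spacetime_coord. Qed.

Let m t j x := rho t x * ubar t x 0 j.

Let derivable_rho t x (j : 'I_n) : 0 <= t -> (t%:E < T)%E ->
  derivable (rho t) x (delta_mx 0 j).
Proof.
by move=> t0 tT; have [_ d _ _] := rhoC1; have [_] := d (t, x) (conj t0 tT).
Qed.

Let derivable_ubar t x i (j : 'I_n) : 0 <= t -> (t%:E < T)%E ->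
  derivable (fun y => ubar t y 0 i) x (delta_mx 0 j).
Proof.
by move=> t0 tT; have [_ d _ _] := ubarCi i; have [_] := d (t, x) (conj t0 tT).
Qed.

Let derivable_u t x i (j : 'I_n) : 0 <= t -> (t%:E < T)%E ->
  derivable (fun y => u t y 0 i) x (delta_mx 0 j).
Proof.
by move=> t0 tT; have [_ d _ _] := uCi i; have [_] := d (t, x) (conj t0 tT).
Qed.

Let derivable_m t x i (j : 'I_n) : 0 <= t -> (t%:E < T)%E ->
  derivable (m t i) x (delta_mx 0 j).
Proof. by move=> t0 tT; apply: derivableM; [exact: derivable_rho|exact: derivable_ubar]. Qed.

Let dx_m t x i (j : 'I_n) : 0 <= t -> (t%:E < T)%E ->
  dx j (m t i) x = rho t x * dx j (fun y => ubar t y 0 i) x +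
    ubar t x 0 i * dx j (rho t) x.
Proof.
move=> t0 tT; rewrite /dx /m.
by rewrite (@deriveM _ _ (rho t) (fun y => ubar t y 0 i))//;
  [exact: derivable_rho|exact: derivable_ubar].
Qed.

Let continuous_rho t : 0 <= t -> (t%:E < T)%E -> continuous (rho t).
Proof. by have [c _ _ _] := rhoC1; exact: spacetime_slice. Qed.

Let continuous_ubar t i : 0 <= t -> (t%:E < T)%E ->
  continuous (fun x => ubar t x 0 i).
Proof.
have [c _ _ _] := ubarCi i.
exact: (@spacetime_slice _ _ T _ (fun t x => ubar t x 0 i)).
Qed.

Let continuous_u t i : 0 <= t -> (t%:E < T)%E -> continuous (fun x => u t x 0 i).
Proof.
have [c _ _ _] := uCi i.
exact: (@spacetime_slice _ _ T _ (fun t x => u t x 0 i)).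
Qed.

Let continuous_m t j : 0 <= t -> (t%:E < T)%E -> continuous (m t j).
Proof. by move=> t0 tT; apply: continuous_mulf; [exact: continuous_rho|exact: continuous_ubar]. Qed.

Let continuous_dx_m t i (j : 'I_n) : 0 <= t -> (t%:E < T)%E ->
  continuous (dx j (m t i)).
Proof.
move=> t0 tT; have [_ _ _ cr] := rhoC1; have [_ _ _ cu] := ubarCi i.
have -> : dx j (m t i) = (fun x => rho t x * dx j (fun y => ubar t y 0 i) x +
    ubar t x 0 i * dx j (rho t) x) by apply/funext => x; exact: dx_m.
apply: continuous_addf; apply: continuous_mulf.
- exact: continuous_rho.
- exact: (@spacetime_slice _ _ T _ (fun t => dx j (fun y => ubar t y 0 i))).
- exact: continuous_ubar.
- exact: (@spacetime_slice _ _ T _ (fun t => dx j (rho t))).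
Qed.

Let continuous_dt_rho t : 0 <= t -> (t%:E < T)%E ->
  continuous (fun x => dt (rho ^~ x) t).
Proof.
have [_ _ c _] := rhoC1.
exact: (@spacetime_slice _ _ T _ (fun t x => dt (rho ^~ x) t)).
Qed.

(** The integral of [rho t] against a test function is, on the initial
positions, an integral where only the argument of the test function moves with
time. Its time derivative is therefore the integral of the derivative of
[phi] in the direction [u0 s = u t (F t s)], weighted by [rho0]; pushed forward
again, this is the flux of [rho u = rho ubar] against the gradient of [phi], to
be integrated by parts. *)
Let continuity_weak t (phi : 'rV[R]_n -> R) r : 0 <= t -> (t%:E < T)%E ->
  continuous phi -> vanishes_beyond r phi -> (forall x, differentiable phi x) ->
  (forall j : 'I_n, continuous (dx j phi)) ->
  \int[mu]_x (phi x * (dt (rho ^~ x) t + \sum_j dx j (m t j) x)) = 0.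
Proof.
move=> t0 tT cphi phir dphi cdphi.
have [T' tT' T'T] := lt_EFin_between tT.
have Tt0 : 0 < T' - t by rewrite subr_gt0.
have [N _ hN] := near_infty_natSinv_lt (PosNum Tt0).
(* the shift by [N] keeps [t + h k] below [T'] *)
pose h k : R := harmonic (k + N).
have h0 k : 0 < h k by exact: harmonic_gt0.
have h1 k : h k <= 1 by rewrite /h /harmonic /= invf_le1// ler1n.
have hT' k : t + h k < T'.
  by rewrite addrC -ltrBrDr; apply: hN; rewrite /= leq_addl.
have hT k : ((t + h k)%:E < T)%E by apply: lt_trans T'T; rewrite lte_fin.
have th0 k : 0 <= t + h k by rewrite addr_ge0// ltW.
have dphir j : vanishes_beyond r (dx j phi) by exact: derive_vanishes.
have M0 : 0 <= M by apply: le_trans (normr_ge0 _) (u0_le 0).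
pose q k x := (h k)^-1 * (rho (t + h k) x - rho t x).
have [D dtD] : exists D : R, forall s x, 0 <= s <= T' -> `|x| <= r ->
    `|dt (rho ^~ x) s| <= D.
  have [_ _ c _] := rhoC1.
  exact: (@spacetime_bounded _ _ T (fun t x => dt (rho ^~ x) t)).
have [P phiP] := continuous_bounded cphi phir.
have P0 : 0 <= P by apply: le_trans (normr_ge0 _) (phiP 0).
have cq k : continuous (fun x => q k x * phi x).
  apply: continuous_mulf => //; apply: continuous_mulf.
    exact: cst_continuous.
  by apply: continuous_subf; [exact: continuous_rho (th0 k) (hT k)|exact: continuous_rho].
have qr k : vanishes_beyond r (fun x => q k x * phi x).
  by move=> x rx; rewrite phir ?mulr0.
have lim_rho : \int[mu]_x (q k x * phi x) @[k --> \oo] -->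
    \int[mu]_x (dt (rho ^~ x) t * phi x).
  apply: (@bounded_convergence_rV R n r _ _ (`|D| * P)) => //.
  - by move=> k; exact: continuous_measurable_rV.
  - move=> k x; have [rx|rx] := ltP r `|x|; first by rewrite qr// normr0 mulr_ge0.
    rewrite normrM ler_pM// /q.
    have ht : t < t + h k by rewrite ltrDl.
    have [c /andP[c1 c2] ->] := time_mean_value rhoC1 x t0 ht (hT k).
    rewrite [t + _]addrC addrK mulrC mulfK ?gt_eqF//.
    apply: le_trans (dtD c x _ rx) (ler_norm D).
    by rewrite (le_trans t0 (ltW c1)) /= ltW// (lt_trans c2).
  - move=> x; apply: cvgM; last exact: cvg_cst.
    have [_ d _ _] := rhoC1; have [/= cd _] := d (t, x) (conj t0 tT).
    have := cvg_comp _ _ (@cvg_harmonic_within R t t0) cd.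
    by move=> /(cvg_comp _ _ (cvg_addnr N)).
pose F s x := x + s *: u0 x.
have mphi := continuous_measurable_rV cphi.
have mF s : measurable_fun setT (F s).
  apply: measurable_fun_coordP => i; under eq_fun do rewrite !mxE.
  apply: measurable_funD; first exact: measurable_coord.
  apply: measurable_funM => //.
  exact: (measurableT_comp (measurable_coord i) mu0).
have Fr (psi : 'rV[R]_n -> R) s : 0 <= s <= T' -> vanishes_beyond r psi ->
    vanishes_beyond (r + T' * M) (psi \o F s).
  move=> /andP[s0 sT'] psir x rx; apply: psir.
  have : `|x| <= `|F s x| + `|s *: u0 x|.
    by rewrite -{1}(addrK (s *: u0 x) x) ler_normB.
  rewrite normrZ ger0_norm//.
  have : s * `|u0 x| <= T' * M by rewrite ler_pM.
  lra.
have tT'0 : 0 <= t <= T' by rewrite t0 ltW.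
have thT'0 k : 0 <= t + h k <= T' by rewrite th0 ltW.
have integ s (psi : 'rV[R]_n -> R) : 0 <= s <= T' -> continuous psi ->
    vanishes_beyond r psi ->
    mu.-integrable setT (EFin \o (fun x => rho0 x * psi (F s x))).
  move=> sT' cpsi psir; have [B psiB] := continuous_bounded cpsi psir.
  apply: (@integrable_bounded_support R n (r + T' * M) _ (K * B)).
  - apply: measurable_funM => //.
    exact: (measurableT_comp (continuous_measurable_rV cpsi) (mF s)).
  - by move=> x; rewrite normrM ler_pM.
  - by move=> x rx; rewrite [psi _](Fr psi s sT' psir) ?mulr0.
pose q' k s := rho0 s * ((h k)^-1 * (phi (F (t + h k) s) - phi (F t s))).
have qq' k : \int[mu]_x (q k x * phi x) = \int[mu]_s q' k s.
  transitivity ((h k)^-1 * (\int[mu]_x (rho (t + h k) x * phi x) -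
      \int[mu]_x (rho t x * phi x))).
    have i1 : mu.-integrable setT (EFin \o (fun x => rho (t + h k) x * phi x)).
      apply: (@integrable_continuous _ _ _ r).
        by apply: continuous_mulf => //; exact: continuous_rho (th0 k) (hT k).
      by move=> x rx; rewrite phir ?mulr0.
    have i2 : mu.-integrable setT (EFin \o (fun x => rho t x * phi x)).
      apply: (@integrable_continuous _ _ _ r).
        by apply: continuous_mulf => //; exact: continuous_rho.
      by move=> x rx; rewrite phir ?mulr0.
    rewrite -RintegralB// -RintegralZl//.
      by apply: eq_Rintegral => x _; rewrite /q; ring.
    exact: (integrableB measurableT i1 i2).
  rewrite (rho_pushforward (th0 k) (hT k) cphi phir).
  rewrite (rho_pushforward t0 tT cphi phir).
  have i1 := integ _ _ (thT'0 k) cphi phir.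
  have i2 := integ _ _ tT'0 cphi phir.
  rewrite -RintegralB// -RintegralZl//.
    by apply: eq_Rintegral => x _; rewrite /q'; ring.
  exact: (integrableB measurableT i1 i2).
have [G dphiG] : exists G : R, forall x (j : 'I_n), `|dx j phi x| <= G.
  have /choice[g gG] : forall j : 'I_n, exists g : R, forall x, `|dx j phi x| <= g.
    by move=> j; exact: continuous_bounded (cdphi j) (dphir j).
  exists (\sum_j `|g j|) => x j; apply: le_trans (gG j x) _.
  apply: (le_trans (ler_norm _)); rewrite (bigD1 j)//= lerDl.
  exact: sumr_ge0.
have dphi_le x v : `|v| <= M -> `|'D_v phi x| <= \sum_(j < n) (M * G).
  move=> vM; rewrite derive_delta//; apply: le_trans (ler_norm_sum _ _ _) _.
  apply: ler_sum => j _; rewrite normrM; apply: ler_pM => //.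
    exact: le_trans (rV_norm_ge v j) vM.
  exact: dphiG.
pose psi x := \sum_j u t x 0 j * dx j phi x.
have cpsi : continuous psi.
  by apply: continuous_sumf => j; apply: continuous_mulf => //; exact: continuous_u.
have psir : vanishes_beyond r psi.
  by move=> x rx; rewrite /psi big1// => j _; rewrite dphir ?mulr0.
have lim_init : \int[mu]_s q' k s @[k --> \oo] -->
    \int[mu]_s (rho0 s * psi (F t s)).
  apply: (@bounded_convergence_rV R n (r + T' * M) _ _ (K * \sum_(j < n) (M * G))).
  - move=> k; apply: measurable_funM => //; apply: measurable_funM => //.
    by apply: measurable_funB; exact: (measurableT_comp mphi (mF _)).
  - move=> k s; rewrite normrM ler_pM// normrM gtr0_norm ?invr_gt0//.
    rewrite ler_pdivrMl// mulrC.
    have -> : F (t + h k) s = F t s + h k *: u0 s by rewrite /F scalerDl addrA.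
    apply: mean_value_line; first exact: ltW.
      by move=> ? _; exact: diff_derivable.
    by move=> ? _; exact: dphi_le.
  - move=> k s rs; rewrite /q'.
    rewrite [phi (F (t + h k) s)](Fr phi _ (thT'0 k) phir)//.
    by rewrite [phi (F t s)](Fr phi _ tT'0 phir)// subrr !mulr0.
  - move=> s; apply: cvgM; first exact: cvg_cst.
    have -> : psi (F t s) = 'D_(u0 s) phi (F t s).
      rewrite derive_delta//; apply: eq_bigr => j _; congr (_ * _).
      by rewrite /F (burgers_characteristic uB uC1).
    have := @cvg_diff_quotient R n phi (F t s) (u0 s)
      (diff_derivable (dphi (F t s))).
    move=> /(cvg_comp _ _ (cvg_addnr N)); apply: cvg_trans.
    apply: near_eq_cvg; apply: nearW => k /=.
    by rewrite -/(h k) /F scalerDl addrA.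
have E : \int[mu]_x (dt (rho ^~ x) t * phi x) = \int[mu]_x (rho t x * psi x).
  rewrite (rho_pushforward t0 tT cpsi psir).
  apply: (cvg_unique _ lim_rho) => //.
  by rewrite /= (_ : (fun k => _) = (fun k => \int[mu]_s q' k s))//; apply/funext.
have cpm j : continuous (fun x => phi x * m t j x).
  by apply: continuous_mulf => //; exact: continuous_m.
have pmr j : vanishes_beyond r (fun x => phi x * m t j x).
  by move=> x rx; rewrite phir ?mul0r.
have dpm j x : 'D_(delta_mx 0 j) (fun x => phi x * m t j x) x =
    phi x * dx j (m t j) x + m t j x * dx j phi x.
  rewrite (@deriveM _ _ phi (m t j))//; first exact: diff_derivable.
  exact: derivable_m.
have cdpm j : continuous (fun x => phi x * dx j (m t j) x + m t j x * dx j phi x).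
  by apply: continuous_addf; apply: continuous_mulf => //;
    [exact: continuous_dx_m|exact: continuous_m].
have parts j : \int[mu]_x (phi x * dx j (m t j) x + m t j x * dx j phi x) = 0.
  have d : (fun x => 'D_(delta_mx 0 j) (fun x => phi x * m t j x) x) =
      (fun x => phi x * dx j (m t j) x + m t j x * dx j phi x).
    by apply/funext => x; exact: dpm.
  have := @integral_derive_eq0 R n (fun x => phi x * m t j x) r (delta_mx 0 j)
    (cpm j) (pmr j).
  under eq_Rintegral do rewrite dpm; apply; last by rewrite d.
  by move=> x; apply: derivableM; [exact: diff_derivable|exact: derivable_m].
have partsr j : vanishes_beyond r
    (fun x => phi x * dx j (m t j) x + m t j x * dx j phi x).
  by move=> x rx; rewrite phir// dphir// mul0r mulr0 addr0.
transitivity (\int[mu]_x (dt (rho ^~ x) t * phi x - rho t x * psi x) +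
    \int[mu]_x \sum_j (phi x * dx j (m t j) x + m t j x * dx j phi x)).
  rewrite -RintegralD//.
  - apply: eq_Rintegral => x _; rewrite big_split /= -mulr_sumr mulrDr.
    have -> : \sum_j m t j x * dx j phi x = rho t x * psi x.
      rewrite /psi mulr_sumr; apply: eq_bigr => j _.
      by rewrite /m ubar_eq// mulrA.
    ring.
  - apply: (@integrable_continuous _ _ _ r).
      apply: continuous_subf; apply: continuous_mulf => //.
        exact: continuous_dt_rho.
      exact: continuous_rho.
    by move=> x rx; rewrite phir// psir// !mulr0 subrr.
  - apply: (@integrable_continuous _ _ _ r); first exact: continuous_sumf.
    by move=> x rx; rewrite big1// => j _; exact: partsr.
rewrite (Rintegral_sum_continuous cdpm partsr) big1 ?addr0//.
rewrite RintegralB// ?E ?subrr//.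
- apply: (@integrable_continuous _ _ _ r).
    by apply: continuous_mulf => //; exact: continuous_dt_rho.
  by move=> x rx; rewrite phir ?mulr0.
- apply: (@integrable_continuous _ _ _ r).
    by apply: continuous_mulf => //; exact: continuous_rho.
  by move=> x rx; rewrite psir ?mulr0.
Qed.

Lemma continuity_equation t x : 0 <= t -> (t%:E < T)%E ->
  dt (rho ^~ x) t + \sum_j dx j (m t j) x = 0.
Proof.
move=> t0 tT.
pose D x := dt (rho ^~ x) t + \sum_j dx j (m t j) x.
apply: (@bump_orthogonal_eq0 R n D).
  apply: continuous_addf; first exact: continuous_dt_rho.
  by apply: continuous_sumf => j; exact: continuous_dx_m.
move=> r r0; apply: (@continuity_weak t _ (`|x| + r)) => //.
- exact: continuous_bump.
- by apply: bump_vanishes; exact: ltW.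
- exact: differentiable_bump.
- by move=> j; exact: continuous_derive_bump.
Qed.

(** As [rho * ubar] and [rho * u] coincide, the momentum is [rho * u_i], and the
momentum equation is [u_i] times the continuity equation plus [rho] times the
Burgers equation. *)
Lemma transport_pressureless_gas : pressureless_gas T rho ubar.
Proof.
move=> t x [/= t0 tT]; have cont y := continuity_equation y t0 tT.
have divE (g : 'rV[R]_n -> 'rV[R]_n) : (forall y j, g y 0 j = m t j y) ->
    divx g x = \sum_j dx j (m t j) x.
  move=> gm; apply: eq_bigr => j _; congr (dx j _ x).
  by apply/funext => y; exact: gm.
split; first by rewrite divE// => y j; rewrite mxE.
move=> i; have [_ dr _ _] := rhoC1; have [_ dui _ _] := uCi i.
have [/= cr _] := dr (t, x) (conj t0 tT).
have [/= cu _] := dui (t, x) (conj t0 tT).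
have PF := time_quotient_proper t0.
have -> : dt (fun s => rho s x * ubar s x 0 i) t =
    rho t x * dt (fun s => u s x 0 i) t + u t x 0 i * dt (rho ^~ x) t.
  rewrite (@eq_dt R T _ (fun s => rho s x * u s x 0 i))//; last first.
    by move=> s s0 sT; exact: ubar_eq.
  by apply: cvg_lim => //; exact: (dt_mul t0 cr cu).
have -> : divx (fun y => (rho t y * ubar t y 0 i) *: ubar t y) x =
    \sum_j (m t j x * dx j (fun y => u t y 0 i) x + u t x 0 i * dx j (m t j) x).
  apply: eq_bigr => j _.
  have -> : (fun y => ((rho t y * ubar t y 0 i) *: ubar t y) 0 j) =
      (fun y => m t j y * u t y 0 i).
    apply/funext => y; rewrite mxE ubar_eq// /m ubar_eq//.
    rewrite -[in LHS]mulrA [_ * ubar t y 0 j]mulrC mulrA.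
    by rewrite ubar_eq.
  have dm : derivable (m t j) x (delta_mx 0 j) by exact: derivable_m.
  have du : derivable (fun y => u t y 0 i) x (delta_mx 0 j) by exact: derivable_u.
  exact: (deriveM dm du).
rewrite big_split /= -mulr_sumr addrACA -mulrDr [dt _ _ + _]cont mulr0 addr0.
have -> : \sum_j m t j x * dx j (fun y => u t y 0 i) x =
    rho t x * \sum_j u t x 0 j * dx j (fun y => u t y 0 i) x.
  by rewrite mulr_sumr; apply: eq_bigr => j _; rewrite /m ubar_eq// mulrA.
by rewrite -mulrDr (burgers_coord_closed uB)// mulr0.
Qed.

End transport.

(** * Noise in the position only *)

Section degenerate_noise.
Variables (R : realType) (n : nat).
Context d (T : measurableType d) (Pr : probability T R).
Variables (W1 W2 : R -> {RV Pr >-> 'rV[R]_n}).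

Lemma sde_solution_no_velocity_noise (e : R) (s v : 'rV[R]_n)
    (X U : R -> {RV Pr >-> 'rV[R]_n}) :
  sde_solution W1 W2 (e, 0) s v X U ->
  {ae Pr, forall w, forall t, 0 <= t ->
    X t w = s + t *: v + e *: W1 t w /\ U t w = v}.
Proof.
apply: filterS => w XU t t0; have /= [-> ->] := XU _ t0.
rewrite scale0r addr0; split => //; congr (_ + _ + _).
apply/rowP => k; rewrite !mxE.
under eq_Rintegral => r.
  rewrite inE /= in_itv /= => /andP[r0 _].
  have /= [_ ->] := XU _ r0; rewrite scale0r addr0; over.
rewrite Rintegral_cst//= lebesgue_measure_itv/= lte_fin.
case: ltgtP t0 => // [t0 _|<- _]; last by rewrite mulr0 mul0r.
by rewrite -EFinB subr0 mulrC.
Qed.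

Lemma probability_ae_eq (A B : set T) : measurable A -> measurable B ->
  {ae Pr, forall w, A w <-> B w} -> Pr A = Pr B.
Proof.
move=> mA mB AB.
have E C : measurable C -> Pr C = (\int[Pr]_w (\1_C w)%:E)%E.
  by move=> mC; rewrite integral_indic// setIT.
rewrite (E A)// (E B)//.
apply: ge0_ae_eq_integral => //.
- exact/measurable_EFinP.
- exact/measurable_EFinP.
apply: filterS AB => w AB _; rewrite !indicE; congr (_%:R%:E).
by congr nat_of_bool; apply/idP/idP; rewrite !inE => /AB.
Qed.

(** Almost surely the velocity keeps its initial value, so that the condition on
it no longer depends on the realisation, and the position is the end of a
straight segment displaced by the noise. *)
Lemma joint_distribution_no_velocity_noise (e t : R) (rho0 : 'rV[R]_n -> R)
    (u0 : 'rV[R]_n -> 'rV[R]_n) (X U : 'rV[R]_n -> 'rV[R]_n -> R -> {RV Pr >-> 'rV[R]_n})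
    (A B : set 'rV[R]_n) : 0 <= t ->
  (forall s v, sde_solution W1 W2 (e, 0) s v (X s v) (U s v)) ->
  measurable A -> measurable B ->
  joint_distribution rho0 u0 X U t (A `*` B) =
  (\int[lebesgue_rV R n]_s ((rho0 s)%:E *
     Pr [set w | A (s + t *: u0 s + e *: W1 t w)%R /\ B (u0 s)]))%E.
Proof.
move=> t0 XU mA mB; apply: eq_integral => s _; congr (_ * _)%E.
have mW : measurable_fun setT (fun w => s + t *: u0 s + e *: W1 t w).
  apply: measurable_fun_coordP => i; under eq_fun do rewrite !mxE.
  apply: measurable_funD => //; apply: measurable_funM => //.
  exact: (measurableT_comp (measurable_coord i)).
apply: probability_ae_eq.
- rewrite (_ : [set w | _] = X s (u0 s) t @^-1` A `&` U s (u0 s) t @^-1` B)//.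
  by apply: measurableI; exact: measurable_funPTI.
- have [vB|vB] := pselect (B (u0 s)).
    rewrite (_ : [set w | _] = (fun w => s + t *: u0 s + e *: W1 t w) @^-1` A).
      by rewrite -[X in measurable X]setTI; exact: mW.
    by apply/seteqP; split=> w //= [].
  rewrite (_ : [set w | _] = set0)//.
  by apply/seteqP; split=> w //= [].
apply: filterS (sde_solution_no_velocity_noise (XU s (u0 s))) => w /(_ _ t0) [Xw Uw].
by rewrite /= Xw Uw.
Qed.

Lemma cvg_degenerate_noise :
  (fun k => (@harmonic R k, 0 : R)) @ \oo --> within (@noise R) (nbhs (0 : R * R)).
Proof.
move=> A NA.
have c := @cvg_pair nat R R \oo (nbhs (0 : R)) (nbhs (0 : R)) _ _ _
  (@harmonic R) (fun=> 0) cvg_harmonic (cvg_cst _).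
have cA : \forall k \near \oo, @noise R (@harmonic R k, 0) -> A (@harmonic R k, 0).
  exact: (c _ _ _ _ [set p | @noise R p -> A p] NA).
apply: filterS cA => k; apply.
by split => //=; rewrite xpair_eqE /= invr_eq0 pnatr_eq0.
Qed.

End degenerate_noise.

(** * The limit velocity *)

Section clipping.
Variable R : realType.

(** The weak continuity of the densities concerns bounded functions of the
velocity, and the velocity itself is not bounded. *)
Definition clip (M z : R) : R := Num.max (- M) (Num.min z M).

Lemma clip_id M z : `|z| <= M -> clip M z = z.
Proof. by rewrite ler_norml /clip => /andP[Mz zM]; rewrite min_l// max_r. Qed.

Lemma clip_norm_le M z : 0 <= M -> `|clip M z| <= M.
Proof.
move=> M0; rewrite ler_norml /clip le_max lexx/= ge_max ge_min lexx orbT andbT.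
lra.
Qed.

End clipping.

Section limit_velocity.
Context d (Tm : measurableType d) (R : realType) (n : nat)
  (Pr : probability Tm R).
Local Notation mu := (lebesgue_rV R n).
Variables (F v w : 'rV[R]_n -> 'rV[R]_n) (W : Tm -> 'rV[R]_n)
  (rho0 : 'rV[R]_n -> R) (P : nat -> R.-ftker 'rV[R]_n ~> 'rV[R]_n)
  (K M M' : R).
Hypotheses (mF : measurable_fun setT F) (mv : measurable_fun setT v)
  (mW : measurable_fun setT W) (mrho0 : measurable_fun setT rho0)
  (rho0_ge0 : forall s, 0 <= rho0 s) (rho0_le : forall s, rho0 s <= K)
  (v_le : forall s, `|v s| <= M) (F_near : forall s, `|F s - s| <= M')
  (F_expanding : forall r, exists2 L : R, 0 <= L &
     forall x y, `|F x| <= r -> `|F y| <= r -> `|x - y| <= L * `|F x - F y|).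
Hypotheses
  (P_density : forall k A B, measurable A -> measurable B ->
    (\int[mu]_(x in A) P k x B = \int[mu]_s ((rho0 s)%:E *
       Pr [set w | A (F s + harmonic k *: W w)%R /\ B (v s)]))%E)
  (cP : forall k (phi : 'rV[R]_n -> R), continuous phi -> bounded_fun phi ->
    continuous (fun x => \int[P k x]_u phi u)).
Variables (rho : 'rV[R]_n -> R) (ubar : 'rV[R]_n -> 'rV[R]_n) (C : R).
Hypotheses
  (rho_lim : forall x, (\int[P k x]_u (1 : R)) @[k --> \oo] --> rho x)
  (ubar_lim : forall x i, ((\int[P k x]_u (1 : R))^-1 * \int[P k x]_u (u 0 i))
     @[k --> \oo] --> ubar x 0 i)
  (rho_le : forall x, `|rho x| <= C) (ubar_le : forall x, `|ubar x| <= C)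
  (crho : continuous rho) (cubar : forall i, continuous (fun x => ubar x 0 i))
  (cw : forall i, continuous (fun x => w x 0 i)) (wF : forall s, w (F s) = v s).

Let Poo k x : (P k x setT < +oo)%E.
Proof. by rewrite ltey_eq (@kernel_finite_transition _ _ _ _ _ (P k)). Qed.

Let mP k B : measurable B -> measurable_fun setT (fun x => P k x B).
Proof. exact: measurable_kernel. Qed.

Let M_ge0 : 0 <= M. Proof. exact: le_trans (normr_ge0 _) (v_le 0). Qed.
Let M'_ge0 : 0 <= M'. Proof. exact: le_trans (normr_ge0 _) (F_near 0). Qed.
Let C_ge0 : 0 <= C. Proof. exact: le_trans (normr_ge0 _) (rho_le 0). Qed.

Let bounded_funP (g : 'rV[R]_n -> R) (G : R) : (forall u, `|g u| <= G) ->
  bounded_fun g.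
Proof.
move=> gG; exists G; split; first by rewrite num_real.
by move=> y Gy u _ /=; apply: le_trans (gG u) _; exact: ltW.
Qed.

Let ge0_pushforward (phi : 'rV[R]_n -> R) r :
  continuous phi -> (forall x, 0 <= phi x) -> vanishes_beyond r phi ->
  \int[mu]_x (rho x * phi x) = \int[mu]_s (rho0 s * phi (F s)).
Proof.
move=> cphi phi0 phir.
rewrite (@vague_limit _ Tm R n Pr F v W rho0 P K M' mF mv mW mrho0 rho0_ge0
  rho0_le F_near F_expanding mP Poo P_density (fun=> 1) 1 rho C _ _ _ _ _ _ phi r)//.
- by apply: eq_Rintegral => s _; rewrite mulr1.
- move=> k; apply: cP; first exact: cst_continuous.
  by apply: (@bounded_funP _ 1) => u; rewrite normr1.
- by move=> x; apply: le_trans (ler_norm _) (rho_le _).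
Qed.

Let mF_comp (phi : 'rV[R]_n -> R) : continuous phi ->
  measurable_fun setT (fun s => phi (F s)).
Proof. by move=> /continuous_measurable_rV mphi; exact: measurableT_comp mphi mF. Qed.

Let F_vanishes (phi : 'rV[R]_n -> R) r : vanishes_beyond r phi ->
  vanishes_beyond (r + M') (fun s => rho0 s * phi (F s)).
Proof.
move=> phir s rs; rewrite phir ?mulr0//.
have : `|s| <= `|F s| + `|F s - s|.
  by rewrite {1}(_ : s = F s - (F s - s)) ?ler_normB// subKr.
have := F_near s; lra.
Qed.

Let integrable_F (phi : 'rV[R]_n -> R) r : continuous phi ->
  vanishes_beyond r phi ->
  mu.-integrable setT (EFin \o (fun s => rho0 s * phi (F s))).
Proof.
move=> cphi phir; have [B phiB] := continuous_bounded cphi phir.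
apply: (@integrable_bounded_support _ _ (r + M') _ (K * B)).
- by apply: measurable_funM => //; exact: mF_comp.
- by move=> s; rewrite normrM ler_pM// ger0_norm.
- exact: F_vanishes.
Qed.

Lemma density_pushforward (phi : 'rV[R]_n -> R) r :
  continuous phi -> vanishes_beyond r phi ->
  \int[mu]_x (rho x * phi x) = \int[mu]_s (rho0 s * phi (F s)).
Proof.
move=> cphi phir.
pose p x := Num.max (phi x) 0; pose q x := Num.max (- phi x) 0.
have c0 : continuous ((fun=> 0) : 'rV[R]_n -> R) by exact: cst_continuous.
have cp : continuous p by exact: continuous_maxf.
have cq : continuous q by apply: continuous_maxf => //; exact: continuous_oppf.
have pr : vanishes_beyond r p by move=> x rx; rewrite /p phir// maxxx.
have qr : vanishes_beyond r q by move=> x rx; rewrite /q phir// oppr0 maxxx.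
have phiE x : phi x = p x - q x.
  by rewrite /p /q; case: (leP (phi x) 0); case: (leP (- phi x) 0); lra.
have irho psi : continuous psi -> vanishes_beyond r psi ->
    mu.-integrable setT (EFin \o (fun x => rho x * psi x)).
  move=> cpsi psir; apply: (@integrable_continuous _ _ _ r).
    exact: continuous_mulf.
  by move=> x rx; rewrite psir ?mulr0.
under eq_Rintegral do rewrite phiE mulrBr.
under [in RHS]eq_Rintegral do rewrite phiE mulrBr.
rewrite !RintegralB//; try exact: irho.
- by congr (_ - _); apply: (@ge0_pushforward _ r) => // x;
    rewrite /p /q le_max lexx orbT.
- exact: (@integrable_F p r cp pr).
- exact: (@integrable_F q r cq qr).
Qed.

Let excess (i : 'I_n) (u : 'rV[R]_n) : R := Num.min 1 (Num.max (`|u 0 i| - M) 0).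

Let excess_ge0 i u : 0 <= excess i u.
Proof. by rewrite /excess le_min ler01 le_max lexx orbT. Qed.

Let excess_le1 i u : excess i u <= 1.
Proof. by rewrite /excess ge_min lexx. Qed.

Let ccoord (i : 'I_n) : continuous (fun u : 'rV[R]_n => u 0 i).
Proof. exact: coord_continuous. Qed.

Let cexcess i : continuous (excess i).
Proof.
apply: continuous_minf; first exact: cst_continuous.
apply: continuous_maxf; last exact: cst_continuous.
apply: continuous_subf; last exact: cst_continuous.
by move=> u; apply: continuous_comp; [exact: ccoord|exact: norm_continuous].
Qed.

Let mZ k : measurable_fun setT (fun w => harmonic k *: W w).
Proof.
apply: measurable_fun_coordP => i; under eq_fun do rewrite mxE.
by apply: measurable_funM => //; exact: (measurableT_comp (measurable_coord i) mW).
Qed.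

Let bounded_lty k x (g : 'rV[R]_n -> R) (G : R) : measurable_fun setT g ->
  (forall u, `|g u| <= G) -> (P k x).-integrable setT (EFin \o g).
Proof. by move=> mg gG; apply: (bounded_integrable (M := G)) => //; exact: Poo. Qed.

(** The velocities that occur in [density_identity] are initial ones, of norm at
most [M], where the excess is zero. The integral of the excess thus vanishes
against every bump in [x], and the weak continuity in [x] makes it zero at every
position. *)
Let excess_eq0 k x i : \int[P k x]_u excess i u = 0.
Proof.
apply: (@bump_orthogonal_eq0 R n (fun x => \int[P k x]_u excess i u)).
  apply: cP => //; apply: (@bounded_funP _ 1) => u.
  by rewrite ger0_norm.
move=> r r0; under eq_Rintegral do rewrite mulrC.
rewrite /Rintegral (@density_identity _ Tm R n Pr F v (fun w => harmonic k *: W w)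
  rho0 (P k))//.
- rewrite integral0_eq// => w' _; rewrite integral0_eq// => s _.
  rewrite /excess max_r; last by rewrite subr_le0 (le_trans _ (v_le s))// rV_norm_ge.
  by rewrite min_r// mulr0 mul0r.
- exact: mP.
- exact: P_density.
- by apply: continuous_measurable_rV; exact: cexcess.
- by apply: continuous_measurable_rV; exact: continuous_bump.
- by move=> y; exact: bump_ge0.
move=> y.
have mex : measurable_fun setT (excess i).
  by apply: continuous_measurable_rV; exact: cexcess.
have ex1 u : `|excess i u| <= 1 by rewrite ger0_norm.
have := integrable_fin_num measurableT (@bounded_lty k y _ _ mex ex1).
by rewrite fin_numElt => /andP[].
Qed.

Let mcoord (i : 'I_n) : measurable_fun setT (fun u : 'rV[R]_n => u 0 i).
Proof. exact: measurable_coord. Qed.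

Let cclip (i : 'I_n) : continuous (fun u : 'rV[R]_n => clip M (u 0 i)).
Proof.
apply: continuous_maxf; first exact: cst_continuous.
by apply: continuous_minf; [exact: ccoord|exact: cst_continuous].
Qed.

Let mclip (i : 'I_n) : measurable_fun setT (fun u : 'rV[R]_n => clip M (u 0 i)).
Proof. exact: continuous_measurable_rV. Qed.

(** Almost every velocity for [P k x] is bounded by [M] in each coordinate, by
[excess_eq0]. *)
Let clip_momentum k x i : \int[P k x]_u (u 0 i) = \int[P k x]_u clip M (u 0 i).
Proof.
rewrite /Rintegral; congr fine; apply: ae_eq_integral => //.
- exact/measurable_EFinP.
- exact/measurable_EFinP.
have mex : measurable_fun setT (EFin \o excess i).
  by apply/measurable_EFinP; apply: continuous_measurable_rV; exact: cexcess.
have /ae_eq_integral_abs : (\int[P k x]_u `|(EFin \o excess i) u| = 0)%E.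
  transitivity (\int[P k x]_u (excess i u)%:E)%E.
    by apply: eq_integral => u _; rewrite /= ger0_norm.
  rewrite -[LHS]fineK; first by have := excess_eq0 k x i; rewrite /Rintegral => ->.
  apply: integrable_fin_num => //; apply: (@bounded_lty _ _ _ 1).
    exact: continuous_measurable_rV.
  by move=> u; rewrite ger0_norm.
move=> /(_ measurableT mex); apply: filterS => u /(_ I) /= [ex0] _.
rewrite clip_id//; rewrite leNgt; apply/negP => Mu.
move: ex0; apply/eqP; rewrite gt_eqF// /excess lt_min ltr01 lt_max subr_gt0.
by rewrite Mu.
Qed.

(** When the density vanishes its inverse is zero by convention, and the
momentum vanishes too. *)
Let momentumE k x i : \int[P k x]_u (clip M (u 0 i)) =
  \int[P k x]_u 1 * ((\int[P k x]_u (1 : R))^-1 * \int[P k x]_u (u 0 i)).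
Proof.
rewrite -clip_momentum.
have [P0|/divff E] := eqVneq (\int[P k x]_u (1 : R)) 0; last by rewrite mulrA E mul1r.
rewrite P0 mul0r clip_momentum /Rintegral null_set_integral//.
  exact/measurable_EFinP.
move: P0; rewrite Rintegral_cst// mul1r => P0.
rewrite -[LHS]fineK ?P0//.
by have := Poo k x; rewrite ge0_fin_numE.
Qed.

Let clipped_flux k x i : \int[P k x]_u (clip M (u 0 i) + M) =
  \int[P k x]_u 1 * ((\int[P k x]_u (1 : R))^-1 * \int[P k x]_u (u 0 i)) +
  M * \int[P k x]_u 1.
Proof.
rewrite RintegralD//.
- by rewrite momentumE !Rintegral_cst// mul1r.
- by apply: (@bounded_lty _ _ _ M) => // u; exact: clip_norm_le.
- by apply: (@bounded_lty _ _ _ `|M|).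
Qed.

(* the shift by [M] provides the sign that [vague_limit] asks for *)
Let clip_ge0 z : 0 <= clip M z + M.
Proof. by have := clip_norm_le z M_ge0; rewrite ler_norml; lra. Qed.

Let clip_le2 z : clip M z + M <= 2 * M.
Proof. by have := clip_norm_le z M_ge0; rewrite ler_norml; lra. Qed.

Let momentum_pushforward (phi : 'rV[R]_n -> R) r i :
  continuous phi -> (forall x, 0 <= phi x) -> vanishes_beyond r phi ->
  \int[mu]_x ((rho x * ubar x 0 i + M * rho x) * phi x) =
  \int[mu]_s (rho0 s * (v s 0 i + M) * phi (F s)).
Proof.
move=> cphi phi0 phir.
have cg : continuous (fun u : 'rV[R]_n => clip M (u 0 i) + M).
  by apply: continuous_addf => //; exact: cst_continuous.
rewrite (@vague_limit _ Tm R n Pr F v W rho0 P K M' mF mv mW mrho0 rho0_ge0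
  rho0_le F_near F_expanding mP Poo P_density (fun u => clip M (u 0 i) + M) (2 * M)
  (fun x => rho x * ubar x 0 i + M * rho x) (C * C + M * C) _ _ _ _ _ _ phi r)//.
- apply: eq_Rintegral => s _; rewrite clip_id//.
  by apply: le_trans (v_le s); exact: rV_norm_ge.
- exact: continuous_measurable_rV.
- move=> k; apply: cP => //; apply: (@bounded_funP _ (2 * M)) => u.
  by rewrite ger0_norm.
- move=> x; under eq_cvg do rewrite clipped_flux.
  apply: cvgD; first exact: cvgM.
  by apply: cvgM => //; exact: cvg_cst.
- move=> x; apply: lerD.
    apply: (le_trans (ler_norm _)); rewrite normrM ler_pM//.
    exact: le_trans (rV_norm_ge _ i) (ubar_le x).
  by rewrite ler_wpM2l// (le_trans (ler_norm _)).
Qed.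

(** Tested against a bump, [rho * ubar_i + M * rho] and [rho * (w_i + M)] give the
same integral over the initial positions: the former by [vague_limit] with the
shifted momentum, the latter by [density_pushforward] because [w] takes the
value [v s] at [F s]. *)
Lemma limit_velocity x i : rho x * ubar x 0 i = rho x * w x 0 i.
Proof.
apply/eqP; rewrite -subr_eq0; apply/eqP.
apply: (@bump_orthogonal_eq0 R n (fun x => rho x * ubar x 0 i - rho x * w x 0 i)).
  by apply: continuous_subf; exact: continuous_mulf.
move=> r r0.
have cb := @continuous_bump R n x r.
have b0 := @bump_ge0 R n x r.
have br : vanishes_beyond (`|x| + r) (rV_bump x r) by apply: bump_vanishes; exact: ltW.
have cwM : continuous (fun y => rV_bump x r y * (w y 0 i + M)).
  apply: continuous_mulf => //; apply: continuous_addf => //.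
  exact: cst_continuous.
have bwM : vanishes_beyond (`|x| + r) (fun y => rV_bump x r y * (w y 0 i + M)).
  by move=> y ry; rewrite br// mul0r.
have i1 : mu.-integrable setT
    (EFin \o (fun y => (rho y * ubar y 0 i + M * rho y) * rV_bump x r y)).
  apply: (@integrable_continuous _ _ _ (`|x| + r)).
    apply: continuous_mulf => //; apply: continuous_addf; apply: continuous_mulf => //.
    exact: cst_continuous.
  by move=> y ry; rewrite br// mulr0.
have i2 : mu.-integrable setT
    (EFin \o (fun y => rho y * (rV_bump x r y * (w y 0 i + M)))).
  apply: (@integrable_continuous _ _ _ (`|x| + r)).
    exact: continuous_mulf.
  by move=> y ry; rewrite bwM// mulr0.
transitivity (\int[mu]_y ((rho y * ubar y 0 i + M * rho y) * rV_bump x r y -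
   rho y * (rV_bump x r y * (w y 0 i + M)))).
  by apply: eq_Rintegral => y _; ring.
rewrite RintegralB// (momentum_pushforward i cb b0 br).
rewrite (density_pushforward cwM bwM); apply/eqP; rewrite subr_eq0; apply/eqP.
by apply: eq_Rintegral => s _; rewrite wF; ring.
Qed.

End limit_velocity.

(** * The pressureless gas dynamics limit *)

Lemma bounded_setP (T : Type) (R : realType) (V : normedModType R) (A : set T)
    (f : T -> V) : [bounded f x | x in A] ->
  exists M : R, forall x, A x -> `|f x| <= M.
Proof.
move=> [M [_ fM]]; exists (M + 1) => x Ax; apply: fM => //.
by rewrite ltrDl.
Qed.

Theorem theorem2p4 (R : realType) (n : nat) (n_gt0 : (0 < n)%N)
  (d : measure_display) (T : measurableType d) (Pr : probability T R)
  (W1 W2 : R -> {RV Pr >-> 'rV[R]_n})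
  (brownian1 : brownian W1) (brownian2 : brownian W2)
  (W12_indep : independent_processes W1 W2)
  (X U : R * R -> 'rV[R]_n -> 'rV[R]_n -> R -> {RV Pr >-> 'rV[R]_n})
  (XU_sol : forall sigma s v, noise sigma ->
     sde_solution W1 W2 sigma s v (X sigma s v) (U sigma s v))
  (u0 : 'rV[R]_n -> 'rV[R]_n) (u0_C1 : C1 u0) (u0_bounded : bounded_fun u0)
  (rho0 : 'rV[R]_n -> R) (rho0_L1_loc : L1_loc rho0)
  (rho0_bounded : bounded_fun rho0) (rho0_ge0 : forall x, 0 <= rho0 x)
  (rho0_neq0 : ~ {ae lebesgue_rV R n, forall x, rho0 x = 0})
  (tstar : \bar R) (tstar_gt0 : (0 < tstar)%E)
  (u0_smooth : keeps_smoothness u0 tstar)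
  (P : R * R -> R -> R.-ftker 'rV[R]_n ~> 'rV[R]_n)
  (P_density : forall sigma t, noise sigma -> 0 < t ->
     is_density (joint_distribution rho0 u0 (X sigma) (U sigma) t) (P sigma t))
  (rho : R -> 'rV[R]_n -> R) (ubar : R -> 'rV[R]_n -> 'rV[R]_n)
  (rho_lim : forall t x, spacetime tstar (t, x) ->
     rho_sigma rho0 (P sigma) t x
       @[sigma --> within (@noise R) (nbhs (0 : R * R))] --> rho t x)
  (ubar_lim : forall t x, spacetime tstar (t, x) ->
     u_sigma u0 (P sigma) t x
       @[sigma --> within (@noise R) (nbhs (0 : R * R))] --> ubar t x)
  (rho_C1 : C1_spacetime tstar rho) (rho_bd : bounded_spacetime tstar rho)
  (ubar_C1 : C1_spacetime tstar ubar)
  (ubar_bd : bounded_spacetime tstar ubar) :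
  pressureless_gas tstar rho ubar.
Proof.
have [u uB usm] := u0_smooth.
have uC1 t (t0 : 0 < t) tT := (usm t t0 tT).1.
have [uC u00 _] := uB.
have [M u0M] : exists M : R, forall x, `|u0 x| <= M.
  by have [M u0M] := bounded_setP u0_bounded; exists M => x; exact: u0M.
have [K rho0K] : exists K : R, forall x, `|rho0 x| <= K.
  by have [K rho0K] := bounded_setP rho0_bounded; exists K => x; exact: rho0K.
have [Cr rhoCr] := bounded_setP rho_bd.
have [Cu ubarCu] := bounded_setP ubar_bd.
have mrho0 := rho0_L1_loc.1.
have mu0 : measurable_fun setT u0.
  apply: measurable_fun_coordP => i; apply: continuous_measurable_rV => x.
  have cu0 := differentiable_continuous (u0_C1.1 x).
  exact: (continuous_comp cu0 (@coord_continuous R 1 n 0 i (u0 x))).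
(* the limits are computed along a sequence of noises without effect on the velocity *)
have noise_k k : @noise R (harmonic k, 0).
  by split => //=; rewrite xpair_eqE /= invr_eq0 pnatr_eq0.
have rho_lim_k t x : 0 <= t -> (t%:E < tstar)%E ->
    rho_sigma rho0 (P (harmonic k, 0)) t x @[k --> \oo] --> rho t x.
  by move=> t0 tT; exact: cvg_comp _ _ (@cvg_degenerate_noise R) (rho_lim t x (conj t0 tT)).
have ubar_lim_k t x : 0 <= t -> (t%:E < tstar)%E ->
    u_sigma u0 (P (harmonic k, 0)) t x @[k --> \oo] --> ubar t x.
  by move=> t0 tT; exact: cvg_comp _ _ (@cvg_degenerate_noise R) (ubar_lim t x (conj t0 tT)).
have crho t : 0 <= t -> (t%:E < tstar)%E -> continuous (rho t).
  by have [c _ _ _] := rho_C1; exact: spacetime_slice.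
have cubar t i : 0 <= t -> (t%:E < tstar)%E -> continuous (fun x => ubar t x 0 i).
  have [c _ _ _] := C1_spacetime_coord i ubar_C1.
  exact: (@spacetime_slice R n tstar _ (fun t x => ubar t x 0 i) t c).
have cu t i : 0 <= t -> (t%:E < tstar)%E -> continuous (fun x => u t x 0 i).
  have [c _ _ _] := C1_spacetime_coord i uC.
  exact: (@spacetime_slice R n tstar _ (fun t x => u t x 0 i) t c).
pose F t (s : 'rV[R]_n) := s + t *: u0 s.
have mF t : measurable_fun setT (F t).
  apply: measurable_fun_coordP => i; under eq_fun do rewrite !mxE.
  apply: measurable_funD; first exact: measurable_coord.
  by apply: measurable_funM => //; exact: (measurableT_comp (measurable_coord i)).
have F_near t s : 0 <= t -> `|F t s - s| <= t * M.
  by move=> t0; rewrite /F addrC addKr normrZ ger0_norm// ler_wpM2l.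
have F_expanding t : 0 < t -> (t%:E < tstar)%E -> forall r, exists2 L : R, 0 <= L &
    forall x y, `|F t x| <= r -> `|F t y| <= r -> `|x - y| <= L * `|F t x - F t y|.
  move=> t0 tT r; have [L L0 uL] := burgers_lipschitz uB uC1 r t0 tT.
  exists (1 + t * L) => [|x y xr yr]; first by rewrite addr_ge0// mulr_ge0// ltW.
  have FK s : s = F t s - t *: u t (F t s).
    by rewrite (burgers_characteristic uB uC1)// ?ltW// addrK.
  have -> : x - y = (F t x - F t y) - t *: (u t (F t x) - u t (F t y)).
    by rewrite {1}[x]FK {1}[y]FK scalerBr; apply/rowP => i; rewrite !mxE; ring.
  rewrite (le_trans (ler_normB _ _))// mulrDl mul1r lerD2l normrZ gtr0_norm//.
  by rewrite -mulrA ler_wpM2l// ?uL// ltW.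
have Pd t : 0 < t -> forall k A B, measurable A -> measurable B ->
    (\int[lebesgue_rV R n]_(x in A) P (harmonic k, 0%R) t x B =
     \int[lebesgue_rV R n]_s ((rho0 s)%:E *
       Pr [set w | A (F t s + harmonic k *: W1 t w)%R /\ B (u0 s)]))%E.
  move=> t0 k A B mA mB; rewrite -(P_density _ _ (noise_k k) t0).1//.
  apply: (joint_distribution_no_velocity_noise (W2 := W2)) => //; first exact: ltW.
  by move=> s v; exact: XU_sol.
have rho_lim_pos t x : 0 < t -> (t%:E < tstar)%E ->
    \int[P (harmonic k, 0) t x]_v (1 : R) @[k --> \oo] --> rho t x.
  by move=> t0 tT; have := rho_lim_k t x (ltW t0) tT; rewrite /rho_sigma gt_eqF.
have ubar_lim_pos t x i : 0 < t -> (t%:E < tstar)%E ->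
    (\int[P (harmonic k, 0) t x]_v (1 : R))^-1 *
    \int[P (harmonic k, 0) t x]_v (v 0 i) @[k --> \oo] --> ubar t x 0 i.
  move=> t0 tT; have := ubar_lim_k t x (ltW t0) tT; rewrite /u_sigma gt_eqF//.
  move=> /(cvg_comp _ (fun v : 'rV[R]_n => v 0 i)).
  move=> /(_ _ (@coord_continuous _ _ _ 0 i _)); apply: cvg_trans.
  by apply: near_eq_cvg; apply: nearW => k /=; rewrite !mxE.
have rho_init x : rho 0 x = rho0 x.
  have := rho_lim_k 0 x (lexx _) tstar_gt0; rewrite /rho_sigma eqxx => c.
  by apply: (cvg_unique _ c) => //; exact: cvg_cst.
have ubar_init x : ubar 0 x = u0 x.
  have := ubar_lim_k 0 x (lexx _) tstar_gt0; rewrite /u_sigma eqxx => c.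
  by apply: (cvg_unique _ c) => //; exact: cvg_cst.
have P_cont t k : 0 < t -> forall phi : 'rV[R]_n -> R, continuous phi ->
    bounded_fun phi -> continuous (fun x => \int[P (harmonic k, 0) t x]_v phi v).
  by move=> t0; have [] := P_density _ _ (noise_k k) t0.
apply: (@transport_pressureless_gas R n tstar u0 u rho0 rho ubar K M) => //.
- move=> t phi r; rewrite le_eqVlt => /predU1P[<- _ _ _|t0 tT cphi phir].
    by apply: eq_Rintegral => x _; rewrite scale0r addr0 rho_init.
  apply: (@density_pushforward _ T R n Pr (F t) u0 (W1 t) rho0
    (fun k => P (harmonic k, 0) t) K (t * M) _ _ _ _ _ _ _ _ _ _ (rho t) Cr _ _ _ phi r) => //.
  + by move=> s; exact: le_trans (ler_norm _) (rho0K s).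
  + by move=> s; exact: F_near (ltW t0).
  + exact: F_expanding.
  + exact: Pd.
  + by move=> k; exact: P_cont.
  + by move=> x; exact: rho_lim_pos.
  + by move=> x; exact: (rhoCr (t, x) (conj (ltW t0) tT)).
  + exact: (crho _ (ltW t0) tT).
- move=> t x i; rewrite le_eqVlt => /predU1P[<- _|t0 tT].
    by rewrite ubar_init u00.
  apply: (@limit_velocity _ T R n Pr (F t) u0 (u t) (W1 t) rho0
    (fun k => P (harmonic k, 0) t) K M (t * M) _ _ _ _ _ _ _ _ _ _ _ (rho t) (ubar t)
    (Num.max Cr Cu)) => //.
  + by move=> s; exact: le_trans (ler_norm _) (rho0K s).
  + by move=> s; exact: F_near (ltW t0).
  + exact: F_expanding.
  + exact: Pd.
  + by move=> k; exact: P_cont.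
  + by move=> y; exact: rho_lim_pos.
  + by move=> y j; exact: ubar_lim_pos.
  + by move=> y; rewrite le_max (rhoCr (t, y) (conj (ltW t0) tT)).
  + by move=> y; rewrite le_max (ubarCu (t, y) (conj (ltW t0) tT)) orbT.
  + exact: (crho _ (ltW t0) tT).
  + by move=> j; exact: (cubar _ j (ltW t0) tT).
  + by move=> j; exact: (cu _ j (ltW t0) tT).
  + by move=> s; apply: (burgers_characteristic uB uC1) => //; exact: ltW.
Qed.
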